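(* Let $d\in\mathbb{N}$ and consider the risk model $${\bf U}(t)=x\,{\bf l}+\int_{0-}^t e^{-rs}{\bf p}(s)\,ds-{\bf D}_r(t),\qquad t\ge0,$$ with initial capital $x>0$, weights ${\bf l}=(l_1,\dots,l_d)$, premium densities ${\bf p}(t)=(p_1(t),\dots,p_d(t))$ and discounted aggregate claims ${\bf D}_r(t)=\sum_{i=1}^{N(t)}{\bf X}^{(i)}e^{-r\tau_i}$, as specified in the context. Let $L\subset\mathbb{R}^d$ be open, decreasing (i.e. $-L$ is increasing), with convex complement $L^c$, with ${\bf 0}\in\partial L$, and with $kL=L$ for every $k>0$; and suppose that $A={\bf l}-L=\{{\bf l}-{\bf y}:{\bf y}\in L\}$ belongs to $\mathscr{R}$. Let $$\psi_{{\bf l},L}(x,t)=\mathbf{P}\left[{\bf U}(s)\in L\text{ for some }s\in[0,t]\right].$$ Assume that the sequence $\{{\bf X}^{(i)},\,i\in\mathbb{N}\}$ and the process $\{N(t),\,t\ge0\}$ are independent. (i) If $r\ge0$ and $F\in\mathcal{S}_A$, then for every fixed $T\in\Lambda$, $$\psi_{{\bf l},L}(x,t)\sim\int_0^t\mathbf{P}\left[{\bf X}\in x\,e^{rs}A\right]\lambda(ds),\qquad x\to\infty,$$ uniformly for all $t\in\Lambda_T=\Lambda\cap(0,T]$. (ii) If $F\in\mathcal{A}_A$, there exists $\varepsilon>0$ with $\mathbf{P}[\theta_1>\varepsilon]=1$, and $r>0$, then the same asymptotic relation holds uniformly for all $t\in\Lambda$.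
   Context: Model. The claim vectors ${\bf X}^{(i)}=(X^{(i)}_1,\dots,X^{(i)}_d)$, $i\in\mathbb{N}$, are i.i.d. with common distribution $F$ (generic copy ${\bf X}$) and take values in $[0,\infty)^d$; they may have some zero components but not all components equal to zero. The components of one vector may be arbitrarily dependent. The $i$-th claim vector arrives at time $\tau_i$, with $\tau_0=0$; the inter-arrival times $\theta_i=\tau_i-\tau_{i-1}$, $i\ge1$, are i.i.d., non-negative and not degenerate at zero. $N(t)=\sup\{n:\tau_n\le t\}$ is the renewal counting process and $\lambda(t)=\mathbf{E}[N(t)]=\sum_{i=1}^\infty\mathbf{P}[\tau_i\le t]<\infty$ its renewal function. $\Lambda=\{t\ge0:\lambda(t)>0\}=\{t\ge 0:\mathbf{P}[\tau_1\le t]>0\}$. Integrals $\int_0^t\cdot\,\lambda(ds)$ are over the closed interval $[0,t]$ (a possible atom of $\lambda$ at $0$ is included), with respect to the measure $B\mapsto\sum_{i\ge1}\mathbf{P}[\tau_i\in B]$. The number $r\ge 0$ is the constant interest force. The weights $l_1,\dots,l_d>0$ are deterministic with $\sum_{i=1}^d l_i=1$. For each $i=1,\dots,d$ the premium density satisfies $0\le p_i(t)\le C_i$ for all $t\ge0$, for a constant $C_i\in(0,\infty)$; the premium process may be random and arbitrarily dependent on the other sources of randomness. The integral of ${\bf p}$ is taken componentwise. Sets. A set $A\subset\mathbb{R}^d$ is increasing if ${\bf x}\in A$ and ${\bf y}\in[0,\infty)^d$ imply ${\bf x}+{\bf y}\in A$. $\mathscr{R}$ is the family of all sets $A\subsetneq\mathbb{R}^d$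 that are open, increasing, have convex complement $A^c$, and satisfy ${\bf 0}\notin\overline{A}$. For $x>0$, $xA=\{x{\bf a}:{\bf a}\in A\}$. Distribution classes. For $A\in\mathscr{R}$ and a random vector ${\bf X}$ in $[0,\infty)^d$ with distribution $F$, let $Y_A=\sup\{u>0:{\bf X}\in uA\}$ (with $\sup\emptyset=0$), and let $F_A$ be the distribution of $Y_A$; its tail is $\overline{F}_A(x)=1-F_A(x)=\mathbf{P}[{\bf X}\in xA]$ for $x>0$. All univariate distributions $V$ in the classes considered satisfy $\overline V(x)>0$ for all $x$. $F\in\mathcal{S}_A$ means that $F_A$ is subexponential: $\lim_{x\to\infty}\overline{F_A^{n*}}(x)/\overline{F}_A(x)=n$ for any (equivalently, some) integer $n\ge2$, where $F_A^{n*}$ is the $n$-fold convolution of $F_A$. $F\in\mathcal{A}_A$ means that $F\in\mathcal{S}_A$ and, in addition, $F_A$ is positively decreasing: $\limsup_{x\to\infty}\overline{F}_A(vx)/\overline{F}_A(x)<1$ for some $v>1$. Uniformity. $f(x,t)\sim g(x,t)$ uniformly for $t\in E$ means $\lim_{x\to\infty}\sup_{t\in E}\left|f(x,t)/g(x,t)-1\right|=0$. *)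

(* Defs.v *)
From HB Require Import structures.
From mathcomp Require Import all_boot all_order all_algebra.
From mathcomp Require Import finmap.
From mathcomp Require Import all_classical all_reals all_analysis.
From mathcomp Require Import measurable_realfun.

Set Implicit Arguments.
Unset Strict Implicit.
Unset Printing Implicit Defensive.

Import Order.TTheory GRing.Theory Num.Theory.
Import numFieldNormedType.Exports.

Local Open Scope classical_set_scope.
Local Open Scope ring_scope.

Section Sets.
Context {R : realType} {d : nat}.
Implicit Types A L : set 'rV[R]_d.

Definition increasing_set A :=
  forall x y : 'rV[R]_d, A x -> (forall j, 0 <= y 0 j) -> A (x + y).

Definition decreasing_set L := increasing_set [set - y | y in L].

Definition convex_complement A :=
  convex_set (~` A : set (convex_lmodType 'rV[R]_d)).

Definition boundary A : set 'rV[R]_d := closure A `\` interior A.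

Definition dilation (k : R) A : set 'rV[R]_d := [set k *: a | a in A].

(* The family written as a script R in the literature. *)
Definition ruin_family A :=
  [/\ A != setT, open A, increasing_set A, convex_complement A
    & ~ closure A 0].

End Sets.

(* R^d with its Borel sigma-algebra. *)
Definition borel_rV (R : realType) (d : nat) :=
  g_sigma_algebraType (@open 'rV[R]_d).

Section UnivariateDistributions.
Context {R : realType}.
Implicit Types V W : set R -> \bar R.

Definition tail V (x : R) : R := fine (V `]x, +oo[%classic).

Definition convolution V W : set R -> \bar R :=
  pushforward (V \x W)%E (fun z : R * R => z.1 + z.2).

Fixpoint convolution_power V (n : nat) : set R -> \bar R :=
  if n is m.+1 then convolution V (convolution_power V m) else \d_(0 : R).

Definition subexponential V :=
  (forall x, 0 < tail V x) /\
  forall n, (2 <= n)%N ->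
    tail (convolution_power V n) x / tail V x @[x --> +oo] --> (n%:R : R).

Definition positively_decreasing V :=
  exists2 v : R, 1 < v &
    (limf_esup (fun x : R => (tail V (v * x) / tail V x)%:E)
       (pinfty_nbhs R) < 1)%E.

End UnivariateDistributions.

Section MultivariateClasses.
Context {R : realType} {d : nat}.
Implicit Types (A : set 'rV[R]_d) (F : set (borel_rV R d) -> \bar R).

(* The set of u is bounded above as soon as 0 is not in the closure of A,
   and the real supremum of the empty set is 0. *)
Definition Y_ A (x : borel_rV R d) : R := sup [set u | 0 < u /\ dilation u A x].

Definition F_ A F : set R -> \bar R := pushforward F (Y_ A).

Definition class_S A F := subexponential (F_ A F).

Definition class_A A F := class_S A F /\ positively_decreasing (F_ A F).

End MultivariateClasses.

Section Independence.
Context {R : realType} {dT : measure_display} {T : measurableType dT}.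
Variable P : probability T R.

Definition mutually_independent (d' : measure_display) (V : measurableType d')
    (X : nat -> T -> V) :=
  forall (J : {fset nat}) (B : nat -> set V), (forall i, measurable (B i)) ->
    P (\bigcap_(i in [set` J]) (X i @^-1` B i)) =
    (\prod_(i <- J) P (X i @^-1` B i))%E.

Definition identically_distributed (d' : measure_display)
    (V : measurableType d') (X : nat -> T -> V) :=
  forall i (B : set V), measurable B -> P (X i @^-1` B) = P (X 0%N @^-1` B).

Definition iid (d' : measure_display) (V : measurableType d')
    (X : nat -> T -> V) :=
  mutually_independent X /\ identically_distributed X.

Definition sigma_of (I : Type) (D : set I) (d' : measure_display)
    (V : measurableType d') (X : I -> T -> V) : set (set T) :=
  <<s \bigcup_(i in D) preimage_set_system setT (X i) measurable >>.

Definition independent_systems (G H : set (set T)) :=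
  forall A B, G A -> H B -> P (A `&` B) = (P A * P B)%E.

End Independence.

(* Sequences indexed by i >= 1 in the mathematics are indexed from 0 here:
   theta k is the (k+1)-st inter-arrival time and X i the (i+1)-st claim, which
   arrives at time tau theta i.+1. *)
Section RiskModel.
Context {R : realType} {dT : measure_display} {T : measurableType dT}.
Variable P : probability T R.
Variable theta : nat -> T -> R.

Definition tau (n : nat) (w : T) : R := \sum_(k < n) theta k w.

Definition N_ (t : R) (w : T) : \bar R :=
  ereal_sup [set n%:R%:E | n in [set n | tau n w <= t]].

Definition renewal_function (t : R) : \bar R := (\int[P]_w N_ t w)%E.

Definition Lambda : set R := [set t | 0 <= t /\ (0 < renewal_function t)%E].

Definition renewal_measure : set R -> \bar R :=
  fun B => (\sum_(1 <= i <oo) P (tau i @^-1` B))%E.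

Context {d : nat}.
Variables (X : nat -> T -> 'rV[R]_d) (p : 'I_d -> T -> R -> R).
Variables (r : R) (l : 'rV[R]_d).

(* N_ t is finite almost surely; where it is infinite the number of terms, and
   hence the sum, is 0. *)
Definition D_ (t : R) (w : T) : 'rV[R]_d :=
  \sum_(i < Num.truncn (fine (N_ t w))) expR (- r * tau i.+1 w) *: X i w.

Definition U_ (x t : R) (w : T) : 'rV[R]_d :=
  x *: l
  + \row_j (\int[lebesgue_measure]_(s in `[0, t]) (expR (- r * s) * p j w s))
  - D_ t w.

Definition ruin_probability (L : set 'rV[R]_d) (x t : R) : R :=
  fine (P [set w | exists2 s, 0 <= s <= t & L (U_ x s w)]).

Definition claim_integral (A : set 'rV[R]_d) (x t : R) : R :=
  fine (\int[renewal_measure]_(s in `[0%R, t])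
          P [set w | dilation (x * expR (r * s)) A (X 0%N w)])%E.

End RiskModel.

(* Adjoining 0 only makes the supremum over an empty E equal to 0; it changes
   nothing otherwise, since the other elements are nonnegative. *)
Definition uniformly_equivalent (R : realType) (f g : R -> R -> R)
    (E : set R) :=
  ereal_sup ([set 0%E] `|` [set `|f x t / g x t - 1|%:E | t in E])
    @[x --> +oo] --> 0%E.

(* Main.v *)
Require Import Defs.
From mathcomp Require Import all_boot all_order all_algebra finmap.
From mathcomp Require Import all_classical all_reals all_analysis.
From mathcomp Require Import measurable_realfun ring lra.

(** Since [L] is a cone, the surplus lies in [L] exactly when the discounted
claims minus the discounted premiums lie in [x A].  The gauge [Y_A], that is
[y |-> sup {u > 0 : y \in u A}], is subadditive and positively homogeneous,
because the complement of [A] is convex and contains [0].  Hence ruin before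
[t] forces the scalar sum of the [Y_i exp(-r tau_i)] over the arrivals up to
[t] to exceed [x], where [Y_i] is the gauge of the i-th claim ([ruin_sum]).
Conversely, the premiums earned up to a finite time are dominated by a multiple
[c l] of [l], and [x A + c l = (x + c) A], so that one discounted claim of gauge
above [x + c] already causes ruin ([big_claim_ruin]).  What remains is scalar:
both bounds must be compared with the expected number of claims that arrive
before [t] and satisfy [Y_i exp(-r tau_i) > x], and this number is the integral
in the statement ([claim_integralE]).

The arrival times are independent of the claims and can be frozen
([prob_decoupling]).  It then suffices to bound the tail of a sum
[\sum_i v_i Y_i] with deterministic nonincreasing weights, uniformly in the
weights.  The engine is [add_jump]: if the tail of [W] is at most a mixture of
the tails of [c_j Y] and [w] is at most every [c_j], then
[P(W + w Y > x) <= (1 + d) (mixture + P(w Y > x))] for large [x], the threshold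
being independent of the weights as long as they stay in [[a, 1]].  It follows
from the two faces of subexponentiality: the tail is long ([long_tailed]), and
two independent copies are rarely both large when their sum is
([two_big_jumps]).  Iterating it gives the sharp bound for boundedly many
weights ([survival_add_claims_le]) and the bound [K (1 + eta)^n Fbar(x)] of
Kesten for [n] summands ([kesten_sum]).

On a finite horizon, having many arrivals is exponentially unlikely.  The
estimates must be relative to the contribution of the first claim,
[E[Fbar(x exp(r tau_1)); tau_1 <= t]], and not to [Fbar(x)], which may be of a
larger order than the integral; [first_discount_bound] supplies this by
separating the first gap from the later ones.  Kesten's bound with a small
[eta] is then summable against the renewal probabilities
([upper_finite_horizon]).  In the other direction, independence makes the event
that some claim is big almost as likely as the sum of the single
probabilities, and the long tail absorbs the shift [c]
([lower_finite_horizon]).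

On the infinite horizon, gaps larger than [eps] make the weights decay
geometrically.  For a positively decreasing tail, the whole discounted series
has a tail of order [Fbar(x)] ([discounted_sum_bound]).  Normalising by the
first weight, the claims with weights below a small level therefore contribute
a negligible tail, and boundedly many weights remain: this bounds the ruin
probability from above for all [t] at once ([upper_infinite_horizon]).  From
below, the arrivals after a large time contribute a negligible part of the
integral ([long_horizon_negligible]), which reduces the claim to the finite
horizon. *)

Set Implicit Arguments.
Unset Strict Implicit.
Unset Printing Implicit Defensive.

Import Order.TTheory GRing.Theory Num.Theory.
Import numFieldNormedType.Exports.

Local Open Scope classical_set_scope.
Local Open Scope ring_scope.

(** * Bounded expectations and survival functions *)

Section BoundedExpectation.
Context {R : realType} {dT : measure_display} {T : measurableType dT}.
Variable P : probability T R.
Implicit Types (f g : T -> R) (B : T -> bool).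

Lemma mem_set_bool B w : (w \in [set w | B w]) = B w.
Proof. by apply/idP/idP; rewrite inE. Qed.

Definition prob (B : set T) : R := fine (P B).

Definition mean f : R := \int[P]_w f w.

(** Over a probability measure, this class is closed under the operations used
below and contains only integrable functions, so that [mean] is linear and
monotone on it without integrability side conditions. *)
Definition bounded_measurable f :=
  measurable_fun setT f /\ exists M, forall w, `|f w| <= M.

Lemma probE (B : set T) : measurable B -> P B = (prob B)%:E.
Proof. by move=> mB; rewrite fineK// fin_num_measure. Qed.

Lemma prob_ge0 (B : set T) : 0 <= prob B.
Proof. by rewrite fine_ge0// measure_ge0. Qed.

Lemma prob_le1 (B : set T) : measurable B -> prob B <= 1.
Proof. by move=> mB; rewrite -lee_fin -probE// probability_le1. Qed.

Lemma le_prob (A B : set T) : measurable A -> measurable B -> A `<=` B ->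
  prob A <= prob B.
Proof. by move=> mA mB AB; rewrite -lee_fin -!probE// le_measure// inE. Qed.

Lemma bounded_measurable_integrable f :
  bounded_measurable f -> P.-integrable setT (EFin \o f).
Proof.
move=> [mf [M fM]]; apply: measurable_bounded_integrable => //.
  by apply: le_lt_trans (ltry 1); exact: probability_le1.
by exists M; split; [exact: num_real|move=> x Mx w _ /=; rewrite (le_trans (fM w))// ltW].
Qed.

Lemma bounded_measurable_cst (c : R) : bounded_measurable (fun=> c).
Proof. by split; [exact: measurable_cst|exists `|c|]. Qed.

Lemma bounded_measurableD f g : bounded_measurable f -> bounded_measurable g ->
  bounded_measurable (fun w => f w + g w).
Proof.
move=> [mf [M fM]] [mg [N gN]]; split; first exact: measurable_funD.
by exists (M + N) => w; rewrite (le_trans (ler_normD _ _))// lerD.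
Qed.

Lemma bounded_measurableM f g : bounded_measurable f -> bounded_measurable g ->
  bounded_measurable (fun w => f w * g w).
Proof.
move=> [mf [M fM]] [mg [N gN]]; split; first exact: measurable_funM.
by exists (M * N) => w; rewrite normrM ler_pM.
Qed.

Lemma bounded_measurable_sum (I : Type) (s : seq I) (F : I -> T -> R) :
  (forall i, bounded_measurable (F i)) ->
  bounded_measurable (fun w => \sum_(i <- s) F i w).
Proof.
move=> bF; elim: s => [|i s IH].
  by under eq_fun do rewrite big_nil; exact: bounded_measurable_cst.
by under eq_fun do rewrite big_cons; exact: bounded_measurableD.
Qed.

Lemma bounded_measurable_bool B : measurable [set w | B w] ->
  bounded_measurable (fun w => (B w)%:R).
Proof.
move=> mB; split; last by exists 1 => w; case: (B w); rewrite ?normr0 ?normr1.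
rewrite (_ : (fun w => _) = \1_[set w | B w]); first exact: measurable_indic.
by apply/funext => w; rewrite indicE mem_set_bool.
Qed.

Lemma meanD f g : bounded_measurable f -> bounded_measurable g ->
  mean (fun w => f w + g w) = mean f + mean g.
Proof.
by move=> /bounded_measurable_integrable ? /bounded_measurable_integrable ?;
  rewrite /mean RintegralD.
Qed.

Lemma meanZ c f : bounded_measurable f -> mean (fun w => c * f w) = c * mean f.
Proof. by move=> /bounded_measurable_integrable ?; rewrite /mean RintegralZl. Qed.

Lemma mean_cst c : mean (fun=> c) = c.
Proof. by rewrite /mean Rintegral_cst//= probability_setT mulr1. Qed.

Lemma mean_sum (I : Type) (s : seq I) (F : I -> T -> R) :
  (forall i, bounded_measurable (F i)) ->
  mean (fun w => \sum_(i <- s) F i w) = \sum_(i <- s) mean (F i).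
Proof.
move=> bF; elim: s => [|i s IH].
  by under [X in mean X]eq_fun do rewrite big_nil; rewrite mean_cst big_nil.
under [X in mean X]eq_fun do rewrite big_cons.
by rewrite meanD// ?IH ?big_cons//; exact: bounded_measurable_sum.
Qed.

Lemma mean_bool B : measurable [set w | B w] ->
  mean (fun w => (B w)%:R) = prob [set w | B w].
Proof.
move=> mB; rewrite /mean /Rintegral /prob; congr fine.
rewrite -[in RHS](setIT [set w | B w]) -integral_indic//; apply: eq_integral.
by move=> w _; rewrite indicE mem_set_bool.
Qed.

Lemma le_mean f g : bounded_measurable f -> bounded_measurable g ->
  (forall w, f w <= g w) -> mean f <= mean g.
Proof.
by move=> /bounded_measurable_integrable ? /bounded_measurable_integrable ? fg;
  rewrite /mean le_Rintegral.
Qed.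

Lemma mean_ge0 f : (forall w, 0 <= f w) -> 0 <= mean f.
Proof. by move=> f0; rewrite /mean Rintegral_ge0. Qed.

Lemma eq_mean f g : f =1 g -> mean f = mean g.
Proof. by move=> /funext ->. Qed.

Lemma mean_EFin f : bounded_measurable f -> (forall w, 0 <= f w) ->
  (\int[P]_w (f w)%:E)%E = (mean f)%:E.
Proof.
move=> /bounded_measurable_integrable bf f0; rewrite fineK//.
exact: integrable_fin_num.
Qed.

Lemma prob_neg B : measurable [set w | B w] ->
  prob [set w | ~~ B w] = 1 - prob [set w | B w].
Proof.
move=> mB; apply: EFin_inj; rewrite EFinB -!probE//.
  by rewrite -probability_setC//; congr (P _); apply/seteqP; split=> w /= /negP.
by rewrite (_ : [set w | _] = ~` [set w | B w]); [exact: measurableC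
  |apply/seteqP; split=> w /= /negP].
Qed.

End BoundedExpectation.

#[local] Hint Resolve bounded_measurable_cst : core.

Section Survival.
Context {R : realType} {dT : measure_display} {T : measurableType dT}.
Variable P : probability T R.
Implicit Types Z : T -> R.

Definition survival Z (x : R) : R := prob P [set w | x < Z w].

Lemma measurable_gt Z x : measurable_fun setT Z -> measurable [set w | x < Z w].
Proof.
move=> mZ; have := mZ measurableT _ (measurable_itv `]x, +oo[).
rewrite setTI; congr measurable; apply/seteqP; split => w /=;
by rewrite in_itv/= andbT.
Qed.

Lemma survival_ge0 Z x : 0 <= survival Z x.
Proof. exact: prob_ge0. Qed.

Lemma survival_le1 Z x : measurable_fun setT Z -> survival Z x <= 1.
Proof. by move=> mZ; apply/prob_le1/measurable_gt. Qed.

Lemma survival_mono Z x y : measurable_fun setT Z -> x <= y ->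
  survival Z y <= survival Z x.
Proof.
move=> mZ xy; apply: le_prob; try exact: measurable_gt.
by move=> w /=; exact: le_lt_trans.
Qed.

Lemma le_survival Z Z' x : measurable_fun setT Z -> measurable_fun setT Z' ->
  (forall w, Z w <= Z' w) -> survival Z x <= survival Z' x.
Proof.
move=> mZ mZ' ZZ'; apply: le_prob; try exact: measurable_gt.
by move=> w /= /lt_le_trans; exact.
Qed.

Lemma survival_neg Z x : (forall w, 0 <= Z w) -> x < 0 -> survival Z x = 1.
Proof.
move=> Z0 x0; rewrite /survival (_ : [set w | _] = setT); first by rewrite /prob probability_setT.
by apply/seteqP; split => // w _ /=; exact: lt_le_trans (Z0 w).
Qed.

Lemma survival_scale Z c x : 0 < c -> survival (fun w => c * Z w) x = survival Z (x / c).
Proof.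
move=> c0; congr (prob P _); apply/seteqP; split => w /=.
  by rewrite ltr_pdivrMr// mulrC.
by rewrite ltr_pdivrMr// mulrC.
Qed.

Lemma measurable_survival Z : measurable_fun setT Z -> measurable_fun setT (survival Z).
Proof.
by move=> mZ; apply: nonincreasing_measurable => // x y; exact: survival_mono.
Qed.

Lemma cvg_survival Z : measurable_fun setT Z -> survival Z x @[x --> +oo] --> (0:R).
Proof.
move=> mZ.
have mS n : measurable [set w | (n%:R:R) < Z w] by exact: measurable_gt.
have H : (P \o (fun n : nat => [set w | (n%:R:R) < Z w])) n @[n --> \oo] --> P (\bigcap_n [set w | (n%:R:R) < Z w]).
  apply: nonincreasing_cvg_mu => //.
  - by apply: le_lt_trans (ltry 1); exact: probability_le1.
  - exact: bigcap_measurable.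
  - move=> m n mn; apply/subsetPset => w /=; apply: le_lt_trans.
    by rewrite ler_nat.
have E0 : \bigcap_n [set w | (n%:R:R) < Z w] = set0.
  apply/seteqP; split => // w /= /(_ (Num.truncn (Z w)).+1 I) /=.
  by have := truncnS_gt (Z w) => /lt_trans h /h; rewrite ltxx.
rewrite E0 measure0 in H.
apply/cvgrPdist_le => e e0.
have /fine_cvg/cvgrPdist_le /(_ e e0) [N _ HN] := H.
near=> x; rewrite sub0r normrN ger0_norm ?survival_ge0//.
have := HN N (leqnn _); rewrite /= sub0r normrN ger0_norm ?fine_ge0//.
by apply: le_trans; apply: survival_mono => //; near: x; exact: nbhs_pinfty_ge.
Unshelve. all: by end_near. Qed.

End Survival.

(** * Long tails and two simultaneous big jumps *)

Section Subexponential.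
Context {R : realType} {dT : measure_display} {T : measurableType dT}.
Variables (P : probability T R) (Y : T -> R).
Hypotheses (mY : measurable_fun setT Y) (Y_ge0 : forall w, 0 <= Y w).

Notation Fb := (survival P Y).

(** The tail of the sum of two independent copies of [Y]. *)
Definition survival_conv2 (x : R) : R := mean P (fun w => Fb (x - Y w)).

(** The half of subexponentiality that carries information: for a distribution on
the half-line, [survival_conv2] is automatically at least asymptotically twice
the tail. *)
Definition asymptotically_double :=
  (forall x, 0 < Fb x) /\
  forall e, 0 < e -> \forall x \near +oo, survival_conv2 x <= (2 + e) * Fb x.

Hypothesis FY : asymptotically_double.

Lemma bounded_measurable_comp (G Z : _ -> R) : measurable_fun [set: R] G ->
  (forall x, 0 <= G x <= 1) -> measurable_fun [set: T] Z ->
  bounded_measurable (fun w => G (Z w)).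
Proof.
move=> mG G01 mZ; split; first exact: measurableT_comp.
by exists 1 => w; have /andP[? ?] := G01 (Z w); rewrite ger0_norm.
Qed.

Lemma bounded_measurable_survival_sub c x :
  bounded_measurable (fun w => Fb (x - c * Y w)).
Proof.
apply: bounded_measurable_comp => [|y|].
- exact: measurable_survival.
- by rewrite survival_ge0 survival_le1.
- by apply: measurable_funB => //; exact: measurable_funM.
Qed.

Lemma bounded_measurable_gt (x : R) : bounded_measurable (fun w => (x < Y w)%R%:R : R).
Proof. exact/bounded_measurable_bool/measurable_gt. Qed.

(** Split the sum of two copies of [Y] according to whether the second copy is in
[[0, h]], in [(h, z]] or above [z].  The three parts contribute at least
[Fbar(z) F(h)], [Fbar(z - h) (F(z) - F(h))] and [Fbar(z)].  As the total is about
[2 Fbar(z)], the middle part leaves room for [Fbar(z - h)] to exceed [Fbar(z)]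
only by a factor close to one. *)
Lemma long_tailed h d : 0 <= h -> 0 < d ->
  \forall x \near +oo, Fb (x - h) <= (1 + d) * Fb x.
Proof.
move=> h0 d0; have [Fpos F2] := FY.
(* chosen so that (1 + e) / (1 - e) = 1 + d *)
pose e := d / (2 + d).
have e0 : 0 < e by rewrite divr_gt0// addr_gt0.
have de : e * (2 + d) = d by rewrite /e divfK// gt_eqF// addr_gt0.
have p0 := Fpos h.
near=> z.
have hz : h <= z by near: z; apply: nbhs_pinfty_ge; exact: num_real.
have Fz : Fb z <= e * Fb h.
  near: z; have /cvgrPdist_le /(_ (e * Fb h)) := cvg_survival P mY.
  rewrite mulr_gt0// => /(_ isT); apply: filterS => x.
  by rewrite sub0r normrN ger0_norm// survival_ge0.
have C : survival_conv2 z <= (2 + e * Fb h) * Fb z.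
  by near: z; apply: F2; rewrite mulr_gt0.
have D : Fb z * (1 - Fb h) + Fb (z - h) * (Fb h - Fb z) + Fb z <= survival_conv2 z.
  have -> : Fb z * (1 - Fb h) + Fb (z - h) * (Fb h - Fb z) + Fb z =
    mean P (fun w => Fb z + (- Fb z + Fb (z - h)) * (h < Y w)%R%:R + (1 - Fb (z - h)) * (z < Y w)%R%:R).
    have b1 := bounded_measurable_gt h; have b2 := bounded_measurable_gt z.
    rewrite !meanD ?meanZ ?mean_cst ?mean_bool//; try exact: measurable_gt;
      try by repeat (apply: bounded_measurableD || apply: bounded_measurableM).
    rewrite -/(survival P Y h) -/(survival P Y z); ring.
  apply: le_mean.
  - by repeat (apply: bounded_measurableD || apply: bounded_measurableM) => //;
      exact: bounded_measurable_gt.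
  - by have := bounded_measurable_survival_sub 1 z; under eq_fun do rewrite mul1r.
  move=> w; case: (ltP h (Y w)) => hY.
    have m1 : Fb (z - h) <= Fb (z - Y w) by apply: survival_mono => //; lra.
    case: (ltP z (Y w)) => zY /=; last lra.
    rewrite (@survival_neg _ _ _ _ _ (z - Y w))//; lra.
  rewrite ltNge (le_trans hY hz) /=.
  have : Fb z <= Fb (z - Y w) by apply: survival_mono => //; have := Y_ge0 w; lra.
  lra.
have Fz0 := Fpos z; have Fzh := survival_ge0 P Y (z - h).
have K : Fb (z - h) * (Fb h - Fb z) <= Fb z * (e * Fb h + Fb h) by lra.
have : Fb (z - h) * (Fb h * (1 - e)) <= Fb z * (Fb h * (1 + e)).
  apply: le_trans (_ : Fb (z - h) * (Fb h - Fb z) <= _); last by lra.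
  by apply: ler_wpM2l => //; lra.
rewrite mulrCA [leRHS]mulrCA ler_pM2l// => H.
have e1 : 0 < 1 - e by nra.
rewrite -(ler_pM2r e1) (le_trans H)//.
have E : 1 + e <= (1 + d) * (1 - e) by lra.
by have := ler_wpM2l (ltW Fz0) E; lra.
Unshelve. all: by end_near. Qed.

(** The left-hand side is the probability that two independent copies both exceed
[h] while their sum exceeds [z].  The sum exceeds [z] with probability about
[2 Fbar(z)], and the cases where one given copy is at most [h], or exceeds [z],
already account for at least [(2 - Fbar(h)) Fbar(z)]. *)
Lemma two_big_jumps e : 0 < e -> \forall h \near +oo, \forall z \near +oo,
  mean P (fun w => Fb (z - Y w) * ((h < Y w) && (Y w <= z - h))%R%:R)
    + Fb h * Fb (z - h) <= e * Fb z.
Proof.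
move=> e0; have [Fpos F2] := FY.
near=> h.
have h0 : 0 <= h by near: h; apply: nbhs_pinfty_ge; exact: num_real.
have Fh : Fb h <= e / 4.
  near: h; have /cvgrPdist_le /(_ (e / 4)) := cvg_survival P mY.
  rewrite divr_gt0// => /(_ isT); apply: filterS => x.
  by rewrite sub0r normrN ger0_norm// survival_ge0.
near=> z.
have hz : h <= z by near: z; apply: nbhs_pinfty_ge; exact: num_real.
have C : survival_conv2 z <= (2 + e / 4) * Fb z.
  by near: z; apply: F2; rewrite divr_gt0.
have LT : Fb (z - h) <= (1 + 1) * Fb z by near: z; exact: long_tailed.
have bJ : bounded_measurable (fun w => Fb (z - Y w) * ((h < Y w) && (Y w <= z - h))%R%:R : R).
  apply: bounded_measurableM.
    by have := bounded_measurable_survival_sub 1 z; under eq_fun do rewrite mul1r.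
  apply: bounded_measurable_bool.
  rewrite (_ : [set w | _] = [set w | h < Y w] `\` [set w | z - h < Y w]).
    by apply: measurableD; exact: measurable_gt.
  apply/seteqP; split => w /=; first by move=> /andP[-> Yw]; split=> //; apply/negP; rewrite -leNgt.
  by move=> [-> /negP]; rewrite -leNgt.
set J := mean _ _.
have D : J + Fb z * (1 - Fb h) + Fb z <= survival_conv2 z.
  have -> : J + Fb z * (1 - Fb h) + Fb z = mean P (fun w => Fb (z - Y w) * ((h < Y w) && (Y w <= z - h))%R%:R + (Fb z + (- Fb z) * (h < Y w)%R%:R + (z < Y w)%R%:R)).
    have b1 := bounded_measurable_gt h; have b2 := bounded_measurable_gt z.
    rewrite !meanD ?meanZ ?mean_cst ?mean_bool//; try exact: measurable_gt;
      try by repeat (apply: bounded_measurableD || apply: bounded_measurableM).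
    rewrite -/(survival P Y h) -/(survival P Y z) -/J; ring.
  apply: le_mean.
  - by repeat (apply: bounded_measurableD || apply: bounded_measurableM) => //;
      try exact: bounded_measurable_gt.
  - by have := bounded_measurable_survival_sub 1 z; under eq_fun do rewrite mul1r.
  move=> w; have G0 := survival_ge0 P Y (z - Y w).
  case: (ltP h (Y w)) => hY /=.
    case: (ltP z (Y w)) => zY /=.
      rewrite (@survival_neg _ _ _ _ _ (z - Y w))//; last lra.
      by case: (leP (Y w) (z - h)) => ? /=; lra.
    by case: (leP (Y w) (z - h)) => ? /=; lra.
  rewrite ltNge (le_trans hY hz) /=.
  have : Fb z <= Fb (z - Y w) by apply: survival_mono => //; have := Y_ge0 w; lra.
  lra.
have Fz0 := Fpos z; have Fzh := survival_ge0 P Y (z - h); have Fh0 := Fpos h.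
have : Fb h * Fb (z - h) <= e / 4 * (2 * Fb z) by apply: ler_pM => //; lra.
have : Fb h * Fb z <= e / 4 * Fb z by apply: ler_wpM2r => //; lra.
lra.
Unshelve. all: by end_near. Qed.

End Subexponential.

(** * Adding one weighted claim *)

Section AddJump.
Context {R : realType} {dT : measure_display} {T : measurableType dT}.
Variables (P : probability T R) (Y : T -> R).
Hypotheses (mY : measurable_fun setT Y) (Y_ge0 : forall w, 0 <= Y w).
Hypothesis FY : asymptotically_double P Y.

Notation Fb := (survival P Y).

Definition tail_mixture (s : seq (R * R)) (x : R) : R :=
  \sum_(z <- s) z.1 * Fb (x / z.2).

Lemma le_div_weight (x c : R) : 0 <= x -> 0 < c -> c <= 1 -> x <= x / c.
Proof. by move=> x0 c0 c1; rewrite ler_pdivlMr// ler_piMr. Qed.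

(** Here [G] plays the tail of a variable [W] independent of [Y].  If [w Y > x - h],
the long tail replaces [x - h] by [x]; if [w Y <= h], then [W > x - h] and the
long tail applies to the mixture.  In between, both terms are large.  Since
[w <= c_j], the term [c_j] of the mixture can be compared with two unweighted
copies of [Y] whose sum exceeds [x / c_j], so [two_big_jumps] makes it a small
fraction of the same term.  The smallest weight has to be added last for this
reason. *)
Lemma add_jump (a d x0 : R) : 0 < a -> 0 < d -> exists x1 : R, forall (w : R) s (G : R -> R),
  a <= w -> w <= 1 ->
  (forall z, z \in s -> [/\ 0 <= z.1, w <= z.2 & z.2 <= 1]) ->
  measurable_fun [set: R] G -> (forall x, 0 <= G x <= 1) ->
  (forall x, x0 <= x -> G x <= tail_mixture s x) ->
  forall x, x1 <= x ->
    mean P (fun u => G (x - w * Y u)) <= (1 + d) * (tail_mixture s x + Fb (x / w)).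
Proof.
move=> a0 d0; have d20 : 0 < d / 2 by rewrite divr_gt0.
have [h [h0 hx0 [M1 [_ HM1]]]] : exists h : R, [/\ 0 <= h, x0 <= h &
    \forall z \near +oo,
    mean P (fun w => Fb (z - Y w) * ((h < Y w) && (Y w <= z - h))%R%:R)
    + Fb h * Fb (z - h) <= d / 2 * Fb z].
  have /(filterI (nbhs_pinfty_ge (num_real x0))) := two_big_jumps mY Y_ge0 FY d20.
  have /[swap]/filterI/[apply] : \forall h \near +oo, (0:R) <= h by apply: nbhs_pinfty_ge.
  move=> [M [_ HM]]; exists (M + 1).
  by have [] := HM (M + 1) (ltr_pwDr ltr01 (lexx _)) => -[].
have [M2 [_ HM2]] := long_tailed mY Y_ge0 FY (divr_ge0 h0 (ltW a0)) d20.
pose x1 := 1 + Num.max (Num.max M1 M2) (2 * h).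
exists x1 => w s G aw w1 Hs mG G01 HG x xx1.
have w0 : 0 < w by exact: lt_le_trans aw.
have : 2 * h < x /\ M1 < x /\ M2 < x.
  have : Num.max (Num.max M1 M2) (2 * h) < x.
    by apply: lt_le_trans xx1; rewrite ltrDr.
  by rewrite !gt_max => /andP[/andP[-> ->] ->].
move=> [xh [xM1 xM2]].
have x0' : 0 <= x by lra.
have Hc c : w <= c -> c <= 1 -> [/\ 0 < c, x <= x / c & Fb ((x - h) / c) <= (1 + d / 2) * Fb (x / c)].
  move=> wc c1; have c0 : 0 < c by exact: lt_le_trans wc.
  have xc := le_div_weight x0' c0 c1; split => //.
  apply: le_trans (HM2 _ (lt_le_trans xM2 xc)).
  apply: survival_mono => //; rewrite mulrBl lerB// ler_wpM2l// lef_pV2 ?posrE//.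
  exact: le_trans wc.
have mJ (c : R) : bounded_measurable (fun w => Fb (x / c - Y w) * ((h < Y w) && (Y w <= x / c - h))%R%:R : R).
  apply: bounded_measurableM.
    by have := bounded_measurable_survival_sub P mY 1 (x / c); under eq_fun do rewrite mul1r.
  apply: bounded_measurable_bool.
  rewrite (_ : [set w | _] = [set w | h < Y w] `\` [set w | x / c - h < Y w]).
    by apply: measurableD; exact: measurable_gt.
  apply/seteqP; split => u /=; first by move=> /andP[-> Yw]; split=> //; apply/negP; rewrite -leNgt.
  by move=> [-> /negP]; rewrite -leNgt.
pose B (z : R * R) u : R := z.1 * (Fb ((x - h) / z.2) +
   (Fb (x / z.2 - Y u) * ((h < Y u) && (Y u <= x / z.2 - h))%R%:R +
    Fb h * (x / z.2 - h < Y u)%R%:R)).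
have mB z : bounded_measurable (B z).
  apply: bounded_measurableM => //; apply: bounded_measurableD => //.
  apply: bounded_measurableD => //.
  by apply: bounded_measurableM => //; exact: bounded_measurable_gt.
have mBs : bounded_measurable (fun u => \sum_(z <- s) B z u).
  exact: bounded_measurable_sum.
have m1 := bounded_measurable_gt mY ((x - h) / w).
apply: (@le_trans _ _ (mean P (fun u => ((x - h) / w < Y u)%R%:R + \sum_(z <- s) B z u))).
  apply: le_mean.
  - apply: bounded_measurable_comp => //; apply: measurable_funB => //.
    exact: measurable_funM.
  - exact: bounded_measurableD.
  move=> u; have Yu := Y_ge0 u; have wY0 : 0 <= w * Y u by rewrite mulr_ge0// ltW.
  have B0 z : z \in s -> 0 <= B z u.
    move=> /Hs[z0 _ _]; rewrite /B mulr_ge0// !addr_ge0 ?mulr_ge0// ?survival_ge0//.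
  case: ltP => xhY /=.
    have /andP[_ G1] := G01 (x - w * Y u); apply: (le_trans G1).
    by rewrite lerDl big_seq sumr_ge0.
  rewrite add0r; have wY : w * Y u <= x - h by rewrite mulrC -ler_pdivlMr.
  apply: le_trans (HG _ _) _; first lra.
  rewrite /tail_mixture big_seq [leRHS]big_seq; apply: ler_sum => z zs.
  have [z0 wz z1] := Hs _ zs; rewrite ler_wpM2l//.
  have [c0 xc _] := Hc _ wz z1.
  have S0 y := survival_ge0 P Y y.
  have [wYh|hwY] := leP (w * Y u) h.
    apply: (@le_trans _ _ (Fb ((x - h) / z.2))).
      by apply: survival_mono => //; rewrite ler_pM2r ?invr_gt0//; lra.
    by rewrite lerDl addr_ge0// mulr_ge0.
  have hY : h < Y u by apply: lt_le_trans hwY _; rewrite ler_piMl.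
  have [Yc|cY] := leP (Y u) (x / z.2 - h); rewrite hY /=.
    rewrite mulr1 -[leLHS]add0r lerD// -[leLHS]addr0 lerD//; last by rewrite mulr_ge0.
    apply: survival_mono => //; rewrite mulrBl lerB// ler_pdivrMr// mulrC.
    by rewrite ler_wpM2l.
  rewrite mulr0 add0r mulr1 -[leLHS]add0r lerD//; apply: survival_mono => //.
  by rewrite ler_pdivlMr// (le_trans (ler_piMr h0 z1))//; lra.
rewrite meanD// mean_bool -?/(survival P Y _); last exact: measurable_gt.
have [_ _ Hw] := Hc _ (lexx w) w1.
rewrite mean_sum// mulrDr addrC lerD//; last first.
  by apply: le_trans Hw _; rewrite ler_wpM2r ?survival_ge0//; lra.
rewrite /tail_mixture mulr_sumr big_seq [leRHS]big_seq; apply: ler_sum => z zs.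
have [z0 wz z1] := Hs _ zs.
have [c0 xc LT] := Hc _ wz z1.
rewrite /B meanZ; last first.
  apply: bounded_measurableD => //; apply: bounded_measurableD => //.
  by apply: bounded_measurableM => //; exact: bounded_measurable_gt.
rewrite mulrCA ler_wpM2l// meanD//; last first.
  by apply: bounded_measurableD => //; apply: bounded_measurableM => //; exact: bounded_measurable_gt.
rewrite mean_cst meanD//; last by apply: bounded_measurableM => //; exact: bounded_measurable_gt.
rewrite meanZ; last exact: bounded_measurable_gt.
rewrite mean_bool -?/(survival P Y _); last exact: measurable_gt.
have := HM1 (x / z.2) (lt_le_trans xM1 xc); lra.
Qed.

End AddJump.

(** * Independence: freezing one source of randomness *)

Section Decoupling.
Context {R : realType} {dT : measure_display} {T : measurableType dT}.
Variable P : probability T R.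
Variables g1 g2 : set (set T).
Hypotheses (mg1 : <<s g1 >> `<=` @measurable _ T)
  (mg2 : <<s g2 >> `<=` @measurable _ T)
  (ind : independent_systems P <<s g1 >> <<s g2 >>).

Notation T1 := (g_sigma_algebraType g1).
Notation T2 := (g_sigma_algebraType g2).

Let mi1 : measurable_fun [set: T] (idfun : T -> T1).
Proof. by move=> _ B mB; rewrite setTI; exact: mg1. Qed.

Let mi2 : measurable_fun [set: T] (idfun : T -> T2).
Proof. by move=> _ B mB; rewrite setTI; exact: mg2. Qed.

Let mdiag : measurable_fun [set: T] (fun w => (w : T1, w : T2)).
Proof. exact: measurable_fun_pair. Qed.

(** The diagonal map pushes [P] forward to the product of the two restrictions of
[P], because these measures agree on rectangles; Tonelli's theorem then gives
the iterated integral.  Working with sub-sigma-algebras of the same space avoids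
any description of the joint law of infinitely many variables. *)
Lemma decoupling (h : T1 * T2 -> \bar R) : measurable_fun setT h ->
  (forall z, 0 <= h z)%E ->
  (\int[P]_w h (w, w) = \int[P]_w1 \int[P]_w2 h (w1, w2))%E.
Proof.
move=> mh h0.
pose i1 : {mfun T >-> T1} := mfun_Sub (mem_set mi1).
pose i2 : {mfun T >-> T2} := mfun_Sub (mem_set mi2).
pose diag : {mfun T >-> (T1 * T2)%type} := mfun_Sub (mem_set mdiag).
transitivity (\int[distribution P diag]_z h z)%E.
  by rewrite ge0_integral_distribution.
transitivity (\int[distribution P i1 \x distribution P i2]_z h z)%E.
  apply: eq_measure_integral => //= A mA _; apply/esym.
  apply: (@product_measure_unique _ _ _ _ _ (distribution P i1) (distribution P i2) (distribution P diag)) ; last by [].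
  by move=> A1 A2 mA1 mA2; have := ind mA1 mA2.
rewrite fubini_tonelli1// /fubini_F ge0_integral_distribution//; last 2 first.
- exact: measurable_fun_fubini_tonelli_F.
- by move=> y; exact: integral_ge0.
apply: eq_integral => w _ /=.
rewrite ge0_integral_distribution//.
by apply: measurableT_comp => //; exact: pair1_measurable.
Qed.

Lemma measurable_decoupling (h : T1 * T2 -> \bar R) : measurable_fun setT h ->
  (forall z, 0 <= h z)%E ->
  measurable_fun [set: T] (fun w1 => \int[P]_w2 h (w1, w2))%E.
Proof.
move=> mh h0.
pose i2 : {mfun T >-> T2} := mfun_Sub (mem_set mi2).
rewrite (_ : (fun w1 => _) = fubini_F (distribution P i2) h \o (idfun : T -> T1)).
  by apply: measurableT_comp => //; exact: measurable_fun_fubini_tonelli_F.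
apply/funext => w /=; rewrite /fubini_F ge0_integral_distribution//.
by apply: measurableT_comp => //; exact: pair1_measurable.
Qed.

Lemma prob_decoupling (B : T1 * T2 -> bool) : measurable [set z | B z] ->
  bounded_measurable (fun w1 : T => prob P [set w2 | B (w1, w2)]) /\
  prob P [set w | B (w, w)] = mean P (fun w1 => prob P [set w2 | B (w1, w2)]).
Proof.
move=> mB.
have mh : measurable_fun setT (fun z => (B z)%:R%:E : \bar R).
  by apply/measurable_EFinP; have [] := @bounded_measurable_bool R _ (T1 * T2)%type _ mB.
have h0 z : (0 <= (B z)%:R%:E :> \bar R)%E by rewrite lee_fin ler0n.
have mB1 w1 : measurable [set w2 : T | B (w1, w2)].
  have := pair1_measurable w1 measurableT mB; rewrite setTI; exact: mg2.
have mBd : measurable [set w : T | B (w, w)].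
  by have := mdiag measurableT mB; rewrite setTI.
have intE w1 : (\int[P]_w2 ((B (w1, w2))%:R)%:E = (prob P [set w2 | B (w1, w2)])%:E)%E.
  rewrite mean_EFin; last 2 first.
  - exact: bounded_measurable_bool.
  - by move=> w; exact: ler0n.
  by rewrite mean_bool.
have bm : bounded_measurable (fun w1 : T => prob P [set w2 | B (w1, w2)]).
  split.
    apply/measurable_EFinP; have := measurable_decoupling mh h0.
    by under eq_fun do rewrite intE.
  by exists 1 => w; rewrite ger0_norm ?prob_ge0 ?prob_le1.
split => //; apply: EFin_inj; rewrite -mean_EFin//; last by move=> w; exact: prob_ge0.
transitivity (\int[P]_w (B (w, w))%:R%:E)%E.
  rewrite (mean_EFin P (@bounded_measurable_bool R _ T (fun w => B (w, w)) mBd)).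
    by rewrite (@mean_bool _ _ _ P (fun w => B (w, w))).
  by move=> w; exact: ler0n.
rewrite (decoupling mh h0); apply: eq_integral => w _; exact: intE.
Qed.

End Decoupling.

Lemma independent_systemsC (R : realType) dT (T : measurableType dT)
  (P : probability T R) (G H : set (set T)) :
  independent_systems P G H -> independent_systems P H G.
Proof. by move=> GH A B HA GB; rewrite setIC muleC GH. Qed.

Section PiLambda.
Context {R : realType} {dT : measure_display} {T : measurableType dT}.
Variable P : probability T R.

Lemma independent_sigma_l (G : set (set T)) (B : set T) :
  G `<=` measurable -> setI_closed G -> G setT -> measurable B ->
  (forall A, G A -> P (A `&` B) = (P A * P B)%E) ->
  forall A, <<s G >> A -> P (A `&` B) = (P A * P B)%E.
Proof.
move=> Gm GI GT mB HG A GA.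
have r0 : 0 <= prob P B by exact: prob_ge0.
have := @g_sigma_algebra_measure_unique _ R T G Gm (fun=> setT) (fun=> GT) _ (mrestr P mB) (mscale (NngNum r0) P) GI.
move=> H; rewrite muleC (probE P mB); apply: H => //.
- by apply/seteqP; split => // x _; exists 0%N.
- by move=> A' /HG /=; rewrite /mrestr /mscale => ->; rewrite muleC probE.
- by move=> _; rewrite /= /mrestr setTI; apply: le_lt_trans (ltry 1); exact: probability_le1.
Qed.

(** Two applications of the uniqueness of measures on a pi-system, one for each
argument. *)
Lemma independent_sigma (G1 G2 : set (set T)) :
  G1 `<=` measurable -> G2 `<=` measurable ->
  setI_closed G1 -> setI_closed G2 -> G1 setT -> G2 setT ->
  independent_systems P G1 G2 -> independent_systems P <<s G1 >> <<s G2 >>.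
Proof.
move=> G1m G2m G1I G2I G1T G2T ind A B GA GB.
have mG1 := smallest_sub (@sigma_algebra_measurable _ T) G1m.
have mG2 := smallest_sub (@sigma_algebra_measurable _ T) G2m.
have mB : measurable B by exact: mG2.
apply: (independent_sigma_l G1m G1I G1T mB) => // A1 GA1.
rewrite setIC muleC; apply: (independent_sigma_l G2m G2I G2T (G1m _ GA1)) => // B1 GB1.
by rewrite setIC muleC ind.
Qed.

Context {d' : measure_display} {V : measurableType d'}.
Variable X : nat -> T -> V.
Hypothesis mX : forall i, measurable_fun setT (X i).
Hypothesis indX : mutually_independent P X.

Definition cylinder (J : {fset nat}) (B : nat -> set V) :=
  \bigcap_(i in [set` J]) (X i @^-1` B i).

(** The pi-system of finite intersections of events about variables with index in
[D]; mutual independence is a statement about exactly these sets. *)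
Definition cylinders (D : set nat) : set (set T) :=
  [set E | exists J, exists2 B, (forall i, measurable (B i)) &
           [set` J] `<=` D /\ E = cylinder J B].

Lemma measurable_cylinder J B : (forall i, measurable (B i)) ->
  measurable (cylinder J B).
Proof.
move=> mB; apply: fin_bigcap_measurable => [|i _]; first exact: finite_fset.
by rewrite -[X in measurable X]setTI; exact: mX.
Qed.

Lemma sigma_of_cylinders D : sigma_of D X `<=` <<s cylinders D >>.
Proof.
apply: smallest_sub; first exact: smallest_sigma_algebra.
move=> E [i Di [B mB <-]]; apply: sub_sigma_algebra.
exists [fset i]%fset, (fun=> B) => //; split; first by move=> j /=; rewrite inE => /eqP ->.
by apply/seteqP; split => w /=; rewrite /cylinder /bigcap /=; [case=> _ XB j; rewrite inE => /eqP ->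
  |move=> H; split => //; apply: H; rewrite inE].
Qed.

Lemma cylinders_setI_closed D : setI_closed (cylinders D).
Proof.
move=> _ _ [J [B mB [JD ->]]] [J' [B' mB' [JD' ->]]].
exists (J `|` J')%fset, (fun i => (if i \in J then B i else setT) `&`
                               (if i \in J' then B' i else setT)).
  by move=> i; apply: measurableI; case: ifP.
split; first by move=> i /=; rewrite inE => /orP[/JD|/JD'].
apply/seteqP; split => w.
  move=> [H H'] i /= _; split; case: ifPn => // iJ; [exact: H|exact: H'].
move=> H; split=> i /= iJ; have := H i; rewrite /= inE iJ ?orbT.
  by case=> //.
by case=> //.
Qed.

Lemma cylindersT D : cylinders D setT.
Proof.
exists fset0, (fun=> setT) => //; split; first by move=> i /=; rewrite inE.
by apply/seteqP; split => // w _ i /=; rewrite inE.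
Qed.

Lemma independent_blocks D1 D2 : D1 `&` D2 = set0 ->
  independent_systems P (sigma_of D1 X) (sigma_of D2 X).
Proof.
move=> D12 A B /sigma_of_cylinders GA /sigma_of_cylinders GB.
have mC D : cylinders D `<=` measurable.
  by move=> _ [J [B' mB' [_ ->]]]; exact: measurable_cylinder.
apply: (independent_sigma _ _ _ _ _ _ _ GA GB) => //; try exact: cylinders_setI_closed;
  try exact: cylindersT; try exact: mC.
move=> _ _ [J1 [B1 mB1 [JD1 ->]]] [J2 [B2 mB2 [JD2 ->]]].
pose C i := if i \in J1 then B1 i else B2 i.
have mCi i : measurable (C i) by rewrite /C; case: ifP.
have J21 i : i \in J2 -> i \in J1 = false.
  move=> i2; apply/negP => i1; have : (D1 `&` D2) i by split; [exact: JD1|exact: JD2].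
  by rewrite D12.
have -> : cylinder J1 B1 `&` cylinder J2 B2 = cylinder (J1 `|` J2)%fset C.
  apply/seteqP; split => w.
    move=> [H1 H2] i /=; rewrite inE /C; case: ifPn => [iJ _|_ /= iJ]; [exact: H1|exact: H2].
  move=> H; split=> i /= iJ; have := H i; rewrite /= inE iJ ?orbT /C ?iJ ?J21//; exact.
rewrite !indX// (perm_big (J1 ++ J2))/=; last first.
  apply: uniq_perm => //; first by rewrite cat_uniq !fset_uniq/= andbT; apply/hasPn => i /J21 /= ->.
  by move=> i; rewrite inE mem_cat.
rewrite big_cat/=; congr (_ * _)%E; rewrite big_seq [RHS]big_seq; apply: eq_bigr => i iJ.
  by rewrite /C iJ.
by rewrite /C J21.
Qed.

Lemma sigma_of_measurable D : sigma_of D X `<=` measurable.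
Proof.
apply: smallest_sub; first exact: sigma_algebra_measurable.
move=> E [i _ [B mB <-]]; exact: mX.
Qed.

Lemma measurable_sigma_of D i : D i ->
  measurable_fun setT (X i : g_sigma_algebraType (\bigcup_(i in D) preimage_set_system setT (X i) measurable) -> V).
Proof.
move=> Di _ B mB; apply: sub_sigma_algebra; exists i => //; exists B => //.
Qed.

End PiLambda.

(** * Weighted sums of i.i.d. scores *)

Section WeightedSums.
Context {R : realType} {dT : measure_display} {T : measurableType dT}.
Variable P : probability T R.
Context {d' : measure_display} {V : measurableType d'}.
Variables (X : nat -> T -> V) (f : V -> R).
Hypotheses (mX : forall i, measurable_fun setT (X i)) (X_iid : iid P X).
Hypotheses (mf : measurable_fun setT f) (f_ge0 : forall v, 0 <= f v).

(** In the application, [V] is the space of claim vectors and [f] is the gauge of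
the ruin set. *)
Definition score (i : nat) (w : T) : R := f (X i w).

(** [I] is a list of distinct indices in the applications; its order only records
the order in which the claims are added. *)
Definition weighted_sum (I : seq nat) (v : nat -> R) (w : T) : R :=
  \sum_(i <- I) v i * score i w.

Notation Y := score.
Notation S := weighted_sum.
Notation Fb := (survival P (Y 0%N)).

Lemma score_ge0 i w : 0 <= Y i w. Proof. exact: f_ge0. Qed.

Lemma measurable_score i : measurable_fun setT (Y i).
Proof. exact: measurableT_comp. Qed.

Lemma measurable_weighted_sum I v : measurable_fun setT (S I v).
Proof.
by apply: measurable_sum => i; apply: measurable_funM => //; exact: measurable_score.
Qed.

Lemma weighted_sum_nil v : S [::] v = fun=> 0.
Proof. by apply/funext => w; rewrite /weighted_sum big_nil. Qed.

Lemma weighted_sum_cons i I v : S (i :: I) v = fun w => v i * Y i w + S I v w.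
Proof. by apply/funext => w; rewrite /weighted_sum big_cons. Qed.

Lemma mean_identically_distributed (G : R -> R) k : measurable_fun setT G ->
  (forall x, 0 <= G x) -> mean P (fun w => G (Y k w)) = mean P (fun w => G (Y 0%N w)).
Proof.
move=> mG G0; pose X' i : {mfun T >-> V} := mfun_Sub (mem_set (mX i)).
have H i : (\int[P]_w (G (Y i w))%:E = \int[distribution P (X' i)]_y (G (f y))%:E)%E.
  rewrite ge0_integral_distribution//; last by move=> y; rewrite lee_fin.
  by apply/measurable_EFinP; exact: measurableT_comp.
rewrite /mean /Rintegral !H; congr fine; apply: eq_measure_integral => A mA _.
exact: X_iid.2.
Qed.

Notation gen D := (\bigcup_(i in D) preimage_set_system setT (X i) measurable).

Lemma measurable_score_gen (D : set nat) i : D i ->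
  measurable_fun setT (Y i : g_sigma_algebraType (gen D) -> R).
Proof. by move=> Di; apply: measurableT_comp => //; exact: measurable_sigma_of. Qed.

Lemma measurable_weighted_sum_gen (D : set nat) I v : (forall i, i \in I -> D i) ->
  measurable_fun setT (S I v : g_sigma_algebraType (gen D) -> R).
Proof.
elim: I => [|i I IH] ID.
  by rewrite weighted_sum_nil; exact: measurable_cst.
rewrite weighted_sum_cons.
apply: measurable_funD; last by apply: IH => j jI; apply: ID; rewrite inE jI orbT.
by apply: measurable_funM => //; apply: measurable_score_gen; apply: ID; rewrite inE eqxx.
Qed.

(** Conditioning on the new claim, which is independent of the block [I] and has the
law of the first claim. *)
Lemma survival_add I v k c x : k \notin I ->
  survival P (fun w => S I v w + c * Y k w) x =
  mean P (fun w => survival P (S I v) (x - c * Y 0%N w)).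
Proof.
move=> kI.
have mSI := measurable_weighted_sum I v.
have mG : measurable_fun setT (fun y => survival P (S I v) (x - c * y)).
  apply: measurableT_comp; first exact: measurable_survival.
  by apply: measurable_funB => //; exact: measurable_funM.
rewrite -(@mean_identically_distributed (fun y => survival P (S I v) (x - c * y)) k)//; last first.
  by move=> y; exact: survival_ge0.
pose D1 : set nat := [set k]; pose D2 : set nat := [set` I].
have D12 : D1 `&` D2 = set0.
  by apply/seteqP; split => // i [/= -> iI]; rewrite iI in kI.
have [|_ E] := prob_decoupling (sigma_of_measurable mX (D:=D1))
  (sigma_of_measurable mX (D:=D2)) (independent_blocks mX X_iid.1 D12)
  (B := fun z => x < S I v z.2 + c * Y k z.1).
  apply: measurable_gt; apply: measurable_funD.
    apply: (measurableT_comp (f := (S I v : g_sigma_algebraType (gen D2) -> R))) => //.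
    exact: measurable_weighted_sum_gen.
  apply: measurable_funM => //.
  apply: (measurableT_comp (f := (Y k : g_sigma_algebraType (gen D1) -> R))) => //.
  exact: measurable_score_gen.
rewrite {1}/survival E; apply: eq_mean => w1 /=.
by congr (prob _ _); apply/seteqP; split => w /=; rewrite ltrBlDr.
Qed.

(** Both sides are instances of [survival_add] for the empty block. *)
Lemma survival_score c k x :
  survival P (fun w => c * Y k w) x = survival P (fun w => c * Y 0%N w) x.
Proof.
have H i : survival P (fun w => c * Y i w) x =
    mean P (fun w => survival P (S [::] (fun=> 0)) (x - c * Y 0%N w)).
  rewrite -(@survival_add _ _ i)//; congr (survival _ _ _).
  by apply/funext => w; rewrite weighted_sum_nil add0r.
by rewrite !H.
Qed.

End WeightedSums.

(** * Uniform tail bounds for sums of claims *)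

Section TailBounds.
Context {R : realType} {dT : measure_display} {T : measurableType dT}.
Variable P : probability T R.
Context {d' : measure_display} {V : measurableType d'}.
Variables (X : nat -> T -> V) (f : V -> R).
Hypotheses (mX : forall i, measurable_fun setT (X i)) (X_iid : iid P X).
Hypotheses (mf : measurable_fun setT f) (f_ge0 : forall v, 0 <= f v).

Notation Y := (score X f).
Notation S := (weighted_sum X f).
Notation Fb := (survival P (Y 0%N)).

Hypothesis FY : asymptotically_double P (Y 0%N).

Let mY i : measurable_fun setT (Y i). Proof. exact: measurable_score. Qed.
Let mS I v : measurable_fun setT (S I v). Proof. exact: measurable_weighted_sum. Qed.
Let Y_ge0 i w : 0 <= Y i w. Proof. exact: score_ge0. Qed.
Let Fb_gt0 x : 0 < Fb x. Proof. exact: FY.1. Qed.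
Let survival_S_le1 I v x : survival P (S I v) x <= 1. Proof. exact: survival_le1. Qed.

Lemma survival_add_claim (a d x0 : R) : 0 < a -> 0 < d -> exists x1 : R,
  forall (c : R) (s : seq (R * R)) I v k, a <= c -> c <= 1 ->
  (forall z, z \in s -> [/\ 0 <= z.1, c <= z.2 & z.2 <= 1]) -> k \notin I ->
  (forall x, x0 <= x -> survival P (S I v) x <= tail_mixture P (Y 0%N) s x) ->
  forall x, x1 <= x -> survival P (fun w => S I v w + c * Y k w) x <=
    (1 + d) * (tail_mixture P (Y 0%N) s x + Fb (x / c)).
Proof.
move=> a0 d0; have [x1 H] := add_jump (mY 0%N) (Y_ge0 0%N) FY x0 a0 d0.
exists x1 => c s I v k ac c1 Hs kI HI x xx1.
rewrite survival_add//; apply: H => //; first exact: measurable_survival.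
by move=> y; rewrite survival_ge0 survival_S_le1.
Qed.

Lemma eq_survival (Z Z' : T -> R) x : Z =1 Z' -> survival P Z x = survival P Z' x.
Proof. by move=> /funext ->. Qed.

Lemma tail_mixtureZ c s x : tail_mixture P (Y 0%N) [seq (c * z.1, z.2) | z <- s] x =
  c * tail_mixture P (Y 0%N) s x.
Proof.
by rewrite /tail_mixture big_map mulr_sumr; apply: eq_bigr => z _; rewrite mulrA.
Qed.

(** Induction on [n] by [add_jump], starting from the block [I] and adding the
indices in increasing order, so that each new weight is the smallest so far.
One factor [1 + d] is lost at each step. *)
Lemma survival_add_claims (a d x0 : R) n : 0 < a -> 0 < d -> exists x1 : R,
  forall (s : seq (R * R)) I v,
  (forall i, (i < n)%N -> a <= v i /\ v i <= 1) ->
  (forall i j, (i <= j)%N -> (j < n)%N -> v j <= v i) ->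
  (forall i, i \in I -> (n <= i)%N) ->
  (forall z i, z \in s -> (i < n)%N -> [/\ 0 <= z.1, v i <= z.2 & z.2 <= 1]) ->
  (forall x, x0 <= x -> survival P (S I v) x <= tail_mixture P (Y 0%N) s x) ->
  forall x, x1 <= x -> survival P (S (iota 0 n ++ I) v) x <=
    (1 + d) ^+ n * (tail_mixture P (Y 0%N) s x + \sum_(i < n) Fb (x / v i)).
Proof.
move=> a0 d0; elim: n => [|n [x1 IH]].
  exists x0 => s I v _ _ _ _ HI x xx0.
  by rewrite big_ord0 addr0 expr0 mul1r; exact: HI.
have [x2 H2] := survival_add_claim x1 a0 d0.
exists x2 => s I v va vmono In Hs HI x xx2.
pose s' := [seq ((1 + d) ^+ n * z.1, z.2) | z <- s ++ [seq (1, v i) | i <- iota 0 n]].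
have d10 : 0 <= (1 + d) ^+ n by rewrite exprn_ge0// addr_ge0// ltW.
have mixE y : tail_mixture P (Y 0%N) s' y = (1 + d) ^+ n *
    (tail_mixture P (Y 0%N) s y + \sum_(i < n) Fb (y / v i)).
  rewrite tail_mixtureZ /tail_mixture big_cat big_map /=; congr (_ * (_ + _)).
  rewrite -(big_mkord predT (fun i => Fb (y / v i))) /index_iota subn0.
  by apply: eq_bigr => i _; rewrite mul1r.
rewrite (@eq_survival _ (fun w => S (iota 0 n ++ I) v w + v n * Y n w)); last first.
  move=> w; rewrite /weighted_sum -addn1 iotaD add0n -catA !big_cat/= big_seq1.
  by rewrite addrA addrAC.
rewrite exprS -mulrA big_ord_recr /= [in leRHS]addrA [in leRHS]mulrDr.
apply: le_trans (_ : (1 + d) * (tail_mixture P (Y 0%N) s' x + Fb (x / v n)) <= _); last first.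
  rewrite ler_wpM2l ?addr_ge0 ?(ltW d0)// mixE lerD// ler_peMl ?survival_ge0//.
  by rewrite exprn_ege1// lerDl ltW.
have [van vn1] := va _ (ltnSn n).
apply: H2 => //.
- move=> _ /mapP[z zs ->] /=; move: zs; rewrite mem_cat => /orP[zs|/mapP[i]].
    have [z0 vz z1] := Hs _ n zs (ltnSn _).
    by split => //; rewrite mulr_ge0.
  rewrite mem_iota add0n => /andP[_ ilt] -> /=.
  by split; [rewrite mulr1|apply: vmono => //; exact: ltnW|exact: (va i (ltnW ilt)).2].
- rewrite mem_cat mem_iota add0n ltnn/=; apply/negP => /In.
  by rewrite ltnn.
move=> y yx1; rewrite mixE; apply: IH => //.
- by move=> i ilt; apply: va; exact: ltnW.
- by move=> i j ij jn; apply: vmono => //; exact: ltnW.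
- by move=> i /In /ltnW.
- by move=> z i zs ilt; apply: Hs => //; exact: ltnW.
Qed.

(** One threshold for all lengths up to [n]. *)
Lemma survival_add_claims_le (a d x0 : R) n : 0 < a -> 0 < d -> exists2 x1 : R, x0 <= x1 &
  forall m (s : seq (R * R)) I v, (m <= n)%N ->
  (forall i, (i < m)%N -> a <= v i /\ v i <= 1) ->
  (forall i j, (i <= j)%N -> (j < m)%N -> v j <= v i) ->
  (forall i, i \in I -> (m <= i)%N) ->
  (forall z i, z \in s -> (i < m)%N -> [/\ 0 <= z.1, v i <= z.2 & z.2 <= 1]) ->
  (forall x, x0 <= x -> survival P (S I v) x <= tail_mixture P (Y 0%N) s x) ->
  forall x, x1 <= x -> survival P (S (iota 0 m ++ I) v) x <=
    (1 + d) ^+ m * (tail_mixture P (Y 0%N) s x + \sum_(i < m) Fb (x / v i)).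
Proof.
move=> a0 d0; elim: n => [|n [x1 x01 IH]].
  have [x1 H] := survival_add_claims x0 0 a0 d0.
  exists (Num.max x0 x1); first by rewrite le_max lexx.
  move=> m s I v; rewrite leqn0 => /eqP -> h1 h2 h3 h4 h5 x.
  by rewrite ge_max => /andP[_]; apply: H.
have [x2 H] := survival_add_claims x0 n.+1 a0 d0.
exists (Num.max x1 x2); first by rewrite le_max x01.
move=> m s I v; rewrite leq_eqVlt => /predU1P[->|mn] h1 h2 h3 h4 h5 x;
  rewrite ge_max => /andP[xx1 xx2]; first exact: H.
by apply: IH.
Qed.

Lemma le_survival_sum I v v' x : (forall i, i \in I -> v i <= v' i) ->
  survival P (S I v) x <= survival P (S I v') x.
Proof.
move=> vv'; apply: le_survival => // w; rewrite /weighted_sum big_seq [leRHS]big_seq.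
by apply: ler_sum => i /vv' vi; rewrite ler_wpM2r.
Qed.

(** Each claim turns a bound [b Fbar] for all [x] into [(b (1 + eta) + K) Fbar]: above
the threshold of [add_jump] this is its conclusion, and below the threshold
[Fbar] is bounded away from zero, which fixes [K].  The constant [c = K / eta]
solves this recursion in closed form. *)
Lemma kesten_bound (eta : R) : 0 < eta -> exists2 c : R, 0 <= c &
  forall J I v b, uniq J -> (forall i, i \in J -> i \notin I) ->
  (forall i, i \in J -> v i <= 1) -> 0 <= b ->
  (forall x, survival P (S I v) x <= b * Fb x) ->
  forall x, survival P (S (J ++ I) v) x <= ((1 + eta) ^+ size J * (b + c) - c) * Fb x.
Proof.
move=> eta0; have [x1 H] := survival_add_claim 0 ltr01 eta0.
pose K := (1 + eta) + (Fb x1)^-1.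
have K0 : 0 <= K by rewrite /K !addr_ge0 ?invr_ge0 ?ltW.
exists (K / eta); first by rewrite divr_ge0// ltW.
set c := K / eta; have c0 : 0 <= c by rewrite divr_ge0// ltW.
have cK : c * eta = K by rewrite /c divfK// gt_eqF.
elim=> [|k J IH] I v b.
  by move=> _ _ _ b0 HI x; rewrite expr0 mul1r addrK.
move=> /andP[kJ uJ] JI vJ b0 HI x.
set b' := (1 + eta) ^+ size J * (b + c) - c.
have b'0 : 0 <= b'.
  have : 1 <= (1 + eta) ^+ size J by rewrite exprn_ege1// lerDl ltW.
  by rewrite /b'; nra.
have HJ y : survival P (S (J ++ I) v) y <= b' * Fb y.
  apply: IH => //.
  - by move=> i iJ; apply: JI; rewrite inE iJ orbT.
  - by move=> i iJ; apply: vJ; rewrite inE iJ orbT.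
have -> : (1 + eta) ^+ size (k :: J) * (b + c) - c = (1 + eta) * b' + K.
  by rewrite -cK /b' /= exprS; ring.
have mSk : measurable_fun setT (fun w => S (J ++ I) v w + 1 * Y k w).
  apply: measurable_funD; first exact: mS.
  by apply: measurable_funM; [exact: measurable_cst|exact: mY].
apply: (@le_trans _ _ (survival P (fun w => S (J ++ I) v w + 1 * Y k w) x)).
  apply: le_survival; [exact: mS|exact: mSk|].
  by move=> w; rewrite /= weighted_sum_cons addrC lerD2l ler_wpM2r// vJ// inE eqxx.
have Fx := Fb_gt0 x; have Fx1 := Fb_gt0 x1.
have [xx1|xx1] := leP x1 x.
  have mixE y : tail_mixture P (Y 0%N) [:: (b', 1)] y = b' * Fb y.
    by rewrite /tail_mixture big_seq1/= divr1.
  apply: le_trans (H 1 [:: (b', 1)] (J ++ I) v k _ _ _ _ _ x xx1) _ => //.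
  - by move=> z; rewrite inE => /eqP ->.
  - by rewrite mem_cat negb_or kJ JI// inE eqxx.
  - by move=> y _; rewrite mixE.
  have : 0 <= (Fb x1)^-1 * Fb x by rewrite mulr_ge0 ?invr_ge0 ?ltW.
  by rewrite mixE divr1 /K; lra.
apply: le_trans (_ : 1 <= _).
  exact: survival_le1.
have : 1 <= (Fb x1)^-1 * Fb x.
  by rewrite mulrC ler_pdivlMr// mul1r survival_mono// ltW.
have e1 : 0 <= 1 + eta by rewrite addr_ge0// ltW.
have : 0 <= (1 + eta) * b' * Fb x by rewrite mulr_ge0 ?survival_ge0// mulr_ge0.
have : 0 <= (1 + eta) * Fb x by rewrite mulr_ge0 ?survival_ge0.
rewrite /K; lra.
Qed.

Lemma survival_nil v x : survival P (S [::] v) x <= 1 * Fb x.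
Proof. by rewrite mul1r weighted_sum_nil; apply: le_survival. Qed.

Lemma survival_nil0 v x : 0 <= x -> survival P (S [::] v) x = 0.
Proof.
move=> x0; rewrite weighted_sum_nil /survival (_ : [set w | _] = set0) /prob ?measure0//.
by apply/seteqP; split => // w /=; rewrite ltNge x0.
Qed.

Lemma kesten_sum (eta : R) : 0 < eta -> exists2 K : R, 0 <= K &
  forall J v x, uniq J -> (forall i, i \in J -> v i <= 1) ->
  survival P (S J v) x <= K * (1 + eta) ^+ size J * Fb x.
Proof.
move=> eta0; have [c c0 H] := kesten_bound eta0.
exists (1 + c) => [|J v x uJ vJ]; first exact: addr_ge0.
rewrite -[J in leLHS]cats0; apply: le_trans (H J [::] v 1 uJ _ vJ ler01 (survival_nil v) x) _ => //.
by rewrite ler_wpM2r ?survival_ge0// lerBlDr mulrC lerDl.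
Qed.

End TailBounds.

(** * Weights bounded away from zero *)

Section SmallPower.
Context {R : realType}.

(** From [1 + e <= exp e] with [e = ln c / (n + 1)]. *)
Lemma small_growth (c : R) n : 1 < c -> exists2 e : R, 0 < e & (1 + e) ^+ n <= c.
Proof.
move=> c1; have l0 : 0 < ln c by rewrite ln_gt0.
exists (ln c / n.+1%:R); first by rewrite divr_gt0.
apply: (@le_trans _ _ (expR (ln c / n.+1%:R) ^+ n)).
  by rewrite lerXn2r ?nnegrE ?expR_ge0 ?addr_ge0 ?divr_ge0 ?(ltW l0)// expR_ge1Dx.
rewrite -expRM_natl -[leRHS]lnK ?posrE ?(lt_trans ltr01)// ler_expR.
rewrite mulrCA ler_piMr ?(ltW l0)// ler_pdivrMr// mul1r ler_nat//.
Qed.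

Lemma small_geometric (rho e : R) : 0 <= rho -> rho < 1 -> 0 < e ->
  exists n, rho ^+ n <= e.
Proof.
move=> r0 r1 e0.
have /cvgrPdist_le /(_ e e0) [n _ Hn] : rho ^+ k @[k --> \oo] --> (0 : R).
  by apply: cvg_expr; rewrite ger0_norm.
exists n; have := Hn n (leqnn n).
by rewrite sub0r normrN ger0_norm// exprn_ge0.
Qed.

End SmallPower.

Section UpperBounds.
Context {R : realType} {dT : measure_display} {T : measurableType dT}.
Variable P : probability T R.
Context {d' : measure_display} {V : measurableType d'}.
Variables (X : nat -> T -> V) (f : V -> R).
Hypotheses (mX : forall i, measurable_fun setT (X i)) (X_iid : iid P X).
Hypotheses (mf : measurable_fun setT f) (f_ge0 : forall v, 0 <= f v).

Notation Y := (score X f).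
Notation S := (weighted_sum X f).
Notation Fb := (survival P (Y 0%N)).

Hypothesis FY : asymptotically_double P (Y 0%N).

Let mY i : measurable_fun setT (Y i). Proof. exact: measurable_score. Qed.
Let mS I v : measurable_fun setT (S I v). Proof. exact: measurable_weighted_sum. Qed.
Let Y_ge0 i w : 0 <= Y i w. Proof. exact: score_ge0. Qed.
Let Fb_gt0 x : 0 < Fb x. Proof. exact: FY.1. Qed.

(** For [x >= 0] this is [Fbar(x / c)] when [c > 0] and [0] when [c = 0]; claims that
have not arrived get weight [0], where [x / c] would be meaningless. *)
Definition scaled_tail (c x : R) : R := survival P (fun w => c * Y 0%N w) x.

Lemma scaled_tail_ge0 c x : 0 <= scaled_tail c x. Proof. exact: survival_ge0. Qed.

Lemma scaled_tailE c x : 0 < c -> scaled_tail c x = Fb (x / c).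
Proof. exact: survival_scale. Qed.

Lemma scaled_tail0 x : 0 <= x -> scaled_tail 0 x = 0.
Proof.
move=> x0; rewrite /scaled_tail /survival (_ : [set w | _] = set0) /prob ?measure0//.
by apply/seteqP; split => // w /=; rewrite mul0r ltNge x0.
Qed.

Lemma weighted_sum_scale c I v w : S I (fun i => c * v i) w = c * S I v w.
Proof. by rewrite /weighted_sum mulr_sumr; apply: eq_bigr => i _; rewrite mulrA. Qed.

Lemma eq_weighted_sum I v v' : (forall i, i \in I -> v i = v' i) -> S I v = S I v'.
Proof.
move=> vv'; apply/funext => w; rewrite /weighted_sum big_seq [RHS]big_seq.
by apply: eq_bigr => i /vv' ->.
Qed.

Lemma weighted_sum0 I v : (forall i, i \in I -> v i = 0) -> S I v = S [::] v.
Proof.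
move=> v0; apply/funext => w; rewrite /weighted_sum big_nil big_seq big1// => i /v0 ->.
by rewrite mul0r.
Qed.

Lemma weighted_sum_cat I J v w : S (I ++ J) v w = S I v w + S J v w.
Proof. by rewrite /weighted_sum big_cat. Qed.

Lemma weighted_sum_iota_le m v w : (forall i, 0 <= v i) ->
  S (iota 0 m) v w <= S (iota 0 m.+1) v w.
Proof.
move=> v_ge0; rewrite -addn1 iotaD weighted_sum_cat lerDl.
by apply: sumr_ge0 => i _; rewrite mulr_ge0.
Qed.

(** Used with a condition on nonincreasing weights, whose truth set is an initial
segment. *)
Lemma prefix_length (Q : pred nat) m : exists2 j, (j <= m)%N &
  (forall i, (i < j)%N -> Q i) /\ ((j < m)%N -> ~~ Q j).
Proof.
elim: m => [|m [j jm [H1 H2]]]; first by exists 0%N.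
have [jm'|jm'] := ltnP j m.
  by exists j; [exact: ltnW|split => // _; exact: H2].
have -> : m = j by apply/eqP; rewrite eqn_leq jm jm'.
have [Qj|nQj] := boolP (Q j).
  exists j.+1 => //; split; last by rewrite ltnn.
  by move=> i; rewrite ltnS leq_eqVlt => /predU1P[->//|/H1].
by exists j.
Qed.

(** If at most [n] of the weights are positive, the sharp bound for boundedly many
weights applies.  Otherwise all weights are bounded by [v 0], and Kesten's bound
for the number [j > n] of positive weights is the term of index [j - 1] of the
second sum. *)
Lemma upper_bounded_weights (k : R) : 1 < k -> exists2 K : R, 0 <= K &
  forall (a d : R) n, 0 < a -> 0 < d -> exists2 x1 : R, 0 <= x1 & forall v m x,
  (forall i, 0 <= v i) ->
  (forall i, v i = 0 \/ (a <= v i /\ v i <= 1)) ->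
  (forall i j, (i <= j)%N -> v j <= v i) -> x1 <= x ->
  survival P (S (iota 0 m) v) x <=
   (1 + d) * \sum_(i < n) scaled_tail (v i) x +
   \sum_(n <= i < m) K * k ^+ i.+1 * (0 < v i)%R%:R * scaled_tail (v 0%N) x.
Proof.
move=> k1; have k0 : 0 < k - 1 by rewrite subr_gt0.
have [K K0 HK] := kesten_sum mX X_iid mf f_ge0 FY k0.
rewrite addrC subrK in HK.
exists K => // a d n a0 d0.
have [e e0 He] := @small_growth _ (1 + d) n (ltr_pwDr d0 (lexx _)).
have [x1 x10 H1] := survival_add_claims_le mX X_iid mf f_ge0 FY 0 n a0 e0.
exists x1 => // v m x v0 v0a vmono xx1.
have xge0 : 0 <= x by exact: le_trans xx1.
have sum1 : 0 <= \sum_(i < n) scaled_tail (v i) x.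
  by apply: sumr_ge0 => i _; exact: scaled_tail_ge0.
have term0 i : 0 <= K * k ^+ i.+1 * (0 < v i)%R%:R * scaled_tail (v 0%N) x.
  by rewrite !mulr_ge0 ?scaled_tail_ge0// exprn_ge0// ltW// (lt_trans ltr01).
have sum2 : 0 <= \sum_(n <= i < m) K * k ^+ i.+1 * (0 < v i)%R%:R * scaled_tail (v 0%N) x.
  by apply: sumr_ge0.
have [j jm [vj1 vj2]] := prefix_length (fun i => 0 < v i) m.
have SE : S (iota 0 m) v = S (iota 0 j) v.
  apply/funext => w; rewrite -{1}(subnKC jm) iotaD weighted_sum_cat.
  rewrite (@weighted_sum0 (iota (0 + j) (m - j))) ?weighted_sum_nil ?addr0// => i.
  rewrite mem_iota add0n => /andP[ji].
  rewrite subnKC// => im; apply/eqP; rewrite eq_le v0 andbT (le_trans (vmono _ _ ji))//.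
  by rewrite leNgt vj2// (leq_ltn_trans ji).
rewrite SE; have [jn|nj] := leqP j n.
  rewrite -[leLHS]addr0 lerD//.
  have mix0 y : tail_mixture P (Y 0%N) [::] y = 0 by rewrite /tail_mixture big_nil.
  rewrite -[iota 0 j]cats0.
  apply: le_trans (H1 j [::] [::] v jn _ _ _ _ _ x xx1) _ => //.
  - move=> i ij; have [vi|//] := v0a i.
    by have := vj1 i ij; rewrite vi ltxx.
  - by move=> i i' ii' _; exact: vmono.
  - by move=> y y0; rewrite survival_nil0// mix0.
  rewrite mix0 add0r; apply: ler_pM.
  - by rewrite exprn_ge0// addr_ge0// ltW.
  - by apply: sumr_ge0 => i _; exact: survival_ge0.
  - apply: le_trans He; apply: ler_weXn2l => //; rewrite lerDl; exact: ltW.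
  rewrite -(big_mkord predT (fun i => Fb (x / v i))) -(big_mkord predT (fun i => scaled_tail (v i) x)).
  rewrite [leRHS](big_cat_nat (n:=j))//= [leLHS]big_nat_cond [X in _ <= X + _]big_nat_cond.
  rewrite -[leLHS]addr0 lerD//; last by apply: sumr_ge0 => i _; exact: scaled_tail_ge0.
  apply: ler_sum => i /andP[/andP[_ ij] _]; rewrite scaled_tailE//; exact: vj1.
rewrite -[leLHS]add0r lerD//; first by rewrite mulr_ge0// addr_ge0// ltW.
have j0 : (0 < j)%N by exact: leq_ltn_trans nj.
have vp0 : 0 < v 0%N by exact: vj1.
have vpj : 0 < v j.-1 by apply: vj1; rewrite prednK.
have jin : j.-1 \in index_iota n m by rewrite mem_index_iota -ltnS prednK// nj.
rewrite (bigD1_seq j.-1 jin)/=; last exact: iota_uniq.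
rewrite vpj mulr1 prednK// -[leLHS]addr0 lerD//; last by rewrite sumr_ge0.
rewrite scaled_tailE//.
have -> : survival P (S (iota 0 j) v) x =
    survival P (S (iota 0 j) (fun i => v i / v 0%N)) (x / v 0%N).
  rewrite -survival_scale//; apply: eq_survival => w.
  rewrite -weighted_sum_scale; congr (_ w); apply: eq_weighted_sum => i _.
  by rewrite mulrCA divff ?mulr1// gt_eqF.
apply: le_trans (HK _ _ _ (iota_uniq 0 j) _) _; last by rewrite size_iota.
by move=> i _; rewrite ler_pdivrMr// mul1r vmono.
Qed.

End UpperBounds.

(** * Positively decreasing tails *)

Section PositivelyDecreasing.
Context {R : realType} {dT : measure_display} {T : measurableType dT}.
Variable P : probability T R.
Context {d' : measure_display} {V : measurableType d'}.
Variables (X : nat -> T -> V) (f : V -> R).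
Hypotheses (mX : forall i, measurable_fun setT (X i)) (X_iid : iid P X).
Hypotheses (mf : measurable_fun setT f) (f_ge0 : forall v, 0 <= f v).

Notation Y := (score X f).
Notation S := (weighted_sum X f).
Notation Fb := (survival P (Y 0%N)).

Hypothesis FY : asymptotically_double P (Y 0%N).

Let mY i : measurable_fun setT (Y i). Proof. exact: measurable_score. Qed.
Let mS I v : measurable_fun setT (S I v). Proof. exact: measurable_weighted_sum. Qed.
Let Y_ge0 i w : 0 <= Y i w. Proof. exact: score_ge0. Qed.
Let Fb_gt0 x : 0 < Fb x. Proof. exact: FY.1. Qed.

Variables (v0 q x0 : R).
Hypotheses (v0_gt1 : 1 < v0) (q_lt1 : q < 1).
Hypothesis decr : forall x, x0 <= x -> Fb (v0 * x) <= q * Fb x.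

(** Iterate the hypothesis: [Fbar(v0^n x) <= q^n Fbar(x)] for large [x]. *)
Lemma survival_decay (d : R) : 0 < d -> exists M x1 : R, [/\ 1 <= M, 0 <= x1 &
  forall lam x, M <= lam -> x1 <= x -> Fb (lam * x) <= d * Fb x].
Proof.
move=> d0; pose q' := Num.max q 0.
have q'0 : 0 <= q' by rewrite le_max lexx orbT.
have q'1 : q' < 1 by rewrite gt_max q_lt1 ltr01.
have [n qn] := small_geometric q'0 q'1 d0.
pose x1 := Num.max x0 0.
have x10 : 0 <= x1 by rewrite le_max lexx orbT.
have v00 : 0 < v0 by rewrite (lt_trans ltr01).
exists (v0 ^+ n), x1; split => //; first by rewrite exprn_ege1// ltW.
move=> lam x Ml x1x; have x_ge0 : 0 <= x by exact: le_trans x1x.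
apply: (@le_trans _ _ (q' ^+ n * Fb x)); last by rewrite ler_wpM2r// survival_ge0.
apply: (@le_trans _ _ (Fb (v0 ^+ n * x))).
  by apply: survival_mono => //; rewrite ler_wpM2r.
elim: n {qn Ml} => [|n IH]; first by rewrite !expr0 !mul1r.
rewrite !exprS -!mulrA; apply: le_trans (decr _) _.
  apply: (@le_trans _ _ x1); first by rewrite le_max lexx.
  by apply: (le_trans x1x); rewrite ler_peMl// exprn_ege1// ltW.
apply: (@le_trans _ _ (q' * Fb (v0 ^+ n * x))).
  by rewrite ler_wpM2r ?survival_ge0// le_max lexx.
by rewrite ler_wpM2l.
Qed.

Variable rho : R.
Hypotheses (rho_gt0 : 0 < rho) (rho_lt1 : rho < 1).

Let rhoX_gt0 n : 0 < rho ^+ n. Proof. exact: exprn_gt0. Qed.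

Lemma survival_decay_pow (d : R) : 0 < d -> exists n, exists2 x1 : R, 0 <= x1 &
  forall x, x1 <= x -> Fb (x / rho ^+ n) <= d * Fb x.
Proof.
move=> d0; have [M [x1 [M1 x10 H]]] := survival_decay d0.
have M0 : 0 < M by exact: lt_le_trans M1.
have Mi : 0 < M^-1 by rewrite invr_gt0.
have [n Hn] := small_geometric (ltW rho_gt0) rho_lt1 Mi.
exists n, x1 => // x xx1; rewrite mulrC; apply: H => //.
by rewrite -[M]invrK lef_pV2 ?posrE.
Qed.

(** Cut the series into blocks of length [M] with [Fbar(x / rho^M) <= Fbar(x) / 4].
The part after the first block is [rho^M] times a series of the same kind, so a
bound [K Fbar] for the latter becomes [(K / 4 + K2) Fbar] for the former.  Adding
back the [M] claims of the block costs a factor at most [2] by Kesten's bound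
with a suitable [e].  Thus [K] is reproduced as soon as it is large enough. *)
Lemma discounted_sum_bound : exists2 K : R, 0 <= K & forall m j x,
  survival P (S (iota j m) (fun i => rho ^+ (i - j))) x <= K * Fb x.
Proof.
have d0 : 0 < 4^-1 :> R by rewrite invr_gt0.
have [M [x1 x10 HM]] := survival_decay_pow d0.
have [e e0 He] := @small_growth R 2 M (ltr1n _ 2).
have [c c0 Hc] := kesten_bound mX X_iid mf f_ge0 FY e0.
pose K2 := (Fb x1)^-1.
have K20 : 0 <= K2 by rewrite invr_ge0 ltW.
(* K satisfies 2 (K / 4 + K2 + c) <= K and covers a series of one block *)
pose K := 4 * (K2 + c) + 2 * (1 + c).
have K0 : 0 <= K by rewrite /K; lra.
have eX n : (n <= M)%N -> 1 <= (1 + e) ^+ n /\ (1 + e) ^+ n <= 2.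
  move=> nM; split; first by rewrite exprn_ege1// lerDl ltW.
  by apply: le_trans He; rewrite ler_weXn2l// lerDl ltW.
have w1 i j : rho ^+ (i - j) <= 1 by rewrite exprn_ile1// ltW.
exists K => // m; elim/ltn_ind: m => m IH j x.
have Fx0 := Fb_gt0 x.
have [mM|Mm] := leqP m M.
  rewrite -[iota j m]cats0.
  apply: le_trans (Hc _ [::] _ 1 (iota_uniq j m) _ _ ler01 (survival_nil P mX mf f_ge0 _) x) _ => //.
  rewrite size_iota ler_wpM2r ?survival_ge0//.
  by have [h1 h2] := eX _ mM; rewrite /K; nra.
case: M HM He eX Mm => [|M] HM He eX Mm.
  have := HM x1 (lexx _); rewrite expr0 divr1; have := Fb_gt0 x1; lra.
have E : iota j m = iota j M.+1 ++ iota (j + M.+1) (m - M.+1).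
  by rewrite -iotaD subnKC// ltnW.
have HI y : survival P (S (iota (j + M.+1) (m - M.+1)) (fun i => rho ^+ (i - j))) y <=
    (K / 4 + K2) * Fb y.
  have -> : survival P (S (iota (j + M.+1) (m - M.+1)) (fun i => rho ^+ (i - j))) y =
     survival P (S (iota (j + M.+1) (m - M.+1)) (fun i => rho ^+ (i - (j + M.+1)))) (y / rho ^+ M.+1).
    rewrite -survival_scale//; apply: eq_survival => w.
    rewrite -weighted_sum_scale; congr (_ w); apply: eq_weighted_sum => i.
    by rewrite mem_iota => /andP[ji _]; rewrite -exprD addnC subnDA subnK// -(leq_add2l j) subnKC// (leq_trans _ ji)// leq_addr.
  have Fy0 := Fb_gt0 y.
  have [x1y|yx1] := leP x1 y.
    apply: le_trans (IH _ _ _ _) _; first by rewrite ltn_subrL (leq_ltn_trans _ Mm).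
    apply: (@le_trans _ _ (K * (4^-1 * Fb y))); first by rewrite ler_wpM2l// HM.
    by have := mulr_ge0 K20 (ltW Fy0); lra.
  apply: le_trans (survival_le1 _ _ _) _ => //.
  have : 1 <= K2 * Fb y.
    by rewrite /K2 mulrC ler_pdivlMr// mul1r survival_mono// ltW.
  have : 0 <= K / 4 * Fb y by rewrite mulr_ge0 ?divr_ge0// ltW.
  lra.
rewrite E.
apply: le_trans (Hc _ _ _ (K / 4 + K2) (iota_uniq _ _) _ _ _ HI x) _ => //.
- move=> i; rewrite !mem_iota => /andP[_ h]; apply/negP => /andP[h' _].
  by rewrite ltnNge h' in h.
- by rewrite addr_ge0// divr_ge0.
rewrite size_iota ler_wpM2r ?survival_ge0//.
have [h1 h2] := eX _ (leqnn _).
have : (1 + e) ^+ M.+1 * (K / 4 + K2 + c) <= 2 * (K / 4 + K2 + c).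
  by rewrite ler_wpM2r// !addr_ge0// divr_ge0.
rewrite /K; lra.
Qed.

(** The same decomposition into blocks as for [discounted_sum_bound]: one block
contributes at most [M Fbar(x)] and the remainder at most half of the bound. *)
Lemma discounted_tail_sum : exists2 K : R, 0 <= K & exists2 x1 : R, 0 <= x1 &
  forall m x, x1 <= x -> \sum_(0 <= i < m) Fb (x / rho ^+ i) <= K * Fb x.
Proof.
have d0 : 0 < 2^-1 :> R by rewrite invr_gt0.
have [M [x1 x10 HM]] := survival_decay_pow d0.
exists (2 * M%:R); first by rewrite mulr_ge0.
exists x1 => // m; elim/ltn_ind: m => m IH x x1x.
have x_ge0 : 0 <= x by exact: le_trans x1x.
have B n : \sum_(0 <= i < n) Fb (x / rho ^+ i) <= n%:R * Fb x.
  rewrite big_mkord; apply: le_trans (_ : \sum_(i < n) Fb x <= _).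
    apply: ler_sum => i _; apply: survival_mono => //.
    by apply: le_div_weight => //; rewrite exprn_ile1// ltW.
  by rewrite sumr_const card_ord mulr_natl.
have Fx0 := Fb_gt0 x.
have [mM|Mm] := leqP m M.
  apply: le_trans (B m) _; rewrite ler_wpM2r ?survival_ge0//.
  by rewrite -natrM ler_nat (leq_trans mM)// leq_pmull.
case: M HM IH Mm => [|M] HM IH Mm.
  have := HM x1 (lexx _); rewrite expr0 divr1; have := Fb_gt0 x1; lra.
rewrite (big_cat_nat (n:=M.+1))//=; last exact: ltnW.
have -> : \sum_(M.+1 <= i < m) Fb (x / rho ^+ i) =
    \sum_(0 <= i < m - M.+1) Fb (x / rho ^+ M.+1 / rho ^+ i).
  rewrite -{1}[M.+1]add0n big_addn; apply: eq_bigr => i _.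
  by rewrite exprD invfM mulrA mulrAC.
have xr : x <= x / rho ^+ M.+1 by apply: le_div_weight => //; rewrite exprn_ile1// ltW.
have := IH (m - M.+1)%N _ (x / rho ^+ M.+1) (le_trans x1x xr).
rewrite ltn_subrL (leq_ltn_trans _ Mm)// => /(_ isT) H.
have := B M.+1.
have := ler_wpM2l (_ : 0 <= 2 * M.+1%:R :> R) (HM x x1x).
rewrite mulr_ge0// => /(_ isT); lra.
Qed.

(** Divide by the first weight, so that [u 0 = 1].  The weights below [rho^n] are
dominated by [rho^n] times a discounted series, whose tail is at most
[K Fbar(z / rho^n) <= (d / 2) Fbar(z)]; it serves as initial block.  At most [n + 1]
weights are above [rho^n], and the term of the first one, [Fbar(z)], absorbs the
error.  Normalising is what makes the bound uniform in the first arrival time. *)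
Lemma upper_discounted_weights (d : R) : 0 < d -> exists2 x1 : R, 0 <= x1 &
  forall v m x, (forall i, 0 <= v i) -> v 0%N <= 1 ->
  (forall i, v i.+1 <= rho * v i) -> x1 <= x ->
  survival P (S (iota 0 m) v) x <= (1 + d) * \sum_(i < m) scaled_tail P X f (v i) x.
Proof.
move=> d0; have d20 : 0 < d / 2 by rewrite divr_gt0.
have [K K0 HK] := discounted_sum_bound.
have K1 : 0 < d / 2 / (K + 1) by rewrite divr_gt0// ltr_wpDl.
have [n [x1 x10 Hn]] := survival_decay_pow K1.
have [e e0 He] : exists2 e : R, 0 < e & (1 + e) ^+ n.+1 <= (1 + d) / (1 + d / 2).
  by apply: small_growth; rewrite ltr_pdivlMr ?mul1r; lra.
have a0 := rhoX_gt0 n.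
have [x2 x21 H2] := survival_add_claims_le mX X_iid mf f_ge0 FY x1 n.+1 a0 e0.
exists x2 => [|v m x v_ge0 v1 vdec x2x]; first exact: le_trans x21.
have x_ge0 : 0 <= x by rewrite (le_trans x10)// (le_trans x21).
have d1 : 0 <= 1 + d by lra.
case: m => [|m]; first by rewrite big_ord0 mulr0 survival_nil0.
have vmono i j : (i <= j)%N -> v j <= v i.
  move=> /subnKC <-; elim: (j - i)%N => [|k IH]; first by rewrite addn0.
  rewrite addnS; apply: le_trans (vdec _) (le_trans _ IH).
  by rewrite ler_piMl// ltW.
have [v00|v0n] := eqVneq (v 0%N) 0.
  have vz i : v i = 0 by apply/eqP; rewrite eq_le v_ge0 andbT -v00 vmono.
  rewrite (@weighted_sum0 _ _ _ _ _ _ _ (iota 0 m.+1))// survival_nil0//.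
  by rewrite mulr_ge0// sumr_ge0// => i _; exact: scaled_tail_ge0.
have vp : 0 < v 0%N by rewrite lt_neqAle eq_sym v0n v_ge0.
pose u i := v i / v 0%N; pose z := x / v 0%N.
have xz : x <= z by exact: le_div_weight.
have uE i : v i = v 0%N * u i by rewrite /u mulrCA divff// mulr1.
have -> : survival P (S (iota 0 m.+1) v) x = survival P (S (iota 0 m.+1) u) z.
  rewrite -survival_scale//; apply: eq_survival => w.
  by rewrite -weighted_sum_scale; congr (_ w); apply: eq_weighted_sum => i _.
have -> : \sum_(i < m.+1) scaled_tail P X f (v i) x = \sum_(i < m.+1) scaled_tail P X f (u i) z.
  apply: eq_bigr => i _; rewrite /scaled_tail -survival_scale//.
  by apply: eq_survival => w; rewrite mulrA -uE.
have u0 : u 0%N = 1 by rewrite /u divff.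
have u_ge0 i : 0 <= u i by rewrite /u divr_ge0.
have udec i j : u (i + j)%N <= rho ^+ j * u i.
  elim: j => [|j IH]; first by rewrite addn0 expr0 mul1r.
  rewrite addnS exprS -mulrA; apply: le_trans (_ : rho * u (i + j)%N <= _).
    by rewrite /u mulrA ler_wpM2r ?invr_ge0.
  by rewrite ler_wpM2l// ltW.
have umono i j : (i <= j)%N -> u j <= u i.
  by move=> ij; rewrite /u ler_wpM2r ?invr_ge0// vmono.
have [j jm [Hj1 Hj2]] := prefix_length (fun i => rho ^+ n <= u i) m.+1.
have j0 : (0 < j)%N.
  rewrite lt0n; apply/eqP => jz; move: Hj2; rewrite jz => /(_ isT).
  by rewrite u0 exprn_ile1// ltW.
have jn : (j <= n.+1)%N.
  rewrite leqNgt; apply/negP => nj; have := Hj1 _ nj.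
  have := udec 0%N n.+1; rewrite add0n u0 mulr1 => h h'.
  have := le_trans h' h; rewrite exprS leNgt => /negP; apply.
  by rewrite gtr_pMl.
pose I := iota j (m.+1 - j).
have HI y : x1 <= y -> survival P (S I u) y <= tail_mixture P (Y 0%N) [:: (d / 2, 1)] y.
  move=> x1y; rewrite /tail_mixture big_seq1/= divr1.
  apply: (@le_trans _ _ (survival P (S I (fun i => rho ^+ n * rho ^+ (i - j))) y)).
    apply: le_survival_sum => // i; rewrite mem_iota subnKC// => /andP[ji im].
    rewrite -{1}(subnKC ji) (le_trans (udec _ _))// mulrC ler_wpM2r ?exprn_ge0 ?(ltW rho_gt0)//.
    by rewrite ltW// ltNge Hj2// (leq_ltn_trans ji).
  have -> : survival P (S I (fun i => rho ^+ n * rho ^+ (i - j))) y =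
      survival P (S I (fun i => rho ^+ (i - j))) (y / rho ^+ n).
    by rewrite -survival_scale//; apply: eq_survival => w; rewrite -weighted_sum_scale.
  apply: le_trans (HK _ _ _) _.
  apply: (@le_trans _ _ (K * (d / 2 / (K + 1) * Fb y))); first by rewrite ler_wpM2l// Hn.
  rewrite mulrA ler_wpM2r ?survival_ge0// mulrA ler_pdivrMr ?ltr_wpDl//.
  by rewrite mulrC ler_wpM2l ?(ltW d20)// lerDl.
have -> : iota 0 m.+1 = iota 0 j ++ I by rewrite -{1}(subnKC jm) iotaD.
apply: le_trans (H2 j [:: (d / 2, 1)] I u jn _ _ _ _ HI z _) _.
- by move=> i ij; split; [exact: Hj1|rewrite -u0 umono].
- by move=> i i' ii' _; exact: umono.
- by move=> i; rewrite mem_iota => /andP[].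
- move=> w i; rewrite inE => /eqP -> _ /=; split => //; first exact: ltW.
  by rewrite -u0 umono.
- exact: le_trans xz.
rewrite /tail_mixture big_seq1/= divr1.
set A := \sum_(i < j) _; set B := \sum_(i < m.+1) _.
have AB : A <= B.
  rewrite /A /B -(big_mkord predT (fun i => Fb (z / u i))) -(big_mkord predT (fun i => scaled_tail P X f (u i) z)).
  rewrite [leRHS](big_cat_nat (n:=j))//= [leLHS]big_nat_cond [X in _ <= X + _]big_nat_cond.
  rewrite -[leLHS]addr0 lerD//; last by apply: sumr_ge0 => i _; exact: scaled_tail_ge0.
  apply: ler_sum => i /andP[/andP[_ ij] _]; rewrite scaled_tailE//.
  by apply: lt_le_trans (Hj1 _ ij).
have FA : Fb z <= A.
  rewrite /A (bigD1 (Ordinal j0))//= u0 divr1 lerDl.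
  by apply: sumr_ge0 => i _; exact: survival_ge0.
have A0 : 0 <= A by apply: sumr_ge0 => i _; exact: survival_ge0.
have Ej : (1 + e) ^+ j <= (1 + d) / (1 + d / 2).
  by apply: le_trans He; rewrite ler_weXn2l// lerDl ltW.
have Ej0 : 0 <= (1 + e) ^+ j by rewrite exprn_ge0// addr_ge0// ltW.
apply: (@le_trans _ _ ((1 + d) / (1 + d / 2) * ((1 + d / 2) * A))).
  apply: ler_pM => //; first by rewrite addr_ge0// mulr_ge0 ?survival_ge0// ltW.
  have := ler_wpM2l (ltW d20) FA; lra.
rewrite mulrA divfK ?gt_eqF//; last lra.
by rewrite ler_wpM2l.
Qed.

End PositivelyDecreasing.

(** * Renewal arrivals *)

Lemma measurable_le_cst (R : realType) d (T : measurableType d) (Z : T -> R) x :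
  measurable_fun setT Z -> measurable [set w | Z w <= x].
Proof.
move=> mZ; rewrite (_ : [set w | _] = ~` [set w | x < Z w]); last first.
  by apply/seteqP; split => w /=; rewrite leNgt => /negP.
exact/measurableC/measurable_gt.
Qed.

Section Renewal.
Context {R : realType} {dT : measure_display} {T : measurableType dT}.
Variable P : probability T R.
Variable theta : nat -> T -> R.
Hypotheses (mtheta : forall i, measurable_fun setT (theta i)) (theta_iid : iid P theta).
Hypothesis theta_ge0 : forall k w, 0 <= theta k w.
Hypothesis theta_nondegenerate : P [set w | theta 0%N w = 0] <> 1%E.

Notation tau := (tau theta).

Lemma tau0 w : tau 0%N w = 0. Proof. by rewrite /Defs.tau big_ord0. Qed.

Lemma tauS n w : tau n.+1 w = tau n w + theta n w.
Proof. by rewrite /Defs.tau big_ord_recr. Qed.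

Lemma tau_ge0 n w : 0 <= tau n w. Proof. by apply: sumr_ge0. Qed.

Lemma tau_mono m n w : (m <= n)%N -> tau m w <= tau n w.
Proof.
move=> /subnKC <-; elim: (n - m)%N => [|k IH]; first by rewrite addn0.
by rewrite addnS tauS (le_trans IH)// lerDl.
Qed.

Lemma measurable_tau n : measurable_fun setT (tau n).
Proof. exact: measurable_sum. Qed.

Definition theta_sum (I : seq nat) w := \sum_(i <- I) theta i w.

Lemma tauE n w : tau n w = theta_sum (iota 0 n) w.
Proof. by rewrite /Defs.tau /theta_sum -(big_mkord predT (fun i => theta i w)) /index_iota subn0. Qed.

Let f0 (x : R) := Num.max x 0.
Let mf0 : measurable_fun setT f0. Proof. exact: measurable_maxr. Qed.
Let f0_ge0 x : 0 <= f0 x. Proof. by rewrite /f0 le_max lexx orbT. Qed.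

Let scoreE i w : score theta f0 i w = theta i w.
Proof. by rewrite /score /f0; apply/max_idPl. Qed.

Let theta_sumE I : theta_sum I = weighted_sum theta f0 I (fun=> 1).
Proof.
apply/funext => w; rewrite /theta_sum /weighted_sum.
by apply: eq_bigr => i _; rewrite mul1r scoreE.
Qed.

Lemma measurable_theta_sum I : measurable_fun setT (theta_sum I).
Proof. exact: measurable_sum. Qed.

(** The Laplace transform of the gaps at [1]. *)
Definition laplace := mean P (fun w => expR (- theta 0%N w)).

Lemma bounded_measurable_laplace : bounded_measurable (fun w => expR (- theta 0%N w)).
Proof.
split; first by apply: measurableT_comp => //; exact: measurable_funN.
by exists 1 => w; rewrite ger0_norm ?expR_ge0// -expR0 ler_expR oppr_le0.
Qed.

Lemma laplace_ge0 : 0 <= laplace.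
Proof. by apply: mean_ge0 => w; exact: expR_ge0. Qed.

(** Otherwise the nonnegative variable [1 - exp(- theta)] would have mean zero and
vanish almost surely. *)
Lemma laplace_lt1 : laplace < 1.
Proof.
have bl := bounded_measurable_laplace.
have bg : bounded_measurable (fun w => 1 + -1 * expR (- theta 0%N w)).
  by apply: bounded_measurableD => //; exact: bounded_measurableM.
have g0 w : 0 <= 1 + -1 * expR (- theta 0%N w).
  by rewrite mulN1r subr_ge0 -expR0 ler_expR oppr_le0.
have mE : mean P (fun w => 1 + -1 * expR (- theta 0%N w)) = 1 - laplace.
  by rewrite meanD ?meanZ ?mean_cst ?mulN1r//; exact: bounded_measurableM.
rewrite lt_neqAle -subr_ge0 -mE mean_ge0// andbT; apply/eqP => l1.
apply: theta_nondegenerate.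
have : (\int[P]_w `|(1 + -1 * expR (- theta 0%N w))%:E| = 0)%E.
  under eq_integral do rewrite gee0_abs ?lee_fin//.
  by rewrite mean_EFin// mE l1 subrr.
move/ae_eq_integral_abs => /(_ measurableT).
have mgE : measurable_fun setT (fun w => (1 + -1 * expR (- theta 0%N w))%:E).
  by apply/measurable_EFinP; exact: bg.1.
move=> /(_ mgE) [N [mN PN NS]].
have m0 : measurable [set w | theta 0%N w = 0].
  by have := mtheta 0%N measurableT (measurable_set1 (0 : R)); rewrite setTI.
have := @probability_setC _ _ _ P _ m0.
have -> : P (~` [set w | theta 0%N w = 0]) = 0%E.
  apply/eqP; rewrite eq_le measure_ge0 andbT -PN le_measure// ?inE//; first exact: measurableC.
  move=> w /= w0; apply: NS => /= /(_ I) [] /eqP; rewrite mulN1r subr_eq0 eq_sym -expR0.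
  by move=> /eqP/expR_inj/eqP; rewrite oppr_eq0 => /eqP.
rewrite (probE P m0) => /esym/eqP.
rewrite -EFinB eqe subr_eq0 => /eqP <-//.
Qed.

(** Markov's inequality for [exp(- sum)], proved by induction on the number of gaps. *)
Lemma renewal_exponential_bound I x : uniq I ->
  prob P [set w | theta_sum I w <= x] <= expR x * laplace ^+ size I.
Proof.
move=> uI.
have : 1 - expR x * laplace ^+ size I <= survival P (theta_sum I) x.
  elim: I uI x => [|k I IH] uI x.
    rewrite theta_sumE weighted_sum_nil expr0 mulr1.
    have [x0|x0] := ltP x 0; first by rewrite survival_neg// gerBl expR_ge0.
    apply: le_trans (survival_ge0 _ _ _); rewrite subr_le0 -expR0 ler_expR//.
  move: uI => /=/andP[kI uI].
  have -> : survival P (theta_sum (k :: I)) x =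
      mean P (fun w => survival P (theta_sum I) (x - theta 0%N w)).
    transitivity (survival P (fun w => weighted_sum theta f0 I (fun=> 1) w + 1 * score theta f0 k w) x).
      apply: eq_survival => w; rewrite -theta_sumE mul1r scoreE /theta_sum big_cons addrC//.
    rewrite survival_add// theta_sumE; apply: eq_mean => w.
    by rewrite mul1r scoreE.
  have bl := bounded_measurable_laplace.
  have -> : 1 - expR x * laplace ^+ (size I).+1 =
     mean P (fun w => 1 + (- (expR x * laplace ^+ size I)) * expR (- theta 0%N w)).
    rewrite meanD ?meanZ ?mean_cst//; last exact: bounded_measurableM.
    by rewrite -/laplace exprSr mulNr mulrA.
  apply: le_mean.
  - by apply: bounded_measurableD => //; exact: bounded_measurableM.
  - have mS := measurable_theta_sum I.
    apply: (@bounded_measurable_comp _ _ _ (survival P (theta_sum I)) (fun w => x - theta 0%N w)).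
    + exact: measurable_survival.
    + by move=> y; rewrite survival_ge0 survival_le1.
    + exact: measurable_funB.
  move=> w; apply: le_trans (IH uI _).
  by rewrite expRD mulNr mulrAC.
move=> H; have mS := measurable_theta_sum I.
have -> : prob P [set w | theta_sum I w <= x] = 1 - survival P (theta_sum I) x.
  rewrite -prob_neg; last exact: measurable_gt.
  by congr (prob P _); apply/seteqP; split => w /=; rewrite -leNgt.
by rewrite lerBlDl -lerBlDr.
Qed.

(** A function of one gap is independent of the other gaps. *)
Lemma mean_gap_block (G : R -> R) k I x : k \notin I -> measurable_fun setT G ->
  (forall y, 0 <= G y <= 1) ->
  mean P (fun w => G (theta k w) * (theta_sum I w <= x)%R%:R) =
  mean P (fun w => G (theta k w)) * prob P [set w | theta_sum I w <= x].
Proof.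
move=> kI mG G01.
have mGk : bounded_measurable (fun w => G (theta k w)) by exact: bounded_measurable_comp.
have mS := measurable_theta_sum I.
have mle : measurable [set w | theta_sum I w <= x].
  exact: measurable_le_cst.
pose D1 : set nat := [set k]; pose D2 : set nat := [set` I].
have D12 : D1 `&` D2 = set0.
  by apply/seteqP; split => // i [/= -> iI]; rewrite iI in kI.
have bB : bounded_measurable (fun w => (theta_sum I w <= x)%R%:R : R).
  exact: bounded_measurable_bool.
rewrite -[in RHS]mean_bool//.
apply: EFin_inj; rewrite -mean_EFin; last 2 first.
- exact: bounded_measurableM.
- by move=> w; rewrite mulr_ge0//; have /andP[] := G01 (theta k w).
pose gen D := (\bigcup_(i in D) preimage_set_system setT (theta i) measurable).
pose h (z : g_sigma_algebraType (gen D1) * g_sigma_algebraType (gen D2)) : \bar R :=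
  (G (theta k z.1) * (theta_sum I z.2 <= x)%R%:R)%:E.
rewrite (_ : (fun w => _) = (fun w => h (w, w)))//.
rewrite (decoupling (sigma_of_measurable mtheta (D:=D1)) (sigma_of_measurable mtheta (D:=D2))
  (independent_blocks mtheta theta_iid.1 D12)) /h; last 2 first.
- apply/measurable_EFinP; apply: measurable_funM.
    apply: (measurableT_comp mG).
    apply: (measurableT_comp (f := (theta k : g_sigma_algebraType (gen D1) -> R))) => //.
    exact: measurable_sigma_of.
  have [] // := @bounded_measurable_bool R _ (g_sigma_algebraType (gen D1) * g_sigma_algebraType (gen D2))%type
    (fun z => theta_sum I z.2 <= x)%R _.
  have mS2 : measurable_fun setT (fun z : g_sigma_algebraType (gen D1) * g_sigma_algebraType (gen D2) => theta_sum I z.2).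
    rewrite theta_sumE.
    apply: (measurableT_comp (f := (weighted_sum theta f0 I (fun=> 1) : g_sigma_algebraType (gen D2) -> R))) => //.
    exact: measurable_weighted_sum_gen.
  exact: measurable_le_cst.
- by move=> z; rewrite lee_fin mulr_ge0//; have /andP[] := G01 (theta k z.1).
under eq_integral => w1 _ /=.
  rewrite mean_EFin; last 2 first.
  - exact: bounded_measurableM.
  - by move=> w; rewrite mulr_ge0//; have /andP[] := G01 (theta k w1).
  rewrite meanZ// mulrC.
  over.
rewrite mean_EFin ?meanZ//.
- by rewrite mulrC.
- exact: bounded_measurableM.
- move=> w; rewrite mulr_ge0//; first exact: mean_ge0.
  by have /andP[] := G01 (theta k w).
Qed.

Lemma N_ge t n w : 0 <= t -> (n%:R%:E <= N_ theta t w)%E = (tau n w <= t).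
Proof.
move=> t0; apply/idP/idP => [nN|tn]; last first.
  by apply: ereal_sup_ubound; exists n.
rewrite leNgt; apply/negP => tn.
have : (N_ theta t w <= (n%:R - 1)%:E)%E.
  apply: ge_ereal_sup => _ [m /= mt <-]; rewrite lee_fin lerBrDr.
  rewrite natr1 ler_nat ltnNge; apply/negP => /(tau_mono w) nm.
  by have := lt_le_trans tn (le_trans nm mt); rewrite ltxx.
by move=> /(le_trans nN); rewrite lee_fin; lra.
Qed.

Lemma measurable_N t : measurable_fun setT (N_ theta t).
Proof.
apply: (measurability (@ErealGenOInfty.G R)); first exact: ErealGenOInfty.measurableE.
move=> _ [_ [y ->] <-]; rewrite setTI.
rewrite (_ : _ @^-1` _ = \bigcup_n [set w | tau n w <= t /\ y < n%:R]).
  apply: bigcupT_measurable => n; have [yn|ny] := ltP y n%:R.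
    rewrite (_ : [set w | _] = [set w | tau n w <= t]); first exact/measurable_le_cst/measurable_tau.
    by apply/seteqP; split => w /=; [case|].
  rewrite (_ : [set w | _] = set0)//; by apply/seteqP; split => w //= -[].
apply/seteqP; split => w /=; rewrite in_itv/= andbT.
  by move=> /ereal_sup_gt[_ [n /= tn <-]]; rewrite lte_fin => yn; exists n.
move=> [n _ [tn yn]]; apply: lt_le_trans (_ : (n%:R%:E <= _)%E); first by rewrite lte_fin.
by apply: ereal_sup_ubound; exists n.
Qed.

Notation genN := (\bigcup_(t in [set t : R | 0 <= t]) preimage_set_system setT (N_ theta t) measurable).

(** [tau n <= t] holds exactly when [N_t >= n], so independence of the claims from
the counting process is independence from the arrival times. *)
Lemma measurable_tau_genN n : measurable_fun setT (tau n : g_sigma_algebraType genN -> R).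
Proof.
apply: (measurability (@RGenOInfty.G R)); first exact: RGenOInfty.measurableE.
move=> _ [_ [t ->] <-].
rewrite setTI; have [t0|t0] := leP 0 t; last first.
  rewrite (_ : _ @^-1` _ = setT); first exact: measurableT.
  apply/seteqP; split => // w _ /=; rewrite in_itv/= andbT.
  exact: lt_le_trans (tau_ge0 n w).
rewrite (_ : _ @^-1` _ = ~` [set w | tau n w <= t]); last first.
  by apply/seteqP; split => w /=; rewrite in_itv/= andbT ltNge => /negP.
apply: measurableC; apply: sub_sigma_algebra; exists t => //.
exists `[n%:R%:E, +oo%E]%classic; first exact: emeasurable_itv.
by rewrite setTI; apply/seteqP; split => w /=; rewrite in_itv/= leey andbT N_ge.
Qed.

End Renewal.

(** * Claims discounted at random arrival times *)

Section SingleBigClaim.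
Context {R : realType} {dT : measure_display} {T : measurableType dT}.
Variable P : probability T R.
Context {d' : measure_display} {V : measurableType d'}.
Variables (X : nat -> T -> V) (f : V -> R).
Hypotheses (mX : forall i, measurable_fun setT (X i)) (X_iid : iid P X).
Hypotheses (mf : measurable_fun setT f) (f_ge0 : forall v, 0 <= f v).

Notation Y := (score X f).
Notation Fb := (survival P (Y 0%N)).
Notation gen D := (\bigcup_(i in D) preimage_set_system setT (X i) measurable).

Let mY i : measurable_fun setT (Y i). Proof. exact: measurable_score. Qed.

Definition some_big_claim n (v : nat -> R) (x : R) (w : T) : bool :=
  has (fun i => x < v i * Y i w) (iota 0 n).

Lemma some_big_claimS n v x w :
  some_big_claim n.+1 v x w = some_big_claim n v x w || (x < v n * Y n w).
Proof. by rewrite /some_big_claim -addn1 iotaD has_cat /= orbF. Qed.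

Lemma measurable_some_big_claim n (v : T -> nat -> R) x :
  (forall i, measurable_fun setT (v^~ i)) ->
  measurable [set w | some_big_claim n (v w) x w].
Proof.
move=> mv; elim: n => [|n IH].
  by rewrite (_ : [set w | _] = set0)//; apply/seteqP; split.
rewrite (_ : [set w | _] =
  [set w | some_big_claim n (v w) x w] `|` [set w | x < v w n * Y n w]).
  by apply: measurableU => //; apply: measurable_gt; exact: measurable_funM.
by apply/seteqP; split => w /=; rewrite some_big_claimS => /orP.
Qed.

Lemma measurable_some_big_claim_gen n v x (D : set nat) :
  (forall i, (i < n)%N -> D i) ->
  <<s gen D >> [set w | some_big_claim n v x w].
Proof.
elim: n => [|n IH] nD.
  rewrite (_ : [set w | _] = set0); first exact: (@measurable0 _ (g_sigma_algebraType (gen D))).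
  by apply/seteqP; split.
rewrite (_ : [set w | _] = [set w | some_big_claim n v x w] `|` [set w | x < v n * Y n w]).
  apply: (@measurableU _ (g_sigma_algebraType (gen D))).
    by apply: IH => i ni; apply: nD; exact: ltnW.
  apply: (@measurable_gt R _ (g_sigma_algebraType (gen D))); apply: measurable_funM => //.
  by apply: measurable_score_gen => //; exact: nD.
by apply/seteqP; split => w /=; rewrite some_big_claimS => /orP.
Qed.

(** Induction on [n].  Adding the claim [n] increases the probability by that of
[x < v n * Y n], less the product with the probability that an earlier claim is
big; this product is at most [n Fbar(x)] times the new term. *)
Lemma some_big_claim_bounds n (v : nat -> R) (x : R) : 0 <= x -> (forall i, 0 <= v i <= 1) ->
  n%:R * Fb x <= 1 ->
  (1 - n%:R * Fb x) * \sum_(i < n) scaled_tail P X f (v i) x <=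
    prob P [set w | some_big_claim n v x w] <= n%:R * Fb x.
Proof.
move=> x0 v01; have F0 := survival_ge0 P (Y 0%N) x.
elim: n => [_|n IH nF].
  rewrite big_ord0 mulr0 mul0r prob_ge0/= (_ : [set w | _] = set0).
    by rewrite /prob measure0.
  by apply/seteqP; split.
have nF' : n%:R * Fb x + Fb x <= 1 by move: nF; rewrite -natr1 mulrDl mul1r.
have {}IH := IH _.
have /IH /andP[IH1 IH2] : n%:R * Fb x <= 1 by lra.
rewrite big_ord_recr/= -natr1 mulrDl mul1r.
set A := [set w | some_big_claim n v x w] in IH1 IH2 *.
pose B := [set w | x < v n * Y n w].
have mA : measurable A by exact: (@measurable_some_big_claim n (fun=> v)).
have mB : measurable B by apply: measurable_gt; exact: measurable_funM.
have PB : prob P B = scaled_tail P X f (v n) x by exact: survival_score.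
have PB1 : prob P B <= Fb x.
  rewrite PB; apply: le_survival => //; first exact: measurable_funM.
  by move=> w; rewrite ler_piMl ?score_ge0//; have /andP[] := v01 n.
have PAB : prob P (A `&` B) = prob P A * prob P B.
  apply: EFin_inj; rewrite EFinM -!probE//; last exact: measurableI.
  pose D1 : set nat := [set i | (i < n)%N]; pose D2 : set nat := [set n].
  apply: (@independent_blocks _ _ _ P _ _ X mX X_iid.1 D1 D2).
  - by apply/seteqP; split => // i [lin Ei]; have Ein : i = n := Ei; have : (i < n)%N := lin; rewrite Ein ltnn.
  - exact: measurable_some_big_claim_gen.
  - apply: (@measurable_gt R _ (g_sigma_algebraType (gen D2))); apply: measurable_funM => //.
    exact: measurable_score_gen.
have -> : [set w | some_big_claim n.+1 v x w] = A `|` B.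
  by apply/seteqP; split => w /=; rewrite some_big_claimS => /orP.
have PU : prob P (A `|` B) = prob P A + prob P B - prob P (A `&` B).
  apply: EFin_inj; rewrite EFinB EFinD -!probE//; try exact: measurableI; try exact: measurableU.
  by rewrite measureUfinr//; apply: le_lt_trans (ltry 1); exact: probability_le1.
rewrite PU PAB PB.
have p0 := scaled_tail_ge0 P X f (v n) x; have a0 := prob_ge0 P A.
set s := \sum_(i < n) _ in IH1 *.
have s0 : 0 <= s by apply: sumr_ge0 => i _; exact: scaled_tail_ge0.
rewrite PB in PB1; apply/andP; split; last by have := mulr_ge0 a0 p0; lra.
have := ler_wpM2r p0 IH2; have := mulr_ge0 F0 s0; have := mulr_ge0 F0 p0; lra.
Qed.

End SingleBigClaim.

Section DiscountedClaims.
Context {R : realType} {dT : measure_display} {T : measurableType dT}.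
Variable P : probability T R.
Context {d' : measure_display} {V : measurableType d'}.
Variables (X : nat -> T -> V) (f : V -> R).
Hypotheses (mX : forall i, measurable_fun setT (X i)) (X_iid : iid P X).
Hypotheses (mf : measurable_fun setT f) (f_ge0 : forall v, 0 <= f v).
Variable theta : nat -> T -> R.
Hypotheses (mtheta : forall i, measurable_fun setT (theta i)) (theta_iid : iid P theta).
Hypothesis theta_ge0 : forall k w, 0 <= theta k w.
Hypothesis theta_nondegenerate : P [set w | theta 0%N w = 0] <> 1%E.
Hypothesis X_N_independent : independent_systems P
     (sigma_of [set: nat] X) (sigma_of [set t : R | 0 <= t] (N_ theta)).
Variable r : R.
Hypothesis r_ge0 : 0 <= r.

Notation Y := (score X f).
Notation S := (weighted_sum X f).
Notation Fb := (survival P (Y 0%N)).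
Notation tau := (tau theta).
Notation q := (laplace P theta).

Hypothesis FY : asymptotically_double P (Y 0%N).

Let mY i : measurable_fun setT (Y i). Proof. exact: measurable_score. Qed.
Let Fb_gt0 x : 0 < Fb x. Proof. exact: FY.1. Qed.

Definition claim_weight (t : R) (w : T) (i : nat) : R :=
  (tau i.+1 w <= t)%R%:R * expR (- r * tau i.+1 w).

Lemma claim_weight_ge0 t w i : 0 <= claim_weight t w i.
Proof. by rewrite mulr_ge0 ?expR_ge0. Qed.

Lemma claim_weight_le1 t w i : claim_weight t w i <= 1.
Proof.
rewrite /claim_weight; case: (leP (tau i.+1 w) t) => _; last by rewrite mul0r.
by rewrite mul1r -expR0 ler_expR mulNr oppr_le0 mulr_ge0// tau_ge0.
Qed.

Lemma claim_weight_mono t w i j : (i <= j)%N -> claim_weight t w j <= claim_weight t w i.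
Proof.
move=> ij; have tij : tau i.+1 w <= tau j.+1 w by exact: tau_mono.
rewrite /claim_weight; case: (leP (tau j.+1 w) t) => jt; last by rewrite mul0r mulr_ge0 ?expR_ge0.
by rewrite (le_trans tij jt) !mul1r ler_expR !mulNr lerN2 ler_wpM2l.
Qed.

Lemma claim_weight_gt0 t w i : (0 < claim_weight t w i) = (tau i.+1 w <= t).
Proof. by rewrite /claim_weight; case: (leP (tau i.+1 w) t); rewrite ?mul1r ?expR_gt0// mul0r ltxx. Qed.

Lemma scaled_tail_claim_weight t w i x : 0 <= x ->
  scaled_tail P X f (claim_weight t w i) x =
  (tau i.+1 w <= t)%R%:R * Fb (x * expR (r * tau i.+1 w)).
Proof.
move=> x0; rewrite /claim_weight; case: (leP (tau i.+1 w) t) => _; last by rewrite !mul0r scaled_tail0.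
by rewrite !mul1r scaled_tailE ?expR_gt0// mulNr expRN invrK.
Qed.

Notation genX := (\bigcup_(i in [set: nat]) preimage_set_system setT (X i) measurable).
Notation genN := (\bigcup_(t in [set t : R | 0 <= t]) preimage_set_system setT (N_ theta t) measurable).

Let mtau n : measurable_fun setT (tau n). Proof. exact: measurable_tau. Qed.

Lemma bounded_measurable_tau_le n t : bounded_measurable (fun w => (tau n w <= t)%R%:R : R).
Proof. exact/bounded_measurable_bool/measurable_le_cst. Qed.

Lemma measurable_claim_weight t i : measurable_fun setT ((claim_weight t)^~ i).
Proof.
apply: measurable_funM; first by have [] := bounded_measurable_tau_le i.+1 t.
by apply: measurableT_comp => //; exact: measurable_funM.
Qed.

Lemma bounded_measurable_discounted_tail n x :
  bounded_measurable (fun w => Fb (x * expR (r * tau n w))).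
Proof.
apply: (@bounded_measurable_comp _ _ _ Fb (fun w => x * expR (r * tau n w))).
- exact: measurable_survival.
- by move=> y; rewrite survival_ge0 survival_le1.
- by apply: measurable_funM => //; apply: measurableT_comp => //; exact: measurable_funM.
Qed.

(** The probability that the claim [i] arrives by [t] and its discounted score
exceeds [x], written as a mean over the arrival time. *)
Definition exceedance_prob (i : nat) (x t : R) : R :=
  mean P (fun w => (tau i.+1 w <= t)%R%:R * Fb (x * expR (r * tau i.+1 w))).

Lemma bounded_measurable_exceedance i x t :
  bounded_measurable (fun w => (tau i.+1 w <= t)%R%:R * Fb (x * expR (r * tau i.+1 w))).
Proof.
apply: bounded_measurableM; [exact: bounded_measurable_tau_le|].
exact: bounded_measurable_discounted_tail.
Qed.

Lemma exceedance_prob_ge0 i x t : 0 <= exceedance_prob i x t.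
Proof. by apply: mean_ge0 => w; rewrite mulr_ge0 ?survival_ge0. Qed.

Let genN_measurable : <<s genN >> `<=` @measurable _ T.
Proof.
apply: smallest_sub; first exact: sigma_algebra_measurable.
move=> E [t /= t0 [B mB <-]].
exact: measurable_N.
Qed.

Lemma measurable_claim_weight_gen t i :
  measurable_fun setT ((claim_weight t)^~ i : g_sigma_algebraType genN -> R).
Proof.
have mt := measurable_tau_genN theta_ge0 i.+1.
apply: measurable_funM; last by apply: measurableT_comp => //; exact: measurable_funM.
have [] // := @bounded_measurable_bool R _ (g_sigma_algebraType genN) (fun w => tau i.+1 w <= t)%R _.
exact: measurable_le_cst.
Qed.

Lemma discounted_sum_decoupling m x t :
  bounded_measurable (fun w => survival P (S (iota 0 m) (claim_weight t w)) x) /\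
  prob P [set w | x < S (iota 0 m) (claim_weight t w) w] =
  mean P (fun w => survival P (S (iota 0 m) (claim_weight t w)) x).
Proof.
apply: (prob_decoupling genN_measurable (sigma_of_measurable mX (D:=setT))
  (independent_systemsC X_N_independent)
  (B := fun z => x < S (iota 0 m) (claim_weight t z.1) z.2)).
apply: measurable_gt; apply: measurable_sum => i; apply: measurable_funM.
  apply: (measurableT_comp (f := ((claim_weight t)^~ i : g_sigma_algebraType genN -> R))) => //.
  exact: measurable_claim_weight_gen.
apply: (measurableT_comp (f := (Y i : g_sigma_algebraType genX -> R))) => //.
exact: measurable_score_gen.
Qed.

Lemma some_big_claim_decoupling m x t :
  bounded_measurable (fun w => prob P [set w' | some_big_claim X f m (claim_weight t w) x w']) /\
  prob P [set w | some_big_claim X f m (claim_weight t w) x w] =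
  mean P (fun w => prob P [set w' | some_big_claim X f m (claim_weight t w) x w']).
Proof.
apply: (prob_decoupling genN_measurable (sigma_of_measurable mX (D:=setT))
  (independent_systemsC X_N_independent)
  (B := fun z => some_big_claim X f m (claim_weight t z.1) x z.2)).
pose TT := (g_sigma_algebraType genN * g_sigma_algebraType genX)%type.
elim: m => [|m IH].
  rewrite (_ : [set z | _] = (set0 : set TT)); first exact: measurable0.
  by apply/seteqP; split.
rewrite (_ : [set z | _] = [set z : TT | some_big_claim X f m (claim_weight t z.1) x z.2] `|`
   [set z : TT | x < claim_weight t z.1 m * Y m z.2]); last first.
  by apply/seteqP; split => w /=; rewrite some_big_claimS => /orP.
apply: measurableU; first exact: IH.
apply: measurable_gt; apply: measurable_funM.
  apply: (measurableT_comp (f := ((claim_weight t)^~ m : g_sigma_algebraType genN -> R))) => //.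
  exact: measurable_claim_weight_gen.
apply: (measurableT_comp (f := (Y m : g_sigma_algebraType genX -> R))) => //.
exact: measurable_score_gen.
Qed.

(** If the arrival [k.+1] occurs before [t <= T0], so does the first one and the
[k] gaps after it add up to at most [T0]; these gaps are independent of the first
arrival. *)
Lemma first_discount_bound k x t T0 : t <= T0 ->
  mean P (fun w => (tau k.+1 w <= t)%R%:R * Fb (x * expR (r * tau 1 w))) <=
  expR T0 * q ^+ k * exceedance_prob 0 x t.
Proof.
move=> tT; pose G y := (y <= t)%R%:R * Fb (x * expR (r * y)).
have mG : measurable_fun setT G.
  apply: measurable_funM.
    have [] // := @bounded_measurable_bool R _ R (fun y => y <= t)%R _.
    exact: measurable_le_cst.
  apply: measurableT_comp; first exact: measurable_survival.
  by apply: measurable_funM => //; apply: measurableT_comp => //; exact: measurable_funM.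
have G01 y : 0 <= G y <= 1.
  rewrite mulr_ge0 ?survival_ge0//= /G; case: (leP y t) => _; rewrite ?mul0r ?mul1r//.
  exact: survival_le1.
have k0 : 0%N \notin iota 1 k by rewrite mem_iota.
have tau1 w : tau 1 w = theta 0%N w by rewrite tauS tau0 add0r.
have tauk w : tau k.+1 w = theta 0%N w + theta_sum theta (iota 1 k) w.
  by rewrite tauE /theta_sum -[k.+1]add1n iotaD big_cat big_seq1.
have mS := measurable_theta_sum mtheta (iota 1 k).
have H := mean_gap_block mtheta theta_iid theta_ge0 T0 k0 mG G01.
apply: (@le_trans _ _ (mean P (fun w => G (theta 0%N w) * (theta_sum theta (iota 1 k) w <= T0)%R%:R))).
  apply: le_mean.
  - apply: bounded_measurableM; [exact: bounded_measurable_tau_le|].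
    exact: bounded_measurable_discounted_tail.
  - apply: bounded_measurableM; first exact: bounded_measurable_comp.
    exact/bounded_measurable_bool/measurable_le_cst.
  move=> w; have s0 : 0 <= theta_sum theta (iota 1 k) w by apply: sumr_ge0.
  have /andP[Gw _] := G01 (theta 0%N w).
  rewrite tau1 tauk; case: (leP (_ + _) t) => h; last by rewrite mul0r mulr_ge0.
  have h0 := theta_ge0 0%N w.
  have -> : theta_sum theta (iota 1 k) w <= T0 by lra.
  by rewrite /G (_ : theta 0%N w <= t) ?mulr1//; lra.
rewrite H mulrC.
have -> : mean P (fun w => G (theta 0%N w)) = exceedance_prob 0 x t.
  by apply: eq_mean => w; rewrite /G tau1.
rewrite ler_wpM2r ?exceedance_prob_ge0//.
by have := renewal_exponential_bound mtheta theta_iid theta_ge0 T0 (iota_uniq 1 k); rewrite size_iota.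
Qed.

Lemma exceedance_prob_geometric k x t T0 : 0 <= x -> t <= T0 ->
  exceedance_prob k x t <= expR T0 * q ^+ k * exceedance_prob 0 x t.
Proof.
move=> x0 tT; apply: le_trans (first_discount_bound k x tT).
apply: le_mean.
- exact: bounded_measurable_exceedance.
- apply: bounded_measurableM; [exact: bounded_measurable_tau_le|].
  exact: bounded_measurable_discounted_tail.
move=> w; rewrite ler_wpM2l//; apply: survival_mono => //.
by rewrite ler_wpM2l// ler_expR ler_wpM2l// tau_mono.
Qed.

End DiscountedClaims.

(** * Finite horizons *)

Lemma geometric_sum_le (R : realType) (q : R) n m : 0 <= q -> q < 1 ->
  \sum_(n <= i < m) q ^+ i <= q ^+ n / (1 - q).
Proof.
move=> q0 q1; have q10 : 0 < 1 - q by rewrite subr_gt0.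
rewrite ler_pdivlMr//; have [mn|/ltnW nm] := leqP m n.
  by rewrite big_geq// mul0r exprn_ge0.
apply: (@le_trans _ _ (q ^+ n - q ^+ m)); last by rewrite gerBl exprn_ge0.
rewrite -(subnKC nm); elim: (m - n)%N => [|k IH].
  by rewrite addn0 big_geq// mul0r subrr.
by rewrite addnS big_nat_recr ?leq_addr//= exprS; lra.
Qed.

Section Horizons.
Context {R : realType} {dT : measure_display} {T : measurableType dT}.
Variable P : probability T R.
Context {d' : measure_display} {V : measurableType d'}.
Variables (X : nat -> T -> V) (f : V -> R).
Hypotheses (mX : forall i, measurable_fun setT (X i)) (X_iid : iid P X).
Hypotheses (mf : measurable_fun setT f) (f_ge0 : forall v, 0 <= f v).
Variable theta : nat -> T -> R.
Hypotheses (mtheta : forall i, measurable_fun setT (theta i)) (theta_iid : iid P theta).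
Hypothesis theta_ge0 : forall k w, 0 <= theta k w.
Hypothesis theta_nondegenerate : P [set w | theta 0%N w = 0] <> 1%E.
Hypothesis X_N_independent : independent_systems P
     (sigma_of [set: nat] X) (sigma_of [set t : R | 0 <= t] (N_ theta)).
Variable r : R.
Hypothesis r_ge0 : 0 <= r.

Notation Y := (score X f).
Notation S := (weighted_sum X f).
Notation Fb := (survival P (Y 0%N)).
Notation tau := (tau theta).
Notation q := (laplace P theta).
Notation weight := (claim_weight theta r).
Notation exceedance_prob := (exceedance_prob P X f theta r).

Hypothesis FY : asymptotically_double P (Y 0%N).

Let mY i : measurable_fun setT (Y i). Proof. exact: measurable_score. Qed.
Let Fb_gt0 x : 0 < Fb x. Proof. exact: FY.1. Qed.
Let q_ge0 : 0 <= q. Proof. exact: laplace_ge0. Qed.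
Let q_lt1 : q < 1. Proof. exact: laplace_lt1. Qed.
Let exceedance_prob_ge0 i x t : 0 <= exceedance_prob i x t. Proof. exact: exceedance_prob_ge0. Qed.
Let bexceed i x t : bounded_measurable (fun w =>
  (tau i.+1 w <= t)%R%:R * Fb (x * expR (r * tau i.+1 w))).
Proof. exact: bounded_measurable_exceedance. Qed.

Definition expected_exceedances (x t : R) : \bar R :=
  (\sum_(0 <= i <oo) (exceedance_prob i x t)%:E)%E.

Notation Phi x t := (fine (expected_exceedances x t)).

Lemma exceedance_prob_tail_sum n m x t T0 : 0 <= x -> t <= T0 ->
  \sum_(n <= i < m) exceedance_prob i x t <= expR T0 * q ^+ n / (1 - q) * exceedance_prob 0 x t.
Proof.
move=> x0 tT; apply: le_trans (_ : \sum_(n <= i < m) (expR T0 * exceedance_prob 0 x t) * q ^+ i <= _).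
  apply: ler_sum => i _.
  by apply: le_trans (exceedance_prob_geometric mX mf mtheta theta_iid theta_ge0 r_ge0 i x0 tT) _; rewrite mulrAC.
have A0 : 0 <= expR T0 * exceedance_prob 0 x t by rewrite mulr_ge0// expR_ge0.
rewrite -mulr_sumr; apply: le_trans (ler_wpM2l A0 (geometric_sum_le n m q_ge0 q_lt1)) _.
by rewrite le_eqVlt; apply/orP; left; apply/eqP; ring.
Qed.

Lemma expected_exceedances_fin x t : 0 <= x -> expected_exceedances x t = (Phi x t)%:E.
Proof.
move=> x0; rewrite fineK// ge0_fin_numE; last by apply: nneseries_ge0 => i _ _; rewrite lee_fin.
apply: le_lt_trans (ltry (expR t * q ^+ 0 / (1 - q) * exceedance_prob 0 x t)).
apply: lime_le; first by apply: is_cvg_nneseries => i _ _; rewrite lee_fin.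
by apply: nearW => m; rewrite sumEFin lee_fin; exact: exceedance_prob_tail_sum.
Qed.

Lemma exceedance_partial_le n x t : 0 <= x -> \sum_(0 <= i < n) exceedance_prob i x t <= Phi x t.
Proof.
move=> x0; rewrite -lee_fin -expected_exceedances_fin// -sumEFin.
by apply: nneseries_lim_ge => i _; rewrite lee_fin.
Qed.

Lemma expected_exceedances_le x t B : 0 <= x ->
  (forall n, \sum_(0 <= i < n) exceedance_prob i x t <= B) -> Phi x t <= B.
Proof.
move=> x0 H; rewrite -lee_fin -expected_exceedances_fin//.
apply: lime_le; first by apply: is_cvg_nneseries => i _ _; rewrite lee_fin.
by apply: nearW => m; rewrite sumEFin lee_fin.
Qed.

Lemma first_exceedance_le x t : 0 <= x -> exceedance_prob 0 x t <= Phi x t.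
Proof. by move=> /(exceedance_partial_le 1 t); rewrite big_nat1. Qed.

Lemma expected_exceedances_ge0 x t : 0 <= Phi x t.
Proof. by rewrite fine_ge0// nneseries_ge0// => i _ _; rewrite lee_fin. Qed.

(** Freeze the arrival times, apply [upper_bounded_weights] with a growth factor
[k > 1] such that [k q < 1], where [q] is the Laplace transform of the gaps, and
average.  By [first_discount_bound], the term of index [i] of the second sum is of
order [(k q)^i] times the contribution of the first claim, so its tail from a
large [n] on is negligible. *)
Lemma upper_finite_horizon T0 d : 0 < d -> exists2 x1 : R, 0 <= x1 &
  forall x t m, x1 <= x -> t <= T0 ->
  prob P [set w | x < S (iota 0 m) (weight t w) w] <= (1 + d) * Phi x t.
Proof.
move=> d0; have d20 : 0 < d / 2 by rewrite divr_gt0.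
have [k k1 kq] : exists2 k, 1 < k & k * q < 1.
  have q1 : 0 < 1 + q by rewrite ltr_wpDr.
  exists (2 / (1 + q)); first by rewrite ltr_pdivlMr// mul1r; have := q_lt1; lra.
  by rewrite mulrAC ltr_pdivrMr// mul1r; have := q_lt1; lra.
have k0 : 0 < k by rewrite (lt_trans ltr01).
have kq0 : 0 <= k * q by rewrite mulr_ge0// ltW.
have [K K0 HK] := upper_bounded_weights mX X_iid mf f_ge0 FY k1.
pose C := K * k * expR T0 / (1 - k * q).
have C0 : 0 <= C.
  apply: divr_ge0; last by rewrite subr_ge0 ltW.
  exact: mulr_ge0 (mulr_ge0 K0 (ltW k0)) (expR_ge0 _).
have e0 : 0 < d / 2 / (C + 1) by rewrite divr_gt0// ltr_wpDl.
have [n Hn] := small_geometric kq0 kq e0.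
have a0 : 0 < expR (- (r * T0)) by exact: expR_gt0.
have [x1 x10 H1] := HK _ _ n a0 d20.
exists x1 => // x t m xx1 tT; have x0 : 0 <= x by exact: le_trans xx1.
have [bS ->] := discounted_sum_decoupling mX mf mtheta theta_ge0 X_N_independent r m x t.
pose tailk i w : R := (tau i.+1 w <= t)%R%:R * Fb (x * expR (r * tau 1 w)).
have btail i : bounded_measurable (tailk i).
  apply: bounded_measurableM; [exact: bounded_measurable_tau_le|].
  exact: bounded_measurable_discounted_tail.
pose bound w := (1 + d / 2) * \sum_(0 <= i < n) ((tau i.+1 w <= t)%R%:R * Fb (x * expR (r * tau i.+1 w)))
  + \sum_(n <= i < m) (K * k ^+ i.+1) * tailk i w.
have b1 : bounded_measurable (fun w => \sum_(0 <= i < n) ((tau i.+1 w <= t)%R%:R * Fb (x * expR (r * tau i.+1 w)))).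
  by apply: bounded_measurable_sum => i; exact: bexceed.
have b2 i : bounded_measurable (fun w => K * k ^+ i.+1 * tailk i w).
  exact: bounded_measurableM.
have b3 : bounded_measurable (fun w => \sum_(n <= i < m) K * k ^+ i.+1 * tailk i w).
  exact: bounded_measurable_sum.
have b4 : bounded_measurable (fun w => (1 + d / 2) * \sum_(0 <= i < n) ((tau i.+1 w <= t)%R%:R * Fb (x * expR (r * tau i.+1 w)))).
  exact: bounded_measurableM.
apply: (@le_trans _ _ (mean P bound)).
  apply: le_mean => //; first exact: bounded_measurableD.
  move=> w; apply: le_trans (H1 (weight t w) m x _ _ _ xx1) _.
  - by move=> i; exact: claim_weight_ge0.
  - move=> i; rewrite /claim_weight; case: (leP (tau i.+1 w) t) => h; last by left; rewrite mul0r.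
    right; rewrite mul1r; split; first by rewrite ler_expR mulNr lerN2 ler_wpM2l// (le_trans h).
    by rewrite -expR0 ler_expR mulNr oppr_le0 mulr_ge0// tau_ge0.
  - by move=> i j; exact: claim_weight_mono.
  rewrite /bound lerD//.
    rewrite -(big_mkord predT (fun i => scaled_tail P X f (weight t w i) x)).
    rewrite ler_wpM2l ?addr_ge0 ?(ltW d20)//.
    by apply: ler_sum => i _; rewrite scaled_tail_claim_weight.
  apply: ler_sum => i _; rewrite -mulrA ler_wpM2l ?mulr_ge0 ?exprn_ge0 ?(ltW k0)//.
  rewrite claim_weight_gt0 scaled_tail_claim_weight// /tailk.
  case: (leP (tau i.+1 w) t) => h; last by rewrite !mul0r.
  by rewrite !mul1r (le_trans (tau_mono theta_ge0 w (_ : (1 <= i.+1)%N)) h)// mul1r.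
rewrite /bound meanD// meanZ// mean_sum// mean_sum//.
have S1 : \sum_(0 <= i < n) exceedance_prob i x t <= Phi x t by exact: exceedance_partial_le.
apply: (@le_trans _ _ ((1 + d / 2) * Phi x t + d / 2 * Phi x t)); last by lra.
rewrite lerD//; first by rewrite ler_wpM2l// addr_ge0// ltW.
apply: (@le_trans _ _ (\sum_(n <= i < m) (K * k * expR T0 * exceedance_prob 0 x t) * (k * q) ^+ i)).
  apply: ler_sum => i _; rewrite meanZ//.
  have H := first_discount_bound mX mf mtheta theta_iid theta_ge0 r i x tT.
  apply: le_trans (ler_wpM2l _ H) _; first by rewrite mulr_ge0// exprn_ge0// ltW.
  by rewrite exprS exprMn le_eqVlt; apply/orP; left; apply/eqP; ring.
rewrite -mulr_sumr.
have A0 : 0 <= K * k * expR T0 * exceedance_prob 0 x t.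
  exact: mulr_ge0 (mulr_ge0 (mulr_ge0 K0 (ltW k0)) (expR_ge0 _)) (exceedance_prob_ge0 _ _ _).
apply: le_trans (ler_wpM2l A0 (geometric_sum_le n m kq0 kq)) _.
apply: le_trans (_ : C * (k * q) ^+ n * exceedance_prob 0 x t <= _).
  by rewrite /C le_eqVlt; apply/orP; left; apply/eqP; ring.
apply: ler_pM => //; first by rewrite mulr_ge0// exprn_ge0.
  apply: le_trans (ler_wpM2l C0 Hn) _.
  by rewrite mulrA ler_pdivrMr ?ltr_wpDl// mulrC ler_wpM2l ?(ltW d20)// lerDl.
exact: first_exceedance_le.
Qed.

(** Only the first [n] claims are used: by [exceedance_prob_tail_sum] they carry
almost all of the expected number of exceedances, and for a fixed [n] the loss
[n Fbar(x + c)] in [some_big_claim_bounds] is small.  The shift of the level is at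
most [c exp(r T0)] after discounting, which the long tail absorbs. *)
Lemma lower_finite_horizon T0 c d : 0 <= c -> 0 < d -> d < 1 -> exists n, exists2 x1 : R, 0 <= x1 &
  forall x t, x1 <= x -> t <= T0 ->
  (1 - d) * Phi x t <= prob P [set w | some_big_claim X f n (weight t w) (x + c) w].
Proof.
move=> c0 d0 d1; pose e := d / 3.
have e0 : 0 < e by rewrite divr_gt0.
have q10 : 0 < 1 - q by rewrite subr_gt0.
have eT0 : 0 < expR T0 / (1 - q) by rewrite divr_gt0 ?expR_gt0.
have [n Hn] := small_geometric q_ge0 q_lt1 (divr_gt0 e0 eT0).
exists n.
have Y0 := score_ge0 X f_ge0 0%N.
have ceT : 0 <= c * expR (r * T0) by rewrite mulr_ge0 ?expR_ge0.
have [M1 [_ HM1]] := long_tailed (mY 0%N) Y0 FY ceT e0.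
have en0 : 0 < e / n.+1%:R by rewrite divr_gt0.
have /cvgrPdist_le /(_ _ en0) [M2 [_ HM2]] := cvg_survival P (mY 0%N).
pose x1 := Num.max (Num.max M1 M2) 0 + 1.
exists x1; first by rewrite /x1 addr_ge0// le_max lexx orbT.
move=> x t xx1 tT.
have [M1x [M2x x0]] : M1 < x /\ M2 < x /\ 0 <= x.
  have : Num.max (Num.max M1 M2) 0 < x by apply: lt_le_trans xx1; rewrite ltrDl.
  by rewrite !gt_max => /andP[/andP[-> ->] /ltW ->].
have xc0 : 0 <= x + c by exact: addr_ge0.
have nF : n%:R * Fb (x + c) <= e.
  have := HM2 (x + c) (lt_le_trans M2x _); rewrite lerDl => /(_ c0).
  rewrite sub0r normrN ger0_norm ?survival_ge0// => F1.
  apply: le_trans (ler_wpM2l (ler0n _ n) F1) _.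
  by rewrite mulrA ler_pdivrMr// mulrC ler_wpM2l ?(ltW e0)// ler_nat.
have ei1 : e < 3^-1 by rewrite /e; lra.
have e1 : e < 1 by lra.
have [bB ->] := some_big_claim_decoupling mX mf mtheta theta_ge0 X_N_independent r n (x + c) t.
have b1 i : bounded_measurable (fun w => (tau i.+1 w <= t)%R%:R * Fb (x * expR (r * tau i.+1 w))) by exact: bexceed.
pose bound w := (1 - e) / (1 + e) * \sum_(0 <= i < n) ((tau i.+1 w <= t)%R%:R * Fb (x * expR (r * tau i.+1 w))).
have b2 : bounded_measurable (fun w => \sum_(0 <= i < n) ((tau i.+1 w <= t)%R%:R * Fb (x * expR (r * tau i.+1 w)))).
  exact: bounded_measurable_sum.
have ep : 0 < 1 + e by rewrite addr_gt0.
apply: (@le_trans _ _ (mean P bound)); last first.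
  apply: le_mean => //; first exact: bounded_measurableM.
  move=> w.
  have nF1 : n%:R * Fb (x + c) <= 1 by lra.
  have w01 i : 0 <= weight t w i <= 1 by rewrite claim_weight_ge0 claim_weight_le1.
  have /andP[+ _] := some_big_claim_bounds mX X_iid mf f_ge0 xc0 w01 nF1.
  apply: le_trans.
  rewrite -(big_mkord predT (fun i => scaled_tail P X f (weight t w i) (x + c))).
  rewrite /bound -mulrA; apply: ler_pM.
  - by rewrite subr_ge0 ltW.
  - rewrite mulr_ge0 ?invr_ge0 ?(ltW ep)//; apply: sumr_ge0 => i _.
    by rewrite mulr_ge0 ?survival_ge0.
  - by rewrite lerD2l lerN2.
  rewrite mulrC ler_pdivrMr// mulr_suml; apply: ler_sum => i _.
  rewrite scaled_tail_claim_weight//.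
  case: (leP (tau i.+1 w) t) => h; last by rewrite !mul0r.
  rewrite !mul1r.
  have E1 : 1 <= expR (r * tau i.+1 w) by rewrite -expR0 ler_expR mulr_ge0// tau_ge0.
  have ET : expR (r * tau i.+1 w) <= expR (r * T0) by rewrite ler_expR ler_wpM2l// (le_trans h).
  apply: (@le_trans _ _ ((1 + e) * Fb (x * expR (r * tau i.+1 w) + c * expR (r * T0)))).
    have H := HM1 (x * expR (r * tau i.+1 w) + c * expR (r * T0)).
    rewrite addrK in H; apply: H; apply: lt_le_trans M1x _.
    by apply: (@le_trans _ _ (x * expR (r * tau i.+1 w))); rewrite ?lerDl// ler_peMr.
  rewrite mulrC ler_wpM2r ?(ltW ep)//; apply: survival_mono => //.
  by rewrite mulrDl lerD2l ler_wpM2l.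
rewrite /bound meanZ// mean_sum//.
set s := \sum_(0 <= i < n) _.
have sE : s = \sum_(0 <= i < n) exceedance_prob i x t by [].
have PhiS : Phi x t <= s + e * Phi x t.
  apply: expected_exceedances_le => // m.
  have [mn|nm] := leqP m n.
    apply: (@le_trans _ _ s); last by rewrite lerDl mulr_ge0 ?expected_exceedances_ge0// ltW.
    by rewrite sE [leRHS](big_cat_nat (n:=m))//= lerDl sumr_ge0.
  rewrite (big_cat_nat (n:=n))//=; last exact: ltnW.
  rewrite -sE lerD2l.
  apply: le_trans (exceedance_prob_tail_sum n m x0 tT) _.
  apply: ler_pM => //; last exact: first_exceedance_le.
    by rewrite divr_ge0 ?mulr_ge0 ?expR_ge0 ?exprn_ge0// ltW.
  move: Hn; rewrite ler_pdivlMr//; apply: le_trans.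
  by rewrite le_eqVlt; apply/orP; left; apply/eqP; ring.
have Ph0 := expected_exceedances_ge0 x t.
have s0 : 0 <= s by rewrite sE sumr_ge0.
apply: (@le_trans _ _ ((1 - e) / (1 + e) * ((1 - e) * Phi x t))); last first.
  by rewrite ler_wpM2l ?divr_ge0 ?subr_ge0 ?(ltW ep) ?(ltW e1)//; lra.
rewrite mulrA ler_wpM2r// mulrAC ler_pdivlMr//.
have -> : d = 3 * e by rewrite /e; lra.
nra.
Qed.

End Horizons.

(** * Infinite horizon *)

Lemma le_mean_ae (R : realType) dT (T : measurableType dT) (P : probability T R)
    (f g : T -> R) (B : set T) : bounded_measurable f -> bounded_measurable g ->
  measurable B -> P B = 0%E -> (forall w, ~ B w -> f w <= g w) -> mean P f <= mean P g.
Proof.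
move=> bf bg mB PB fg.
have [_ [M fM]] := bf; have [_ [N gN]] := bg.
pose b w := `[< B w >].
have bE : [set w | b w] = B by apply/seteqP; split => w /= /asboolP.
have mb : bounded_measurable (fun w => (b w)%:R : R) by apply: bounded_measurable_bool; rewrite bE.
apply: (@le_trans _ _ (mean P (fun w => g w + (M + N) * (b w)%:R))).
  apply: le_mean => //; first by apply: bounded_measurableD => //; exact: bounded_measurableM.
  move=> w; rewrite /b; case: asboolP => [_|/fg]; last by rewrite mulr0 addr0.
  by rewrite mulr1; have := fM w; have := gN w; rewrite !ler_norml => /andP[? ?] /andP[? ?]; lra.
rewrite meanD//; last exact: bounded_measurableM.
by rewrite meanZ// mean_bool ?bE// /prob PB mulr0 addr0.
Qed.

Section InfiniteHorizon.
Context {R : realType} {dT : measure_display} {T : measurableType dT}.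
Variable P : probability T R.
Context {d' : measure_display} {V : measurableType d'}.
Variables (X : nat -> T -> V) (f : V -> R).
Hypotheses (mX : forall i, measurable_fun setT (X i)) (X_iid : iid P X).
Hypotheses (mf : measurable_fun setT f) (f_ge0 : forall v, 0 <= f v).
Variable theta : nat -> T -> R.
Hypotheses (mtheta : forall i, measurable_fun setT (theta i)) (theta_iid : iid P theta).
Hypothesis theta_ge0 : forall k w, 0 <= theta k w.
Hypothesis theta_nondegenerate : P [set w | theta 0%N w = 0] <> 1%E.
Hypothesis X_N_independent : independent_systems P
     (sigma_of [set: nat] X) (sigma_of [set t : R | 0 <= t] (N_ theta)).
Variable r : R.
Hypothesis r_gt0 : 0 < r.
Let r_ge0 : 0 <= r := ltW r_gt0.

Notation Y := (score X f).
Notation S := (weighted_sum X f).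
Notation Fb := (survival P (Y 0%N)).
Notation tau := (tau theta).
Notation weight := (claim_weight theta r).
Notation exceedance_prob := (exceedance_prob P X f theta r).
Notation Phi x t := (fine (expected_exceedances P X f theta r x t)).

Hypothesis FY : asymptotically_double P (Y 0%N).

Variables (v0 q x0 : R).
Hypotheses (v0_gt1 : 1 < v0) (q_lt1 : q < 1).
Hypothesis decr : forall x, x0 <= x -> Fb (v0 * x) <= q * Fb x.

Variable eps : R.
Hypotheses (eps_gt0 : 0 < eps) (gaps : P [set w | eps < theta 0%N w] = 1%E).

Let mY i : measurable_fun setT (Y i). Proof. exact: measurable_score. Qed.
Let Fb_gt0 x : 0 < Fb x. Proof. exact: FY.1. Qed.
Let exceedance_prob_ge0 i x t : 0 <= exceedance_prob i x t. Proof. exact: exceedance_prob_ge0. Qed.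
Let bexceed i x t : bounded_measurable (fun w =>
  (tau i.+1 w <= t)%R%:R * Fb (x * expR (r * tau i.+1 w))).
Proof. exact: bounded_measurable_exceedance. Qed.

Definition short_gap : set T := \bigcup_i [set w | theta i w <= eps].

Lemma measurable_short_gap : measurable short_gap.
Proof. by apply: bigcupT_measurable => i; exact: measurable_le_cst. Qed.

Lemma short_gap_negligible : P short_gap = 0%E.
Proof.
have mle i : measurable [set w | theta i w <= eps] by exact: measurable_le_cst.
have P0 i : P [set w | theta i w <= eps] = 0%E.
  have -> : P [set w | theta i w <= eps] = P [set w | theta 0%N w <= eps].
    have := theta_iid.2 i `]-oo, eps]%classic (measurable_itv _).
    by congr (P _ = P _); apply/seteqP; split => w /=; rewrite in_itv.
  have -> : [set w | theta 0%N w <= eps] = ~` [set w | eps < theta 0%N w].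
    by apply/seteqP; split => w /=; rewrite leNgt => /negP.
  by rewrite probability_setC ?gaps ?subee//; exact: measurable_gt.
apply/eqP; rewrite eq_le measure_ge0 andbT.
apply: le_trans (@measure_sigma_subadditive _ _ _ P _ (fun i => [set w | theta i w <= eps]) _ _ _) _ => //.
- exact: measurable_short_gap.
- by rewrite eseries0// => i _ _; exact: P0.
Qed.

Notation rho := (expR (- (r * eps))).

Lemma rho_gt0 : 0 < rho. Proof. exact: expR_gt0. Qed.
Lemma rho_lt1 : rho < 1.
Proof. by rewrite -expR0 ltr_expR oppr_lt0 mulr_gt0. Qed.

Lemma tau_gap w i k : ~ short_gap w -> tau i w + k%:R * eps <= tau (i + k)%N w.
Proof.
move=> wB; elim: k => [|k IH]; first by rewrite mul0r addr0 addn0.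
rewrite addnS tauS -natr1 mulrDl mul1r addrA lerD// ltW// ltNge; apply/negP => h.
by apply: wB; exists (i + k)%N.
Qed.

(** Almost surely consecutive weights decrease by the factor [exp(- r eps)], whatever
[t] is, so [upper_discounted_weights] applies for all [t] at once. *)
Lemma upper_infinite_horizon d : 0 < d -> exists2 x1 : R, 0 <= x1 &
  forall x t m, x1 <= x ->
  prob P [set w | x < S (iota 0 m) (weight t w) w] <= (1 + d) * Phi x t.
Proof.
move=> d0.
have [x1 x10 H] := upper_discounted_weights mX X_iid mf f_ge0 FY v0_gt1 q_lt1 decr rho_gt0 rho_lt1 d0.
exists x1 => // x t m xx1; have xge0 : 0 <= x by exact: le_trans xx1.
have [bS ->] := discounted_sum_decoupling mX mf mtheta theta_ge0 X_N_independent r m x t.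
pose s w := \sum_(0 <= i < m) ((tau i.+1 w <= t)%R%:R * Fb (x * expR (r * tau i.+1 w))).
have bs : bounded_measurable s by apply: bounded_measurable_sum => i; exact: bexceed.
apply: (@le_trans _ _ (mean P (fun w => (1 + d) * s w))).
  apply: (le_mean_ae _ _ measurable_short_gap short_gap_negligible) => //.
    exact: bounded_measurableM.
  move=> w wB; apply: le_trans (H (weight t w) m x _ _ _ xx1) _.
  - by move=> i; exact: claim_weight_ge0.
  - exact: claim_weight_le1.
  - move=> i; rewrite /claim_weight.
    case: (leP (tau i.+2 w) t) => h; last by rewrite mul0r mulr_ge0 ?expR_ge0// mulr_ge0 ?expR_ge0.
    rewrite (le_trans (tau_mono theta_ge0 w (leqnSn i.+1)) h) !mul1r -expRD ler_expR.
    have := tau_gap i.+1 1 wB; rewrite addn1 mul1r => g.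
    by have := ler_wpM2l r_ge0 g; lra.
  rewrite -(big_mkord predT (fun i => scaled_tail P X f (weight t w i) x)) /s.
  rewrite ler_wpM2l ?addr_ge0 ?(ltW d0)//.
  by apply: ler_sum => i _; rewrite scaled_tail_claim_weight.
rewrite meanZ// /s mean_sum// ler_wpM2l ?addr_ge0 ?(ltW d0)//.
exact: exceedance_partial_le.
Qed.

(** Late terms with index at least [n] are a small fraction of the first one, since
the arrival [i.+1] comes at least [i eps] after the first.  Each of the first [n]
terms grows after [S1] by at most [Fbar(x exp(r S1))], and positive decrease makes
this small compared with the contribution of a first arrival before some
fixed time [s0]. *)
Lemma long_horizon_negligible d S0 : 0 < d -> exists2 S1 : R, S0 <= S1 & exists2 x1 : R, 0 <= x1 &
  forall x t, x1 <= x -> S1 <= t -> Phi x t <= (1 + d) * Phi x S1.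
Proof.
move=> d0.
have [K K0 [x1 x10 HK]] := discounted_tail_sum mX mf FY v0_gt1 q_lt1 decr rho_gt0 rho_lt1.
have d20 : 0 < d / 4 / (K + 1) by rewrite !divr_gt0// ltr_wpDl.
have [n [x2 x20 Hn]] := survival_decay_pow mX mf v0_gt1 q_lt1 decr rho_gt0 rho_lt1 d20.
have [s0 s00 ps0] : exists2 s0, 0 <= s0 & 0 < prob P [set w | tau 1 w <= s0].
  have /cvgrPdist_le /(_ (1/2)) [|M [_ HM]] := cvg_survival P (measurable_tau mtheta 1); first by rewrite divr_gt0.
  have := HM (Num.max M 0 + 1).
  have -> : M < Num.max M 0 + 1.
    by apply: (@le_lt_trans _ _ (Num.max M 0)); rewrite ?ltrDl// le_max lexx.
  move=> /(_ isT); set s := _ + 1; rewrite sub0r normrN ger0_norm ?survival_ge0// => sM.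
  exists s; first by rewrite addr_ge0// le_max lexx orbT.
  rewrite (_ : [set w | _] = [set w | ~~ (s < tau 1 w)]); last first.
    by apply/seteqP; split => w /=; rewrite leNgt.
  rewrite prob_neg; last by apply: measurable_gt; exact: measurable_tau.
  by rewrite subr_gt0; apply: le_lt_trans sM _; lra.
set p0 := prob _ _ in ps0.
(* n terms, each of relative size e, must add up to at most d / 2 *)
pose e := Num.min 1 (d / 2 / n.+1%:R).
have e0 : 0 < e by rewrite lt_min ltr01 !divr_gt0.
have e1 : e <= 1 by rewrite ge_min lexx.
have en : n%:R * e <= d / 2.
  apply: (@le_trans _ _ (n.+1%:R * (d / 2 / n.+1%:R))).
    by rewrite ler_pM ?ler_nat// ?ge_min ?lexx ?orbT// ltW.
  by rewrite mulrC divfK// pnatr_eq0.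
have ep0 : 0 < e * p0 by rewrite mulr_gt0.
have [M [x3 [M1 x30 H3]]] := survival_decay mX mf v0_gt1 q_lt1 decr ep0.
have M0 : 0 < M by rewrite (lt_le_trans ltr01).
pose S1 := Num.max S0 (s0 + ln M / r).
have S01 : s0 + ln M / r <= S1 by rewrite le_max lexx orbT.
exists S1; first by rewrite le_max lexx.
exists (Num.max (Num.max x1 x2) x3); first by rewrite !le_max x10.
move=> x t; rewrite 2!ge_max => /andP[/andP[x1x x2x] x3x] S1t.
have xge0 : 0 <= x by exact: le_trans x1x.
have lnM0 : 0 <= ln M by rewrite ln_ge0.
have s0S1 : s0 <= S1.
  by apply: le_trans S01; rewrite lerDl divr_ge0// ltW.
have xle y : 0 <= y -> x <= x * expR (r * y).
  by move=> y0; rewrite ler_peMr// -expR0 ler_expR mulr_ge0.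
have Ph0 := expected_exceedances_ge0 P X f theta r.
(* what can arrive after S1 is compared with a first arrival before s0 *)
have F1 : Fb (x * expR (r * S1)) <= e * exceedance_prob 0 x S1.
  have H := H3 (expR (r * (S1 - s0))) (x * expR (r * s0)) _ (le_trans x3x (xle _ s00)).
  have -> : x * expR (r * S1) = expR (r * (S1 - s0)) * (x * expR (r * s0)).
    by rewrite mulrCA -expRD; congr (_ * expR _); ring.
  apply: le_trans (H _) _.
    rewrite -[leLHS]lnK ?posrE// ler_expR mulrC -ler_pdivrMr//; lra.
  rewrite -mulrA ler_wpM2l ?(ltW e0)//.
  rewrite /p0 -mean_bool; last by apply: measurable_le_cst; exact: measurable_tau.
  rewrite mulrC -meanZ; last by apply: bounded_measurable_tau_le.
  apply: le_mean.
  - by apply: bounded_measurableM => //; exact: bounded_measurable_tau_le.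
  - exact: bexceed.
  move=> w; case: (leP (tau 1 w) s0) => h; last by rewrite mulr0 mulr_ge0 ?survival_ge0.
  rewrite (le_trans h s0S1) mul1r mulr1; apply: survival_mono => //.
  by rewrite ler_wpM2l// ler_expR ler_wpM2l.
have term i : exceedance_prob i x t <= exceedance_prob i x S1 + e * exceedance_prob 0 x S1.
  apply: (@le_trans _ _ (exceedance_prob i x S1 + Fb (x * expR (r * S1)))); last by rewrite lerD2l.
  rewrite -[X in _ + X](mean_cst P) -meanD//.
  apply: le_mean; [exact: bexceed|exact: bounded_measurableD|].
  move=> w; have F0 := survival_ge0 P (Y 0%N).
  case: (leP (tau i.+1 w) S1) => h.
    by rewrite (le_trans h S1t) lerDl.
  rewrite mul0r add0r; case: (leP (tau i.+1 w) t) => _; last by rewrite mul0r.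
  by rewrite mul1r survival_mono// ler_wpM2l// ler_expR ler_wpM2l// ltW.
have far m : \sum_(n <= i < m) exceedance_prob i x t <= d / 4 * exceedance_prob 0 x t.
  rewrite -mean_sum//.
  apply: (@le_trans _ _ (mean P (fun w => d / 4 * ((tau 1 w <= t)%R%:R * Fb (x * expR (r * tau 1 w)))))); last first.
    by rewrite meanZ//; exact: bexceed.
  apply: (le_mean_ae _ _ measurable_short_gap short_gap_negligible).
  - by apply: bounded_measurable_sum => i; exact: bexceed.
  - by apply: bounded_measurableM => //; exact: bexceed.
  move=> w wB; have [h|h] := leP (tau 1 w) t; last first.
    rewrite mul0r mulr0 big1// => i _.
    by rewrite leNgt (lt_le_trans h (tau_mono theta_ge0 w (_ : (1 <= i.+1)%N)))// mul0r.
  set y := x * expR (r * tau 1 w).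
  have xy : x <= y by apply: xle; exact: tau_ge0.
  rewrite mul1r.
  apply: (@le_trans _ _ (\sum_(n <= i < m) Fb (y / rho ^+ i))).
    apply: ler_sum => i _.
    apply: (@le_trans _ _ (1 * Fb (x * expR (r * tau i.+1 w)))).
      by rewrite ler_wpM2r ?survival_ge0//; case: (leP (tau i.+1 w) t).
    rewrite mul1r; apply: survival_mono => //.
    rewrite /y -expRM_natl -expRN -mulrA -expRD ler_wpM2l// ler_expR.
    have := tau_gap 1 i wB; rewrite add1n => g.
    by have := ler_wpM2l r_ge0 g; lra.
  have [mn|/ltnW nm] := leqP m n.
    by rewrite big_geq// mulr_ge0 ?survival_ge0// divr_ge0// ltW.
  have -> : \sum_(n <= i < m) Fb (y / rho ^+ i) = \sum_(0 <= i < m - n) Fb (y / rho ^+ n / rho ^+ i).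
    rewrite -{1}[n]add0n big_addn; apply: eq_bigr => i _.
    by rewrite exprD invfM mulrA mulrAC.
  have yn : y <= y / rho ^+ n.
    apply: le_div_weight; first exact: le_trans xy.
      by rewrite exprn_gt0// rho_gt0.
    by rewrite exprn_ile1 ?expR_ge0// ltW// rho_lt1.
  apply: le_trans (HK _ _ (le_trans x1x (le_trans xy yn))) _.
  apply: le_trans (ler_wpM2l K0 (Hn y (le_trans x2x xy))) _.
  rewrite mulrA ler_wpM2r ?survival_ge0// mulrA ler_pdivrMr ?ltr_wpDl//.
  by rewrite mulrC ler_wpM2l ?divr_ge0 ?(ltW d0)// lerDl.
apply: expected_exceedances_le => // m.
apply: (@le_trans _ _ (\sum_(0 <= i < n) exceedance_prob i x t + d / 4 * exceedance_prob 0 x t)).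
  have [mn|nm] := leqP m n.
    apply: (@le_trans _ _ (\sum_(0 <= i < n) exceedance_prob i x t)).
      by rewrite [leRHS](big_cat_nat (n:=m))//= lerDl sumr_ge0.
    by rewrite lerDl mulr_ge0// divr_ge0// ltW.
  by rewrite (big_cat_nat (n:=n))//= ?lerD2l//; exact: ltnW.
have A : \sum_(0 <= i < n) exceedance_prob i x t <= Phi x S1 + d / 2 * exceedance_prob 0 x S1.
  apply: (@le_trans _ _ (\sum_(0 <= i < n) (exceedance_prob i x S1 + e * exceedance_prob 0 x S1))).
    exact: ler_sum.
  rewrite big_split/= lerD//; first exact: exceedance_partial_le.
  rewrite (_ : \sum_(0 <= i < n) _ = n%:R * e * exceedance_prob 0 x S1) ?ler_wpM2r//.
  by rewrite sumr_const_nat subn0 -mulrA mulr_natl.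
have B := term 0%N.
have C := first_exceedance_le mX mf mtheta theta_iid theta_ge0 theta_nondegenerate r_ge0 S1 xge0.
have D := exceedance_prob_ge0 0 x S1.
have : e * exceedance_prob 0 x S1 <= 1 * exceedance_prob 0 x S1 by rewrite ler_wpM2r.
have : d / 4 * exceedance_prob 0 x t <= d / 4 * (exceedance_prob 0 x S1 + e * exceedance_prob 0 x S1).
  by rewrite ler_wpM2l// divr_ge0// ltW.
have E2 : d * exceedance_prob 0 x S1 <= d * Phi x S1 by rewrite ler_wpM2l// ltW.
nra.
Qed.

End InfiniteHorizon.

(** * The gauge of a ruin set *)

Section BorelVectors.
Context {R : realType} {d : nat}.

(** An open set of [R^d] is a countable union of boxes with rational centres. *)
Lemma measurable_open_preimage dT (T : measurableType dT) (g : T -> 'rV[R]_d) (U : set 'rV[R]_d) :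
  open U -> (forall j, measurable_fun setT (fun w => g w 0 j)) -> measurable [set w | U (g w)].
Proof.
move=> oU mg.
pose B (qk : 'rV[rat]_d * nat) : set 'rV[R]_d :=
  [set y | forall j, `|ratr (qk.1 0 j) - y 0 j| < qk.2.+1%:R^-1].
pose F qk : set T := if `[< B qk `<=` U >] then [set w | B qk (g w)] else set0.
have -> : [set w | U (g w)] = \bigcup_qk F qk.
  apply/seteqP; split => w /=; last first.
    by move=> [qk _]; rewrite /F; case: asboolP => // BU; exact: BU.
  move=> Ug; have /nbhs_ballP[e /= e0 He] : nbhs (g w) U by exact: open_nbhs_nbhs.
  have [k ke] : exists k, 2 * k.+1%:R^-1 <= e.
    exists (Num.truncn (2 / e)); rewrite ler_pdivrMr// mulrC -ler_pdivrMr//.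
    by rewrite ltW// truncnS_gt.
  have k0 : 0 < k.+1%:R^-1 :> R by rewrite invr_gt0.
  have /choice[q Hq] : forall j, exists q : rat, `|ratr q - g w 0 j| < k.+1%:R^-1.
    move=> j; have /rat_in_itvoo[q] : g w 0 j - k.+1%:R^-1 < g w 0 j + k.+1%:R^-1.
      by rewrite ltrD2l gtrN.
    by rewrite in_itv/= => /andP[h1 h2]; exists q; rewrite ltr_norml ltrBrDr ltrBlDr addrC h1 addrC.
  have Bw : B (\row_j q j, k) (g w) by move=> j /=; rewrite mxE.
  exists (\row_j q j, k) => //; rewrite /F; case: asboolP => //; case.
  move=> z Bz; apply: He; split => // i j; rewrite (ord1 i) /ball/=.
  have := Bz j; have := Bw j; rewrite /= mxE => h1 h2.
  rewrite (lt_le_trans _ ke)//.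
  rewrite (_ : _ - _ = - (ratr (q j) - g w 0 j) + (ratr (q j) - z 0 j)); last by ring.
  by rewrite (le_lt_trans (ler_normD _ _))// normrN mulr_natl mulr2n ltrD.
apply: countable_bigcupT_measurable; first exact: countableP.
move=> qk; rewrite /F; case: asboolP => // _.
rewrite (_ : [set w | _] = \bigcap_(j in setT) [set w | `|ratr (qk.1 0 j) - g w 0 j| < qk.2.+1%:R^-1]).
  apply: fin_bigcap_measurable => [|j _]; first exact: finite_finset.
  rewrite -[X in measurable X]setTI; apply: measurable_fun_ltr => //.
  by apply: measurableT_comp => //; exact: measurable_funB.
by apply/seteqP; split => [w H j _|w H j]; [exact: H|exact: (H j I)].
Qed.

Lemma measurable_coord j : measurable_fun [set: borel_rV R d] (fun y : borel_rV R d => (y : 'rV[R]_d) 0 j).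
Proof.
apply: (measurability (@RGenOpens.G R)); first exact: RGenOpens.measurableE.
move=> _ [_ [a [b ->]] <-]; rewrite setTI; apply: sub_sigma_algebra.
apply: open_comp; last exact: interval_open.
by move=> y _; exact: coord_continuous.
Qed.

End BorelVectors.

Section RuinSets.
Context {R : realType} {d : nat}.
Variable A : set 'rV[R]_d.
Hypothesis A_family : ruin_family A.

Lemma dilationP (u : R) (x : 'rV[R]_d) : 0 < u -> dilation u A x <-> A (u^-1 *: x).
Proof.
move=> u0; split=> [[a Aa <-]|Ax]; first by rewrite scalerA mulVf ?gt_eqF// scale1r.
by exists (u^-1 *: x) => //; rewrite scalerA divff ?gt_eqF// scale1r.
Qed.

Lemma ruin_family_open : open A. Proof. by case: A_family. Qed.

Lemma ruin_family0 : ~ A 0.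
Proof. by case: A_family => _ _ _ _ nA /subset_closure. Qed.

Lemma ruin_family_conv (x y : 'rV[R]_d) (k : R) : 0 <= k -> k <= 1 ->
  ~ A x -> ~ A y -> ~ A (k *: x + (1 - k) *: y).
Proof.
move=> k0 k1 nx ny; case: A_family => _ _ _ cA _.
have k01 : Itv.spec (Itv.num_sem (R:=R)) (Itv.Real `[0%Z, 1%Z]) k.
  by rewrite /= /Itv.num_sem/= num_real in_itv/= k0.
have := cA x y (Itv.Def k01); rewrite !inE.
exact.
Qed.

(** The point [y] lies on the segment from [0] to [s y], and [0] is not in [A]. *)
Lemma ruin_family_scale (y : 'rV[R]_d) s : 1 <= s -> A y -> A (s *: y).
Proof.
move=> s1 Ay; apply: contrapT => nA; have s0 : 0 < s by exact: lt_le_trans s1.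
apply: (ruin_family_conv (k := s^-1)) nA ruin_family0 _.
- by rewrite invr_ge0 ltW.
- by rewrite invf_le1.
by rewrite scaler0 addr0 scalerA mulVf ?gt_eqF// scale1r.
Qed.

Lemma ruin_family_bounded (x : 'rV[R]_d) : exists M, forall u, 0 < u -> A (u^-1 *: x) -> u <= M.
Proof.
case: A_family => _ oA _ _ nc.
have /nbhs_ballP[e /= e0 He] : nbhs (0 : 'rV[R]_d) (~` closure A).
  by apply: open_nbhs_nbhs; split=> //; apply: closed_openC; exact: closed_closure.
have M0 : 0 < `|x| + 1 by rewrite ltr_wpDl.
exists ((`|x| + 1) / e) => u u0 Au; rewrite leNgt; apply/negP => uM.
apply: (He (u^-1 *: x)); last exact: subset_closure.
rewrite mx_norm_ball /ball_ /= sub0r normrN normrZ gtr0_norm ?invr_gt0//.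
rewrite mulrC ltr_pdivrMr//; rewrite ltr_pdivrMr// in uM.
by rewrite mulrC (lt_trans _ uM)// ltrDl.
Qed.

(** Membership in [u A] is monotone in [u] by [ruin_family_scale]; the inequality is
strict because [A] is open. *)
Lemma Y_gt (u : R) (x : 'rV[R]_d) : 0 < u -> u < Y_ A x <-> A (u^-1 *: x).
Proof.
move=> u0; split.
  rewrite /Y_; set E := [set v | _] => uE.
  have E0 : E !=set0.
    apply/set0P/eqP => E0; move: uE; rewrite E0 sup0 ltNge; by rewrite ltW.
  have [v [v0 /(dilationP _ v0) Av] uv] := sup_gt E0 uE.
  have -> : u^-1 *: x = (v / u) *: (v^-1 *: x) by rewrite scalerA mulrAC divff ?mul1r// gt_eqF.
  by apply: ruin_family_scale => //; rewrite ler_pdivlMr// mul1r ltW.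
move=> Au.
have [v uv Av] : exists2 v, u < v & A (v^-1 *: x).
  have /nbhs_ballP[e /= e0 He] : nbhs (u^-1 *: x) A by apply: open_nbhs_nbhs; split=> //; exact: ruin_family_open.
  set y := u^-1 *: x in He Au *.
  have y0 : 0 < `|y| + 1 by rewrite ltr_wpDl.
  pose s := e / (`|y| + 1); have s0 : 0 < s by rewrite divr_gt0.
  have s10 : 0 < 1 + s by rewrite addr_gt0.
  exists (u * (1 + s)); first by rewrite ltr_pMr// ltrDl.
  have -> : (u * (1 + s))^-1 *: x = (1 + s)^-1 *: y by rewrite /y scalerA invfM mulrC.
  apply: He; rewrite mx_norm_ball /ball_ /= -[X in X - _]scale1r -scalerBl normrZ.
  have i1 : 1 - (1 + s)^-1 = s / (1 + s) by field; rewrite gt_eqF.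
  rewrite i1 gtr0_norm ?divr_gt0//.
  have ey : s * (`|y| + 1) = e by rewrite /s divfK// gt_eqF.
  rewrite mulrAC ltr_pdivrMr// (@lt_le_trans _ _ e)//; last by rewrite ler_peMr ?lerDl ?ltW.
  by rewrite -ey ltr_pM2l// ltrDl.
have v0 : 0 < v by exact: lt_trans uv.
apply: (lt_le_trans uv); apply: ub_le_sup; last by split => //; exact/dilationP.
have [M HM] := ruin_family_bounded x; exists M => w [w0 /(dilationP _ w0)].
exact: HM.
Qed.

Lemma Y_ge0 (x : 'rV[R]_d) : 0 <= Y_ A x.
Proof.
rewrite /Y_; set E := [set u | _].
have [->|/set0P[u Eu]] := eqVneq E set0; first by rewrite sup0.
have [M HM] := ruin_family_bounded x.
apply: (@le_trans _ _ u); first by case: Eu => /ltW.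
apply: ub_le_sup => //; exists M => v [v0 /(dilationP _ v0)]; exact: HM.
Qed.

Lemma Y_le (u : R) (x : 'rV[R]_d) : 0 < u -> Y_ A x <= u <-> ~ A (u^-1 *: x).
Proof.
move=> u0; split; first by move=> Yu /(Y_gt _ u0); rewrite ltNge Yu.
by move=> nA; rewrite leNgt; apply/negP => /(Y_gt _ u0).
Qed.

(** If [a] and [b] exceed the gauges of [x] and [y], then [x / a] and [y / b] are
outside [A], and [(x + y) / (a + b)] is a convex combination of them. *)
Lemma Y_add (x y : 'rV[R]_d) : Y_ A (x + y) <= Y_ A x + Y_ A y.
Proof.
apply/ler_addgt0Pl => e e0.
pose a := Y_ A x + e / 2; pose b := Y_ A y + e / 2.
have e20 : 0 < e / 2 by rewrite divr_gt0.
have a0 : 0 < a by rewrite ltr_wpDl// Y_ge0.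
have b0 : 0 < b by rewrite ltr_wpDl// Y_ge0.
have -> : e + (Y_ A x + Y_ A y) = a + b by rewrite /a /b; lra.
have ab0 : 0 < a + b by rewrite addr_gt0.
apply/Y_le => //.
have -> : (a + b)^-1 *: (x + y) = (a / (a + b)) *: (a^-1 *: x) + (1 - a / (a + b)) *: (b^-1 *: y).
  rewrite !scalerA scalerDr; congr (_ *: _ + _ *: _); first by rewrite mulrAC divff ?mul1r// gt_eqF.
  by field; rewrite !gt_eqF.
apply: ruin_family_conv.
- by rewrite divr_ge0// ltW.
- by rewrite ler_pdivrMr// mul1r lerDl ltW.
- by apply/Y_le => //; rewrite /a lerDl ltW.
- by apply/Y_le => //; rewrite /b lerDl ltW.
Qed.

Lemma Y_scale (c : R) (x : 'rV[R]_d) : 0 < c -> Y_ A (c *: x) = c * Y_ A x.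
Proof.
move=> c0.
have le k y : 0 < k -> Y_ A (k *: y) <= k * Y_ A y.
  move=> k0; apply/ler_addgt0Pl => e e0.
  have ek : 0 < e / k by rewrite divr_gt0.
  have -> : e + k * Y_ A y = k * (Y_ A y + e / k) by field; rewrite gt_eqF.
  have p0 : 0 < Y_ A y + e / k by rewrite ltr_wpDl// Y_ge0.
  apply/Y_le; first by rewrite mulr_gt0.
  rewrite scalerA invfM mulrAC mulVf ?mul1r ?gt_eqF//.
  by apply/Y_le => //; rewrite lerDl ltW.
apply/eqP; rewrite eq_le le//= -ler_pdivlMl//.
have := le c^-1 (c *: x); rewrite invr_gt0 => /(_ c0).
by rewrite scalerA mulVf ?gt_eqF// scale1r.
Qed.

Lemma Y_sum (I : Type) (s : seq I) (c : I -> R) (x : I -> 'rV[R]_d) : (forall i, 0 < c i) ->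
  Y_ A (\sum_(i <- s) c i *: x i) <= \sum_(i <- s) c i * Y_ A (x i).
Proof.
move=> c0; elim: s => [|i s IH].
  rewrite !big_nil leNgt; apply/negP => Y0; have Y20 : 0 < Y_ A 0 / 2 by rewrite divr_gt0.
  have : Y_ A 0 / 2 < Y_ A 0 by lra.
  by move/(Y_gt _ Y20); rewrite scaler0; exact: ruin_family0.
by rewrite !big_cons (le_trans (Y_add _ _))// Y_scale// lerD2l.
Qed.

Lemma measurable_Y : measurable_fun [set: borel_rV R d] (Y_ A).
Proof.
apply: (measurability (@RGenOInfty.G R)); first exact: RGenOInfty.measurableE.
have mpos u : 0 < u -> measurable (Y_ A @^-1` `]u, +oo[ : set (borel_rV R d)).
  move=> u0; apply: sub_sigma_algebra.
  rewrite (_ : _ @^-1` _ = (fun x : 'rV[R]_d => u^-1 *: x) @^-1` A).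
    apply: open_comp ruin_family_open => x _.
    exact: scaler_continuous.
  by apply/seteqP; split => x /=; rewrite in_itv/= andbT => /(Y_gt _ u0).
move=> _ [_ [u ->] <-]; rewrite setTI; have [u0|u0|u0] := ltgtP u 0; last 1 first.
- rewrite u0 (_ : _ @^-1` _ = \bigcup_n (Y_ A @^-1` `]n.+1%:R^-1, +oo[)).
    by apply: bigcupT_measurable => n; apply: mpos; rewrite invr_gt0.
  apply/seteqP; split => x /=.
    rewrite in_itv/= andbT => Y0; exists (Num.truncn (Y_ A x)^-1) => //=.
    rewrite in_itv/= andbT invf_plt ?posrE//; exact: truncnS_gt.
  by move=> [n _ /=]; rewrite !in_itv/= !andbT; apply: lt_trans; rewrite invr_gt0.
- rewrite (_ : _ @^-1` _ = setT)//; apply/seteqP; split => // x _ /=.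
  by rewrite in_itv/= andbT (lt_le_trans u0)// Y_ge0.
- exact: mpos.
Qed.

End RuinSets.

(** * Translating the distribution classes and the claim integral *)

Section DistributionClasses.
Context {R : realType} {d : nat} {dT : measure_display} {T : measurableType dT}.
Variables (P : probability T R) (X : {RV P >-> borel_rV R d}) (A : set 'rV[R]_d).
Hypothesis A_family : ruin_family A.

Let Y (w : T) : R := Y_ A (X w).
Let mX : measurable_fun setT X. Proof. exact: measurable_funPT. Qed.
Let mY : measurable_fun setT Y.
Proof. exact: measurableT_comp (measurable_Y A_family) mX. Qed.
Let Yrv : {RV P >-> R} := mfun_Sub (mem_set mY).
Notation F := (distribution P X).

Lemma tail_F_ x : tail (F_ A F) x = survival P Y x.
Proof.
rewrite /tail /survival /prob; congr (fine (P _)).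
by apply/seteqP; split => w /=; rewrite in_itv/= andbT.
Qed.

(** Unfolding the convolution; the second factor is the law convolved with the point
mass at [0], that is, the law itself. *)
Lemma tail_convolution_power2 x :
  tail (convolution_power (F_ A F) 2) x = survival_conv2 P Y x.
Proof.
have -> : F_ A F = distribution P Yrv by [].
have V_itv y : distribution P Yrv `]y, +oo[%classic = (survival P Y y)%:E.
  rewrite -probE; last exact: measurable_gt.
  by congr (P _); apply/seteqP; split => w /=; rewrite in_itv/= andbT.
have conv1 y : convolution_power (distribution P Yrv) 1 `]y, +oo[%classic = (survival P Y y)%:E.
  rewrite -V_itv /= /convolution /pushforward /product_measure1 /=.
  transitivity (\int[distribution P Yrv]_u (\1_(`]y, +oo[%classic) u)%:E)%E.
    apply: eq_integral => u _; rewrite diracE indicE.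
    rewrite (_ : (0 \in _) = (u \in `]y, +oo[%classic))//.
    by apply/idP/idP; rewrite !inE /xsection/= !inE /= addr0.
  by rewrite integral_indic// setIT.
rewrite /tail (_ : convolution_power _ 2 _ = (survival_conv2 P Y x)%:E)//.
transitivity (\int[distribution P Yrv]_u (survival P Y (x - u))%:E)%E.
  apply: eq_integral => u _; rewrite -conv1.
  rewrite [RHS]/convolution_power [LHS]/=; congr (convolution _ _ _).
  by apply/seteqP; split => z /=; rewrite /xsection/= inE /= !in_itv/= !andbT ltrBlDl.
have mS : measurable_fun [set: R] (fun u => survival P Y (x - u)).
  by apply: measurableT_comp; [exact: measurable_survival|exact: measurable_funB].
rewrite ge0_integral_distribution; last 2 first.
- exact/measurable_EFinP.
- by move=> u; rewrite lee_fin survival_ge0.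
rewrite /survival_conv2 -mean_EFin//.
- apply: (@bounded_measurable_comp _ _ _ (fun u => survival P Y (x - u)) Y) => //.
  by move=> u; rewrite survival_ge0 survival_le1.
- by move=> w; exact: survival_ge0.
Qed.

Lemma class_S_double : class_S A F -> asymptotically_double P Y.
Proof.
move=> [Fpos /(_ 2%N isT) F2]; split; first by move=> x; rewrite -tail_F_.
move=> e e0; move/cvgrPdist_le : F2 => /(_ e e0); apply: filterS => x.
rewrite tail_convolution_power2 tail_F_ => H.
have F0 : 0 < survival P Y x by rewrite -tail_F_.
rewrite -ler_pdivrMr//; move: H; rewrite ler_norml => /andP[H _]; lra.
Qed.

(** An upper limit below one yields a constant below one that bounds the ratio from
some point on. *)
Lemma positively_decreasing_survival : class_S A F -> positively_decreasing (F_ A F) ->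
  exists v q x0 : R, [/\ 1 < v, q < 1 &
    forall x, x0 <= x -> survival P Y (v * x) <= q * survival P Y x].
Proof.
move=> [Fpos _] [v v1]; rewrite limf_esupE => /ereal_inf_lt[_ [V [M [_ HM]] <-]] sup1.
have [q q1 Hq] : exists2 q, q < 1 & forall x, V x -> tail (F_ A F) (v * x) / tail (F_ A F) x <= q.
  set s := ereal_sup _ in sup1.
  have Hs x : V x -> ((tail (F_ A F) (v * x) / tail (F_ A F) x)%:E <= s)%E.
    by move=> Vx; apply: ereal_sup_ubound; exists x.
  case: s sup1 Hs => [s s1 Hs|//|_ Hs].
    by exists s => // x /Hs; rewrite lee_fin.
  by exists 0 => // x /Hs; rewrite leeNy_eq.
exists v, q, (M + 1); split => // x Mx.
rewrite -!tail_F_ -ler_pdivrMr//; apply: Hq; apply: HM.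
by apply: lt_le_trans Mx; rewrite ltrDl.
Qed.

End DistributionClasses.

Section ClaimIntegral.
Context {R : realType} {d : nat} {dT : measure_display} {T : measurableType dT}.
Variables (P : probability T R) (X : nat -> {RV P >-> borel_rV R d}) (A : set 'rV[R]_d).
Hypothesis A_family : ruin_family A.
Variable theta : nat -> {RV P >-> R}.
Hypothesis theta_ge0 : forall k w, 0 <= theta k w.
Variable r : R.

Notation Xf := (fun i => X i : T -> borel_rV R d).
Notation thetaf := (fun i => theta i : T -> R).

(** The renewal measure is the sum of the laws of the arrival times, and [x exp(r s) A]
contains the claim exactly when its gauge exceeds [x exp(r s)]. *)
Lemma claim_integralE x t : 0 < x ->
  claim_integral P thetaf Xf r A x t = fine (expected_exceedances P Xf (Y_ A) thetaf r x t).
Proof.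
move=> x0; rewrite /claim_integral; congr fine.
have mth i : measurable_fun setT (thetaf i) by exact: measurable_funPT.
have mY : measurable_fun setT (score Xf (Y_ A) 0).
  by apply: measurableT_comp; [exact: measurable_Y|exact: measurable_funPT].
have mt i := measurable_tau mth i.
pose taurv i : {mfun T >-> R} := mfun_Sub (mem_set (mt i)).
pose m i : {measure set R -> \bar R} := distribution P (taurv i.+1).
have -> : renewal_measure P thetaf = mseries m 0.
  apply/funext => B; rewrite /renewal_measure /mseries.
  rewrite -(@nneseries_addn _ _ 1)//.
  by apply: eq_eseriesr => i _; rewrite addn1.
have mG : measurable_fun [set: R] (fun s => survival P (score Xf (Y_ A) 0) (x * expR (r * s))).
  apply: measurableT_comp; first exact: measurable_survival.
  by apply: measurable_funM => //; apply: measurableT_comp => //; exact: measurable_funM.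
transitivity (\int[mseries m 0]_(s in `[0%R, t]) (survival P (score Xf (Y_ A) 0) (x * expR (r * s)))%:E)%E.
  apply: eq_integral => s _; rewrite -probE; last exact: measurable_gt.
  have u0 : 0 < x * expR (r * s) by rewrite mulr_gt0 ?expR_gt0.
  congr (P _); apply/seteqP; split => w /=.
    by move=> /(dilationP _ _ u0) /(Y_gt A_family _ u0).
  by move=> /(Y_gt A_family _ u0) /(dilationP _ _ u0).
rewrite ge0_integral_measure_series//; last 2 first.
- by move=> s _; rewrite lee_fin survival_ge0.
- by apply/measurable_EFinP; exact: measurable_funTS.
apply: eq_eseriesr => i _.
rewrite ge0_integral_pushforward//; last 2 first.
- by apply/measurable_EFinP; exact: measurable_funTS.
- by move=> s _; rewrite lee_fin survival_ge0.
rewrite integral_mkcond /exceedance_prob -mean_EFin; last 2 first.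
- by apply: bounded_measurable_exceedance => //; exact: measurable_Y.
- by move=> w; rewrite mulr_ge0// survival_ge0.
apply: eq_integral => w _; rewrite patchE /=.
have t0 : 0 <= tau thetaf i.+1 w by exact: tau_ge0.
rewrite (_ : (w \in _) = (tau thetaf i.+1 w <= t)).
  by case: (leP (tau thetaf i.+1 w) t) => _; rewrite ?mul1r ?mul0r.
by apply/idP/idP; rewrite inE /= in_itv/= t0.
Qed.

End ClaimIntegral.

(** * The ruin event *)

Section Premium.
Context {R : realType} {dT : measure_display} {T : measurableType dT}.
Variables (p : T -> R -> R) (C : R) (r : R).
Hypothesis mp : measurable_fun ([set: T] `*` `[0, +oo[%classic : set (T * R)) (fun z => p z.1 z.2).
Hypothesis p_bounded : forall w (t : R), 0 <= t -> 0 <= p w t <= C.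
Hypothesis r_ge0 : 0 <= r.

Definition premium (s : R) (w : T) : R :=
  \int[lebesgue_measure]_(u in `[0, s]) (expR (- r * u) * p w u).

Let g w u : \bar R := (expR (- r * u) * p w u)%:E.

Let g_ge0 w u : 0 <= u -> (0 <= g w u)%E.
Proof. by move=> u0; rewrite lee_fin mulr_ge0 ?expR_ge0//; have /andP[] := p_bounded w u0. Qed.

Let mD0 : measurable ([set: T] `*` `[0, +oo[%classic : set (T * R)).
Proof. by apply: measurableX => //; exact: measurable_itv. Qed.

Let mg2 : measurable_fun ([set: T] `*` `[0, +oo[%classic : set (T * R)) (fun z => g z.1 z.2).
Proof.
apply/measurable_EFinP; apply: measurable_funM => //.
apply: measurable_funTS; apply: measurableT_comp => //.
by apply: measurable_funM.
Qed.

Let mg w : measurable_fun (`[0, +oo[%classic : set R) (g w).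
Proof.
rewrite (_ : g w = (fun z : T * R => g z.1 z.2) \o pair w)//.
apply: (measurable_comp mD0 _ mg2); first by move=> _ [u /= u0 <-].
by apply: measurable_funTS; exact: pair1_measurable.
Qed.

Let mgs w s : measurable_fun (`[0, s]%classic : set R) (g w).
Proof.
by apply: measurable_funS (mg w) => // u /=; rewrite !in_itv/= andbT => /andP[].
Qed.

Let int_le w s : 0 <= s -> (\int[lebesgue_measure]_(u in `[0%R, s]) g w u <= (C * s)%:E)%E.
Proof.
move=> s0; apply: (@le_trans _ _ (\int[lebesgue_measure]_(u in `[0%R, s]) (cst C%:E u))%E).
  apply: ge0_le_integral => //.
  - by move=> u; rewrite /= in_itv/= => /andP[u0 _]; exact: g_ge0.
  - exact: mgs.
  - move=> u; rewrite /= in_itv/= => /andP[u0 _]; rewrite lee_fin.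
    have /andP[p0 pC] := p_bounded w u0.
    apply: le_trans pC; rewrite ler_piMl// -expR0 ler_expR mulNr oppr_le0 mulr_ge0//.
rewrite integral_cst//= lebesgue_measure_itv/= lte_fin.
case: ltP => h; first by rewrite oppr0 adde0.
have -> : s = 0 by apply/eqP; rewrite eq_le h.
by rewrite mule0 mulr0.
Qed.

Let int_ge0 w s : (0 <= \int[lebesgue_measure]_(u in `[0%R, s]) g w u)%E.
Proof. by apply: integral_ge0 => u; rewrite /= in_itv/= => /andP[u0 _]; exact: g_ge0. Qed.

Let int_fin w s : 0 <= s -> (\int[lebesgue_measure]_(u in `[0%R, s]) g w u)%E \is a fin_num.
Proof.
by move=> s0; rewrite ge0_fin_numE// (le_lt_trans (int_le w s0))// ltry.
Qed.

Lemma premium_ge0 s w : 0 <= premium s w.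
Proof. by rewrite /premium /Rintegral fine_ge0//; exact: int_ge0. Qed.

Lemma premium_le s w : 0 <= s -> premium s w <= C * s.
Proof.
move=> s0; rewrite -lee_fin /premium /Rintegral fineK; first exact: int_le.
exact: int_fin.
Qed.

Lemma premium_mono s s' w : 0 <= s -> s <= s' -> premium s w <= premium s' w.
Proof.
move=> s0 ss'; rewrite /premium /Rintegral fine_le//.
- exact: int_fin.
- by apply: int_fin; exact: le_trans ss'.
apply: ge0_subset_integral => //.
- exact: mgs.
- by move=> u; rewrite /= in_itv/= => /andP[u0 _]; exact: g_ge0.
- by move=> u; rewrite /= !in_itv/= => /andP[-> /le_trans ->].
Qed.

(** Tonelli's theorem for the integrand cut off at the random time [Z], extended by
zero. *)
Lemma measurable_premium (Z : T -> R) : measurable_fun setT Z ->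
  measurable_fun setT (fun w => premium (Z w) w).
Proof.
move=> mZ.
pose D : set (T * R) := [set z | 0 <= z.2 /\ z.2 <= Z z.1].
have mD : measurable D.
  rewrite (_ : D = ([set: T] `*` `[0, +oo[%classic) `&` [set z | z.2 - Z z.1 <= 0]).
    apply: measurableI => //; apply: measurable_le_cst; apply: measurable_funB => //.
    exact: measurableT_comp.
  apply/seteqP; split => z; rewrite /D /= in_itv/= andbT subr_le0; first by move=> [].
  by move=> [[]].
pose h : T * R -> \bar R := (fun z => g z.1 z.2) \_ D.
have mh : measurable_fun setT h.
  apply/(measurable_restrictT _ mD); apply: measurable_funS mg2 => //.
  by move=> z [z0 _]; split => //=; rewrite in_itv/= z0.
have h0 z : (0 <= h z)%E.
  by rewrite /h patchE; case: ifPn => //; rewrite inE => -[z0 _]; exact: g_ge0.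
rewrite (_ : (fun w => _) = fine \o fubini_F lebesgue_measure h).
  apply: measurableT_comp => //; exact: measurable_fun_fubini_tonelli_F.
apply/funext => w; rewrite /premium /Rintegral /= /fubini_F; congr fine.
rewrite [LHS]integral_mkcond; apply: eq_integral => u _.
rewrite /h !patchE /=.
rewrite (_ : (u \in _) = ((w, u) \in D))//.
by apply/idP/idP; rewrite !inE /D /= in_itv/= => /andP.
Qed.

End Premium.

Section RuinEvent.
Context {R : realType} {d : nat} {dT : measure_display} {T : measurableType dT}.
Variables (X : nat -> T -> 'rV[R]_d) (theta : nat -> T -> R) (p : 'I_d -> T -> R -> R).
Variables (C : 'I_d -> R) (r : R) (l : 'rV[R]_d) (L : set 'rV[R]_d).
Hypothesis mX : forall i j, measurable_fun setT (fun w => X i w 0 j).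
Hypothesis X_ge0 : forall i w j, 0 <= X i w 0 j.
Hypothesis mtheta : forall i, measurable_fun setT (theta i).
Hypothesis theta_ge0 : forall k w, 0 <= theta k w.
Hypothesis mp : forall j,
  measurable_fun ([set: T] `*` `[0, +oo[%classic : set (T * R)) (fun z => p j z.1 z.2).
Hypothesis p_bounded : forall j w (t : R), 0 <= t -> 0 <= p j w t <= C j.
Hypotheses (C_gt0 : forall j, 0 < C j) (r_ge0 : 0 <= r) (l_gt0 : forall j, 0 < l 0 j).
Hypotheses (L_open : open L) (L_decreasing : decreasing_set L).
Hypothesis L_cone : forall k : R, 0 < k -> dilation k L = L.
Notation A := [set l - y | y in L].
Hypothesis A_family : ruin_family A.

Notation tau := (tau theta).
Notation U := (U_ theta X p r l).
Notation weight := (claim_weight theta r).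

Definition ruin_event (x t : R) : set T := [set w | exists2 s, 0 <= s <= t & L (U x s w)].

Definition claims_paid (n : nat) (w : T) : 'rV[R]_d :=
  \sum_(i <- iota 0 n) expR (- r * tau i.+1 w) *: X i w.

Definition reserve (x : R) (n : nat) (s : R) (w : T) : 'rV[R]_d :=
  x *: l + \row_j premium (p j) r s w - claims_paid n w.

Lemma L_decreasingP (y z : 'rV[R]_d) : L y -> (forall j, z 0 j <= y 0 j) -> L z.
Proof.
move=> Ly zy; have [||u Lu] := @L_decreasing (- y) (y - z).
- by exists y.
- by move=> j; rewrite !mxE subr_ge0.
by rewrite addrA addNr add0r => /oppr_inj <-.
Qed.

Lemma L_coneP k (y : 'rV[R]_d) : 0 < k -> L y -> L (k *: y).
Proof. by move=> k0 Ly; rewrite -(L_cone k0); exists y. Qed.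

Lemma ruin_setP (z : 'rV[R]_d) : A z <-> L (l - z).
Proof.
split; first by move=> [y Ly <-]; rewrite opprB addrC subrK.
by move=> Lz; exists (l - z) => //; rewrite opprB addrC subrK.
Qed.

(** The cone property turns the capital [x l] into [l], and [A] is [l - L]. *)
Lemma surplus_ruinP x (z : 'rV[R]_d) : 0 < x -> L (x *: l - z) <-> A (x^-1 *: z).
Proof.
move=> x0; rewrite ruin_setP; have xi0 : 0 < x^-1 by rewrite invr_gt0.
split=> [/(L_coneP xi0)|/(L_coneP x0)].
  by rewrite scalerBr scalerA mulVf ?gt_eqF// scale1r.
by rewrite scalerBr scalerA divff ?gt_eqF// scale1r.
Qed.

Lemma N_between_arrivals n s w : 0 <= s -> tau n w <= s -> s < tau n.+1 w -> N_ theta s w = n%:R%:E.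
Proof.
move=> s0 ns sn; apply/eqP; rewrite eq_le; apply/andP; split.
  apply: ge_ereal_sup => _ [m /= ms <-]; rewrite lee_fin ler_nat leqNgt; apply/negP => nm.
  by have := le_lt_trans (le_trans (tau_mono theta_ge0 w nm) ms) sn; rewrite ltxx.
by rewrite N_ge.
Qed.

Lemma surplus_between_arrivals x n s w : 0 <= s -> tau n w <= s -> s < tau n.+1 w ->
  U x s w = reserve x n s w.
Proof.
move=> s0 ns sn; rewrite /U_ /reserve /D_ (N_between_arrivals s0 ns sn)/=.
rewrite (_ : Num.truncn n%:R = n); last by apply: truncn_def; rewrite lexx ltr_nat ltnSn.
rewrite /claims_paid -(big_mkord predT (fun i => expR (- r * tau i.+1 w) *: X i w)).
by rewrite /index_iota subn0.
Qed.

Lemma arrivals_finite s w : 0 <= s -> (exists k, s < tau k w) ->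
  exists n, tau n w <= s /\ s < tau n.+1 w.
Proof.
move=> s0 [k]; elim: k => [|k IH]; first by rewrite tau0 ltNge s0.
move=> sk; have [ks|sk'] := leP (tau k w) s; first by exists k.
exact: IH.
Qed.

(** In this case [D_] is an empty sum, because [fine +oo] is [0]. *)
Lemma arrivals_infinite s w : (forall k, tau k w <= s) -> N_ theta s w = +oo%E.
Proof.
move=> H; apply/eqP; rewrite -leye_eq leNgt; apply/negP => Nlt.
have N0 : (0 <= N_ theta s w)%E by apply: ereal_sup_ubound; exists 0%N => //; exact: H.
move: Nlt; rewrite -ge0_fin_numE// => /fineK NE.
have : ((Num.truncn (fine (N_ theta s w))).+1%:R%:E <= N_ theta s w)%E.
  by apply: ereal_sup_ubound; exists (Num.truncn (fine (N_ theta s w))).+1 => //; exact: H.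
by rewrite -NE lee_fin leNgt truncnS_gt.
Qed.

Definition ruin_after (x t : R) (n : nat) : set T :=
  [set w | [/\ tau n w <= t, tau n w < tau n.+1 w & L (reserve x n (tau n w) w)]].

(** Between arrivals the surplus only grows, and [L] is decreasing, so ruin at some
time implies ruin at the preceding arrival.  When infinitely many arrivals have
occurred, no claim is subtracted and ruin is impossible since [0] is not in [A].
This reduces the event to countably many times, hence makes it measurable. *)
Lemma ruin_eventE x t : 0 < x -> ruin_event x t = \bigcup_n ruin_after x t n.
Proof.
move=> x0; apply/seteqP; split => w; last first.
  move=> [n _ [nt nn Lr]]; exists (tau n w); first by rewrite tau_ge0.
  by rewrite (@surplus_between_arrivals _ n)// tau_ge0.
move=> [s /andP[s0 st] LU].
have [fin|/forallNP inf] := pselect (exists k, s < tau k w); last first.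
  have inf' k : tau k w <= s by rewrite leNgt; apply/negP; exact: inf.
  exfalso; move: LU; rewrite /U_ /D_ arrivals_infinite//= truncn0 big_ord0 subr0.
  set q := \row_j _; rewrite -[q]opprK => /(surplus_ruinP _ x0) Aq.
  have q0 j : 0 <= (x^-1 *: q) 0 j.
    rewrite !mxE; apply: mulr_ge0; first by rewrite invr_ge0 ltW.
    exact: (premium_ge0 r (p_bounded j)).
  case: (A_family) => _ _ /(_ _ _ Aq q0) + _ _.
  by rewrite scalerN addNr; exact: ruin_family0.
have [n [ns sn]] := arrivals_finite s0 fin.
exists n => //; split; [exact: le_trans st|exact: le_lt_trans sn|].
move: LU; rewrite (surplus_between_arrivals _ s0 ns sn) => LU; apply: L_decreasingP LU _ => j.
rewrite !mxE lerB// lerD2l; exact: (premium_mono (mp j) (p_bounded j) r_ge0 w (tau_ge0 theta_ge0 n w) ns).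
Qed.

Lemma measurable_ruin_event x t : 0 < x -> measurable (ruin_event x t).
Proof.
move=> x0; rewrite ruin_eventE//; apply: bigcupT_measurable => n.
have mt k : measurable_fun setT (tau k) by exact: measurable_tau.
rewrite (_ : ruin_after x t n = [set w | tau n w <= t] `&` ([set w | 0 < tau n.+1 w - tau n w] `&`
  [set w | L (reserve x n (tau n w) w)])); last first.
  apply/seteqP; split => w /=; first by move=> [? ? ?]; rewrite subr_gt0.
  by move=> [? []]; rewrite subr_gt0.
apply: measurableI; first exact: measurable_le_cst.
apply: measurableI; first by apply: measurable_gt; exact: measurable_funB.
apply: measurable_open_preimage => // j.
rewrite (_ : (fun w => _) = (fun w => x * l 0 j + premium (p j) r (tau n w) w -
   \sum_(i <- iota 0 n) expR (- r * tau i.+1 w) * X i w 0 j)); last first.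
  apply/funext => w; rewrite !mxE; congr (_ - _).
  by rewrite /claims_paid summxE; apply: eq_bigr => i _; rewrite mxE.
apply: measurable_funB.
  by apply: measurable_funD => //; exact: (measurable_premium r (mp j) (p_bounded j)).
apply: measurable_sum => i; apply: measurable_funM => //.
by apply: measurableT_comp => //; exact: measurable_funM.
Qed.

(** The premiums may be dropped because [L] is decreasing; then the gauge is
subadditive. *)
Lemma ruin_sum x t w : 0 < x -> ruin_event x t w ->
  exists m, x < weighted_sum (X : nat -> T -> borel_rV R d) (Y_ A) (iota 0 m) (weight t w) w.
Proof.
move=> x0; rewrite ruin_eventE// => -[n _ [nt nn Lr]]; exists n.
have : x < Y_ A (claims_paid n w).
  apply/Y_gt => //; apply/surplus_ruinP => //; apply: L_decreasingP Lr _ => j.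
  by rewrite !mxE lerD2r lerDl; exact: (premium_ge0 r (p_bounded j)).
move=> /lt_le_trans; apply.
apply: (le_trans (Y_sum A_family _ _ _)) => [i|]; first exact: expR_gt0.
rewrite /weighted_sum big_seq [leRHS]big_seq; apply: ler_sum => i.
rewrite mem_iota add0n => /andP[_ ilt].
rewrite /claim_weight (le_trans (tau_mono theta_ge0 w ilt) nt) mul1r//.
Qed.

(** A multiple of [l] by this number dominates the premiums earned up to [T0], since
all coordinates of [l] are positive. *)
Definition premium_margin (T0 : R) : R := \sum_j C j * T0 / l 0 j.

Lemma premium_margin_ge0 T0 : 0 <= T0 -> 0 <= premium_margin T0.
Proof.
by move=> T00; apply: sumr_ge0 => j _; rewrite divr_ge0 ?mulr_ge0 ?(ltW (C_gt0 _)) ?(ltW (l_gt0 _)).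
Qed.

Lemma premium_margin_le T0 t w j : 0 <= t -> t <= T0 ->
  premium (p j) r t w <= premium_margin T0 * l 0 j.
Proof.
move=> t0 tT; have T00 : 0 <= T0 by exact: le_trans tT.
apply: (le_trans (premium_le (mp j) (p_bounded j) r_ge0 w t0)).
apply: (@le_trans _ _ (C j * T0)); first by rewrite ler_wpM2l// ltW.
rewrite -ler_pdivrMr// /premium_margin (bigD1 j)//= lerDl.
by apply: sumr_ge0 => k _; rewrite divr_ge0 ?mulr_ge0 ?(ltW (C_gt0 _)) ?(ltW (l_gt0 _)).
Qed.

(** All other claims are nonnegative and the premiums are at most [c l], so the
surplus is at most [(x + c) l] minus the big claim, which is in [L]; conclude as
[L] is decreasing. *)
Lemma big_claim_ruin x t T0 n w : 0 < x -> 0 <= t -> t <= T0 -> (exists k, t < tau k w) ->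
  some_big_claim (X : nat -> T -> borel_rV R d) (Y_ A) n (weight t w) (x + premium_margin T0) w -> ruin_event x t w.
Proof.
move=> x0 t0 tT fin /hasP[i _ big].
have T00 : 0 <= T0 by exact: le_trans tT.
have c0 := premium_margin_ge0 T00; set c := premium_margin T0 in c0 big.
have xc0 : 0 < x + c by rewrite ltr_wpDr.
have wi0 : 0 < weight t w i.
  rewrite lt_neqAle claim_weight_ge0// andbT; apply/eqP => w0.
  by move: big; rewrite -w0 mul0r ltNge ltW.
have it : tau i.+1 w <= t by rewrite -(claim_weight_gt0 theta r).
have [k [kt tk]] := arrivals_finite t0 fin.
exists t; first by rewrite t0 lexx.
rewrite (surplus_between_arrivals x t0 kt tk).
have ik : (i < k)%N.
  rewrite ltnNge; apply/negP => ki.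
  by have := lt_le_trans tk (le_trans (tau_mono theta_ge0 w (ki : (k.+1 <= i.+1)%N)) it); rewrite ltxx.
pose xi := weight t w i *: X i w.
have Lxi : L ((x + c) *: l - xi).
  by apply/surplus_ruinP => //; apply/Y_gt => //; rewrite Y_scale.
apply: L_decreasingP Lxi _ => j; rewrite !mxE mulrDl.
apply: lerB; first by rewrite lerD2l premium_margin_le.
rewrite /claims_paid summxE (bigD1_seq i)/= ?iota_uniq ?mem_iota//.
rewrite !mxE /claim_weight it mul1r lerDl.
by apply: sumr_ge0 => k' _; rewrite mxE mulr_ge0 ?expR_ge0.
Qed.

End RuinEvent.

(** * Ruin asymptotics *)

Lemma uniformly_equivalentP (R : realType) (f g : R -> R -> R) (E : set R) :
  (forall d, 0 < d -> d < 1 -> exists x1 : R, forall x t, x1 <= x -> E t ->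
     0 < g x t /\ `|f x t - g x t| <= d * g x t) -> uniformly_equivalent f g E.
Proof.
move=> H.
have {}H d : 0 < d -> \forall x \near +oo,
   (0 <= ereal_sup ([set 0%E] `|` [set `|f x t / g x t - 1|%:E | t in E]) <= d%:E)%E.
  move=> d0; pose e := Num.min d (1 / 2).
  have e0 : 0 < e by rewrite lt_min d0 divr_gt0.
  have e1 : e < 1 by rewrite gt_min; apply/orP; right; lra.
  have [x1 Hx1] := H e e0 e1.
  near=> x; have xx1 : x1 <= x by near: x; apply: nbhs_pinfty_ge; exact: num_real.
  apply/andP; split; first by apply: ereal_sup_ubound; left.
  apply: ge_ereal_sup => _ [->|[t Et <-]]; first by rewrite lee_fin ltW.
  have [g0 fg] := Hx1 x t xx1 Et.
  have -> : f x t / g x t - 1 = (f x t - g x t) / g x t by field; rewrite gt_eqF.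
  rewrite lee_fin normrM normfV (gtr0_norm g0) ler_pdivrMr// (le_trans fg)//.
  by rewrite ler_wpM2r ?(ltW g0)// ge_min lexx.
apply/fine_cvgP; split.
  have := H 1 ltr01; apply: filterS => x /andP[h0 h1].
  by rewrite ge0_fin_numE// (le_lt_trans h1)// ltry.
apply/cvgrPdist_le => d d0; have := H d d0; apply: filterS => x /andP[h0 h1] /=.
have fn : ereal_sup ([set 0%E] `|` [set `|f x t / g x t - 1|%:E | t in E]) \is a fin_num.
  by rewrite ge0_fin_numE// (le_lt_trans h1)// ltry.
by rewrite sub0r normrN ger0_norm ?fine_ge0// -lee_fin fineK.
Unshelve. all: by end_near. Qed.

(** Continuity from below. *)
Lemma prob_increasing_union (R : realType) dT (T : measurableType dT) (P : probability T R)
    (E : nat -> set T) (A : set T) B :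
  (forall m, measurable (E m)) -> (forall m, E m `<=` E m.+1) -> measurable A ->
  A `<=` \bigcup_m E m -> (forall m, prob P (E m) <= B) -> prob P A <= B.
Proof.
move=> mE Emono mA AE EB.
have mU : measurable (\bigcup_m E m) by exact: bigcupT_measurable.
apply: (@le_trans _ _ (prob P (\bigcup_m E m))); first exact: le_prob.
have H : P \o E @ \oo --> P (\bigcup_m E m).
  apply: nondecreasing_cvg_mu => // m n mn; apply/subsetPset.
  elim: n mn => [|n IH]; first by rewrite leqn0 => /eqP ->.
  by rewrite leq_eqVlt => /predU1P[->//|/IH mn]; exact: subset_trans (Emono n).
rewrite -lee_fin -probE// -(cvg_lim _ H)//; apply: lime_le; first by apply/cvg_ex; exists (P (\bigcup_m E m)).
by apply: nearW => m /=; rewrite probE// lee_fin.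
Qed.

Section RuinAsymptotics.
Context {R : realType} {d : nat} {dT : measure_display} {T : measurableType dT}.
Variable P : probability T R.
Variable X : nat -> {RV P >-> borel_rV R d}.
Hypothesis X_iid : iid P X.
Hypothesis X_ge0 : forall i w j, 0 <= (X i w : 'rV[R]_d) 0 j.
Variable theta : nat -> {RV P >-> R}.
Hypothesis theta_iid : iid P theta.
Hypothesis theta_ge0 : forall k w, 0 <= theta k w.
Hypothesis theta_nondegenerate : P [set w | theta 0%N w = 0] <> 1%E.
Variables (p : 'I_d -> T -> R -> R) (C : 'I_d -> R).
Hypothesis p_measurable : forall j,
     measurable_fun ([set: T] `*` `[0, +oo[%classic : set (T * R)) (fun z => p j z.1 z.2).
Hypothesis C_gt0 : forall j, 0 < C j.
Hypothesis p_bounded : forall j w (t : R), 0 <= t -> 0 <= p j w t <= C j.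
Variable r : R.
Hypothesis r_ge0 : 0 <= r.
Variable l : 'rV[R]_d.
Hypothesis l_gt0 : forall j, 0 < l 0 j.
Variable L : set 'rV[R]_d.
Hypothesis L_open : open L.
Hypothesis L_decreasing : decreasing_set L.
Hypothesis L_cone : forall k : R, 0 < k -> dilation k L = L.
Notation A := [set l - y | y in L].
Hypothesis A_family : ruin_family A.
Hypothesis X_N_independent : independent_systems P
     (sigma_of [set: nat] X) (sigma_of [set t : R | 0 <= t] (N_ theta)).

Let Xf i : T -> borel_rV R d := X i.
Let thetaf i : T -> R := theta i.
Let f : borel_rV R d -> R := Y_ A.
Let mX i : measurable_fun setT (Xf i). Proof. exact: measurable_funPT. Qed.
Let mtheta i : measurable_fun setT (thetaf i). Proof. exact: measurable_funPT. Qed.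
Let mf : measurable_fun setT f. Proof. exact: measurable_Y. Qed.
Let f_ge0 v : 0 <= f v. Proof. exact: Y_ge0. Qed.
Let mXj i j : measurable_fun setT (fun w => (X i w : 'rV[R]_d) 0 j).
Proof. by apply: (measurableT_comp (measurable_coord j)). Qed.

Notation tau := (tau thetaf).
Notation Phi x t := (fine (expected_exceedances P Xf f thetaf r x t)).
Notation psi := (ruin_probability P theta X p r l L).
Notation ruin := (ruin_event X theta p r l L).
Notation Fb := (survival P (score Xf f 0%N)).

Hypothesis FY : asymptotically_double P (score Xf f 0%N).

Let mruin x t : 0 < x -> measurable (ruin x t).
Proof.
exact: (measurable_ruin_event mXj mtheta theta_ge0 p_measurable p_bounded r_ge0
  L_open L_decreasing L_cone A_family).
Qed.

Let psiE x t : psi x t = prob P (ruin x t). Proof. by []. Qed.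

(** Otherwise [N_t] would vanish almost surely, and so would its mean. *)
Lemma arrival_probability_gt0 t : Lambda P theta t -> 0 < prob P [set w | tau 1 w <= t].
Proof.
move=> [t0 N0]; rewrite lt_neqAle prob_ge0 andbT; apply/eqP => p0.
have mle : measurable [set w | tau 1 w <= t] by exact/measurable_le_cst/measurable_tau.
move: N0; rewrite /renewal_function.
have mN : measurable_fun setT (N_ theta t) by exact: (measurable_N mtheta t).
have N_ge0 w : (0 <= N_ theta t w)%E.
  by apply: ereal_sup_ubound; exists 0%N => //=; rewrite tau0.
rewrite (@ge0_ae_eq_integral _ _ _ P setT (N_ theta t) (cst 0%E))//.
  by rewrite integral_cst// mul0e ltxx.
exists [set w | tau 1 w <= t]; split => //; first by have := probE P mle; rewrite -p0.
move=> w /= nN; apply: contrapT => /negP; rewrite -ltNge => t1; apply: nN => _.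
apply/eqP; rewrite eq_le N_ge0 andbT; apply: ge_ereal_sup => _ [n /= nt <-].
case: n nt => [//|n] nt; have := lt_le_trans t1 (le_trans (tau_mono theta_ge0 w (ltn0Sn n)) nt).
by rewrite ltxx.
Qed.

Lemma expected_exceedances_gt0 x t : 0 <= x -> Lambda P theta t -> 0 < Phi x t.
Proof.
move=> x0 Lt.
have := first_exceedance_le mX mf mtheta theta_iid theta_ge0 theta_nondegenerate r_ge0 t x0.
apply: lt_le_trans.
have mle : measurable [set w | tau 1 w <= t] by exact/measurable_le_cst/measurable_tau.
apply: (@lt_le_trans _ _ (Fb (x * expR (r * t)) * prob P [set w | tau 1 w <= t])).
  by rewrite mulr_gt0 ?arrival_probability_gt0//; exact: FY.1.
rewrite -mean_bool// -meanZ//; last exact: bounded_measurable_bool.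
apply: le_mean.
- by apply: bounded_measurableM => //; exact: bounded_measurable_bool.
- exact: bounded_measurable_exceedance.
move=> w; case: (leP (tau 1 w) t) => h; rewrite ?mulr0 ?mul0r// mul1r mulr1.
apply: survival_mono; first exact: measurable_score.
by rewrite ler_wpM2l// ler_expR ler_wpM2l.
Qed.

Lemma ruin_probability_le x t B : 0 < x ->
  (forall m, prob P [set w | x < weighted_sum Xf f (iota 0 m) (claim_weight thetaf r t w) w] <= B) ->
  psi x t <= B.
Proof.
move=> x0 H; rewrite psiE.
apply: (prob_increasing_union _ _ _ _ H) => [m|m w /=||w].
- apply: measurable_gt; apply: measurable_sum => i; apply: measurable_funM; last exact: measurable_score.
  exact: measurable_claim_weight.
- move=> h; apply: lt_le_trans h _; apply: weighted_sum_iota_le => // i.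
  exact: claim_weight_ge0.
- exact: mruin.
move=> /(ruin_sum theta_ge0 p_measurable p_bounded r_ge0 L_decreasing L_cone A_family x0) [m Hm].
by exists m.
Qed.

(** Up to the null event of infinitely many arrivals by [t], where the aggregate
claim is [0] by convention, [big_claim_ruin] applies. *)
Lemma ruin_probability_ge x t T0 n : 0 < x -> 0 <= t -> t <= T0 ->
  prob P [set w | some_big_claim Xf f n (claim_weight thetaf r t w) (x + premium_margin C l T0) w]
    <= psi x t.
Proof.
move=> x0 t0 tT; rewrite psiE.
pose I := \bigcap_k [set w | tau k w <= t].
have mle k : measurable [set w | tau k w <= t] by exact/measurable_le_cst/measurable_tau.
have mI : measurable I by exact: bigcap_measurable.
have PI : prob P I = 0.
  apply/eqP; rewrite eq_le prob_ge0 andbT; apply/ler_addgt0Pl => e e0; rewrite addr0.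
  have eT : 0 < e / expR t by rewrite divr_gt0// expR_gt0.
  have [k Hk] := small_geometric (laplace_ge0 P thetaf) (laplace_lt1 mtheta theta_ge0 theta_nondegenerate) eT.
  apply: (@le_trans _ _ (prob P [set w | tau k w <= t])).
    by apply: le_prob => // w; apply.
  have := renewal_exponential_bound mtheta theta_iid theta_ge0 t (iota_uniq 0 k).
  rewrite size_iota; under [in X in X -> _]eq_set do rewrite -tauE.
  move/le_trans; apply; rewrite mulrC -ler_pdivlMr// expR_gt0//.
have mbig : measurable [set w | some_big_claim Xf f n (claim_weight thetaf r t w) (x + premium_margin C l T0) w].
  by apply: measurable_some_big_claim => // i; exact: measurable_claim_weight.
apply: (@le_trans _ _ (prob P (ruin x t `|` I))).
  apply: le_prob => //; first by apply: measurableU => //; exact: mruin.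
  move=> w /= big; have [fin|/forallNP inf] := pselect (exists k, t < tau k w).
    left; exact: (big_claim_ruin X_ge0 theta_ge0 p_measurable p_bounded C_gt0 r_ge0 l_gt0 L_decreasing L_cone A_family x0 t0 tT fin big).
  by right => k _ /=; rewrite leNgt; apply/negP; exact: inf.
rewrite -lee_fin -!probE//; [|exact: mruin|by apply: measurableU => //; exact: mruin].
by rewrite measureU0//; [exact: mruin|have := probE P mI; rewrite PI].
Qed.

Lemma finite_horizon_equivalence T0 : 0 <= T0 ->
  uniformly_equivalent psi (claim_integral P theta X r A) (Lambda P theta `&` `]0, T0]).
Proof.
move=> T00; apply: uniformly_equivalentP => e e0 e1.
have [x1 x10 H1] := upper_finite_horizon mX X_iid mf f_ge0 mtheta theta_iid theta_ge0 theta_nondegenerate X_N_independent r_ge0 FY T0 e0.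
have c0 := premium_margin_ge0 C_gt0 l_gt0 T00.
have [n [x2 x20 H2]] := lower_finite_horizon mX X_iid mf f_ge0 mtheta theta_iid theta_ge0 theta_nondegenerate X_N_independent r_ge0 FY T0 c0 e0 e1.
exists (Num.max x1 x2 + 1) => x t xx [Lt]; rewrite /= in_itv/= => /andP[t0 tT].
have [xx1 [xx2 x0]] : x1 <= x /\ x2 <= x /\ 0 < x.
  have : Num.max x1 x2 < x by apply: lt_le_trans xx; rewrite ltrDl.
  by rewrite gt_max => /andP[h1 h2]; rewrite !ltW// (le_lt_trans x10).
rewrite (claim_integralE X A_family theta_ge0)//.
split; first by apply: expected_exceedances_gt0 => //; exact: ltW.
have up : psi x t <= (1 + e) * Phi x t by apply: ruin_probability_le => // m; exact: H1.
have lo : (1 - e) * Phi x t <= psi x t.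
  by apply: le_trans (H2 x t xx2 tT) _; apply: ruin_probability_ge => //; exact: ltW.
rewrite ler_norml; apply/andP; split; lra.
Qed.

(** Take [S1] from [long_horizon_negligible].  Up to [S1] the lower bound is that of
the finite horizon; beyond, the ruin probability is at least its value at [S1] and
the expected number of exceedances at most [1 + e / 3] times its value at [S1]. *)
Lemma infinite_horizon_equivalence (v q x0 eps : R) : 0 < r -> 1 < v -> q < 1 ->
  (forall x, x0 <= x -> Fb (v * x) <= q * Fb x) ->
  0 < eps -> P [set w | eps < thetaf 0%N w] = 1%E ->
  uniformly_equivalent psi (claim_integral P theta X r A) (Lambda P theta).
Proof.
move=> r0 v1 q1 decr eps0 gaps; apply: uniformly_equivalentP => e e0 e1.
have [x1 x10 H1] := upper_infinite_horizon mX X_iid mf f_ge0 mtheta theta_iid theta_ge0 theta_nondegenerate X_N_independent r0 FY v1 q1 decr eps0 gaps e0.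
have e30 : 0 < e / 3 by rewrite divr_gt0.
have e31 : e / 3 < 1 by lra.
have [S1 S10 [x3 x30 H3]] := long_horizon_negligible mX mf mtheta theta_iid theta_ge0 theta_nondegenerate r0 FY v1 q1 decr eps0 gaps 0 e30.
have c0 := premium_margin_ge0 C_gt0 l_gt0 S10.
have [n [x2 x20 H2]] := lower_finite_horizon mX X_iid mf f_ge0 mtheta theta_iid theta_ge0 theta_nondegenerate X_N_independent r_ge0 FY S1 c0 e30 e31.
exists (Num.max (Num.max x1 x2) x3 + 1) => x t xx Lt.
have [t0 _] := Lt.
have [xx1 [xx2 [xx3 xp]]] : x1 <= x /\ x2 <= x /\ x3 <= x /\ 0 < x.
  have : Num.max (Num.max x1 x2) x3 < x by apply: lt_le_trans xx; rewrite ltrDl.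
  by rewrite !gt_max => /andP[/andP[h1 h2] h3]; rewrite !ltW// (le_lt_trans x10).
have lo s : 0 <= s -> s <= S1 -> (1 - e / 3) * Phi x s <= psi x s.
  by move=> s0 sS; apply: le_trans (H2 x s xx2 sS) _; exact: ruin_probability_ge.
have Ph0 s := expected_exceedances_ge0 P Xf f thetaf r x s.
rewrite (claim_integralE X A_family theta_ge0)//.
split; first by apply: expected_exceedances_gt0 => //; exact: ltW.
have up : psi x t <= (1 + e) * Phi x t by apply: ruin_probability_le => // m; exact: H1.
suff : (1 - e) * Phi x t <= psi x t by move=> ?; rewrite ler_norml; apply/andP; split; lra.
have [tS|/ltW St] := leP t S1.
  by apply: le_trans (lo t t0 tS); rewrite ler_wpM2r//; lra.
have mono : psi x S1 <= psi x t.
  rewrite !psiE; apply: le_prob; try exact: mruin.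
  by move=> w [s /andP[s0 sS] Ls]; exists s => //; rewrite s0 (le_trans sS).
apply: le_trans (le_trans (lo S1 S10 (lexx _)) mono).
have := H3 x t xx3 St.
have e2 : (1 - e) * (1 + e / 3) <= 1 - e / 3 by nra.
move=> /(ler_wpM2l (_ : 0 <= 1 - e)); rewrite subr_ge0 ltW// => /(_ isT) /le_trans; apply.
by rewrite mulrA ler_wpM2r.
Qed.

End RuinAsymptotics.

Unset Implicit Arguments.
Set Strict Implicit.
Set Printing Implicit Defensive.

Theorem corollary3p1 (R : realType) (d : nat) (dT : measure_display)
  (T : measurableType dT) (P : probability T R)
  (X : nat -> {RV P >-> borel_rV R d})
  (X_iid : iid P X)
  (X_ge0 : forall i w j, 0 <= (X i w : 'rV[R]_d) 0 j)
  (X_neq0 : forall i w, X i w <> (0 : 'rV[R]_d))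
  (theta : nat -> {RV P >-> R})
  (theta_iid : iid P theta)
  (theta_ge0 : forall k w, 0 <= theta k w)
  (theta_nondegenerate : P [set w | theta 0%N w = 0] <> 1%E)
  (p : 'I_d -> T -> R -> R) (C : 'I_d -> R)
  (p_measurable : forall j,
     measurable_fun ([set: T] `*` `[0, +oo[%classic : set (T * R))
       (fun z => p j z.1 z.2))
  (C_gt0 : forall j, 0 < C j)
  (p_bounded : forall j w (t : R), 0 <= t -> 0 <= p j w t <= C j)
  (r : R) (r_ge0 : 0 <= r)
  (l : 'rV[R]_d) (l_gt0 : forall j, 0 < l 0 j) (l_sum1 : \sum_j l 0 j = 1)
  (L : set 'rV[R]_d)
  (L_open : open L)
  (L_decreasing : decreasing_set L)
  (L_convex : convex_complement L)
  (L_boundary : boundary L 0)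
  (L_cone : forall k : R, 0 < k -> dilation k L = L)
  (A_family : ruin_family [set l - y | y in L])
  (X_N_independent : independent_systems P
     (sigma_of [set: nat] X) (sigma_of [set t : R | 0 <= t] (N_ theta))) :
  let A := [set l - y | y in L] in
  let F := distribution P (X 0%N) in
  let psi := ruin_probability P theta X p r l L in
  let phi := claim_integral P theta X r A in
  (class_S A F ->
     forall T0, Lambda P theta T0 ->
       uniformly_equivalent psi phi (Lambda P theta `&` `]0, T0]))
  /\
  (class_A A F ->
     (exists2 eps : R, 0 < eps & P [set w | eps < theta 0%N w] = 1%E) ->
     0 < r ->
     uniformly_equivalent psi phi (Lambda P theta)).
Proof.
have mX i : measurable_fun setT (X i) by exact: measurable_funPT.
move=> A F psi phi; split=> [FS T0 [T00 _]|[FS FD] [eps eps0 gaps] r0].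
  apply: (finite_horizon_equivalence X_iid X_ge0 theta_iid theta_ge0
    theta_nondegenerate p_measurable C_gt0 p_bounded r_ge0 l_gt0 L_open
    L_decreasing L_cone A_family X_N_independent) => //.
  exact: (class_S_double A_family FS).
have [v [q [x0 [v1 q1 decr]]]] := positively_decreasing_survival FS FD.
apply: (infinite_horizon_equivalence X_iid X_ge0 theta_iid theta_ge0
  theta_nondegenerate p_measurable C_gt0 p_bounded r_ge0 l_gt0 L_open
  L_decreasing L_cone A_family X_N_independent _ r0 v1 q1 decr eps0 gaps).
exact: (class_S_double A_family FS).
Qed.
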